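(* Let $\{T^z\}_{z\in\mathbb{Z}^2}$ be a measure-preserving $\mathbb{Z}^2$-action on a Lebesgue space $(X,\mathcal{A},\mu)$, $\mu(X)=1$, such that the diagonal action $\{T^z\times T^z\}_{z\in\mathbb{Z}^2}$ on $(X\times X,\mu\otimes\mu)$ is totally ergodic. Suppose that: 1. the action $\{T^z\}_{z\in\mathbb{Z}^2}$ has simple spectrum; 2. there are positive real numbers $a_j,b_j,c_j$ with $a_j+b_j+c_j=1$, $j\in\{1,2,3\}$, such that each of the operators $$a_1I+b_1\hat T^{(1,0)}+c_1\Theta,\qquad a_2I+b_2\hat T^{(0,1)}+c_2\Theta,\qquad a_3I+b_3\hat T^{(1,1)}+c_3\Theta$$ on $L_2(X,\mu)$ is a weak limit of the action $\{T^z\}_{z\in\mathbb{Z}^2}$. Then the action $\{T^z\times T^z\}_{z\in\mathbb{Z}^2}$ has homogeneous spectrum of multiplicity two.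
   Context: A $\mathbb{Z}^2$-action is a family $\{S^z\}_{z\in\mathbb{Z}^2}$ of measure-preserving automorphisms of a Lebesgue space (standard nonatomic probability space) $(Y,\nu)$ with $S^{z_1}\circ S^{z_2}=S^{z_1+z_2}$ for all $z_1,z_2\in\mathbb{Z}^2$. The automorphism $S^z$ induces the unitary operator $\hat S^z$ on $L_2(Y,\nu)$, $(\hat S^z f)(y)=f(S^z y)$. The action is totally ergodic if $S^z$ is ergodic for every $z\neq 0$. $I$ is the identity operator, $\Theta$ is the orthogonal projection of $L_2$ onto the subspace of constants, and $L_2^0(Y,\nu)=L_2(Y,\nu)\ominus\{\mathrm{const}\}$. An operator $Q$ is a weak limit of the action $\{S^z\}$ if there is a sequence $z_i\in\mathbb{Z}^2$ with $\hat S^{z_i}\to Q$ in the weak operator topology. A subspace $C$ is cyclic for $\{S^z\}$ if there is a vector $h$ such that $C$ is the closed linear span of $\{\hat S^z h: z\in\mathbb{Z}^2\}$. An ergodic action has simple spectrum if $L_2^0(Y,\nu)$ is a cyclic subspace. An action has homogeneous spectrum of multiplicity $n$ if $L_2^0(Y,\nu)$ is an orthogonal direct sum $\bigoplus_{i=1}^n C_i$ of cyclic subspaces such that the restrictions of the action to the $C_i$ are pairwise unitarily equivalent. *)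

(* Defs.v *)
From HB Require Import structures.
From mathcomp Require Import all_boot all_order all_algebra.
From mathcomp Require Import all_classical all_reals all_analysis.
From mathcomp Require Import complex.
Set Implicit Arguments.
Unset Strict Implicit.
Unset Printing Implicit Defensive.
Import Order.TTheory GRing.Theory Num.Theory.
Import numFieldNormedType.Exports.
Local Open Scope classical_set_scope.
Local Open Scope ring_scope.
Local Open Scope complex_scope.

(* Points, sets and maps are taken modulo null sets, as usual for Lebesgue
   spaces.  An element of the complex Hilbert space L_2(mu) is represented by a
   function Y -> R[i], two functions being identified when they agree almost
   everywhere; the subspaces below are sets of functions that are saturated for
   this identification. *)

Section MeasureSpaces.
Context d (Y : measurableType d) (R : realType).
Variable mu : {measure set Y -> \bar R}.

(* A is measurable for the completion of mu, and its completed measure is m. *)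
Definition completed_measure (A : set Y) (m : \bar R) : Prop :=
  exists B, [/\ measurable B, mu.-negligible (A `+` B) & mu B = m].

(* Automorphism modulo 0: a measurable, measure-preserving map with an almost
   everywhere two-sided inverse of the same kind. *)
Definition measure_preserving (S : Y -> Y) : Prop :=
  measurable_fun [set: Y] S /\
  forall A, measurable A -> mu (S @^-1` A) = mu A.

Definition automorphism (S : Y -> Y) : Prop :=
  measure_preserving S /\
  exists S', [/\ measure_preserving S',
    {ae mu, forall y, S' (S y) = y} & {ae mu, forall y, S (S' y) = y}].

Definition ergodic (S : Y -> Y) : Prop :=
  forall A, measurable A -> mu ((S @^-1` A) `+` A) = 0%E ->
    mu A = 0%E \/ mu A = 1%E.

End MeasureSpaces.

(* (Y, mu) is isomorphic modulo 0 to [0, 1] with the Lebesgue measure.  Both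
   sides are completed, so that the sigma-algebra of Y may or may not be
   complete (standard Borel spaces and Rokhlin's complete spaces both qualify). *)
Definition lebesgue_space d (Y : measurableType d) (R : realType)
    (mu : {measure set Y -> \bar R}) : Prop :=
  exists (Y0 : set Y) (I0 : set R) (phi : Y -> R),
    [/\ mu.-negligible (~` Y0),
        I0 `<=` `[0, 1]
          /\ (@lebesgue_measure R).-negligible (`[0, 1] `\` I0),
        set_bij Y0 I0 phi &
        forall (A : set Y) (m : \bar R), A `<=` Y0 ->
          completed_measure mu A m <->
          completed_measure (@lebesgue_measure R) (phi @` A) m].

Section L2.
Context d (Y : measurableType d) (R : realType).
Variable mu : {measure set Y -> \bar R}.
Implicit Types f g h : Y -> R[i].

Definition L2 : set (Y -> R[i]) :=
  [set f | (fun y => complex.Re (f y)) \in Lfun mu 2%:E /\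
           (fun y => complex.Im (f y)) \in Lfun mu 2%:E].

Definition cintegral f : R[i] :=
  (\int[mu]_y complex.Re (f y)) +i* (\int[mu]_y complex.Im (f y)).

Definition inner f g : R[i] := cintegral (fun y => f y * conjc (g y)).

Definition L2norm f : R := Num.sqrt (complex.Re (inner f f)).

(* L_2 minus the constants (orthogonal complement). *)
Definition L2_0 : set (Y -> R[i]) :=
  [set f | L2 f /\ forall c : R[i], inner f (cst c) = 0].

(* The orthogonal projection onto the constants when mu has total mass 1:
   f |-> <f, 1> 1. *)
Definition Theta f : Y -> R[i] := cst (inner f (cst 1)).

End L2.

Lemma Theta_orthogonal d (Y : measurableType d) (R : realType)
    (mu : probability Y R) (f : Y -> R[i]) (c : R[i]) :
  L2 mu f -> inner mu (fun y => f y - Theta mu f y) (cst c) = 0.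
Proof.
move=> [fR fI]; have mufin : mu [set: Y] \is a fin_num by rewrite probability_setT.
have {}fR := (Lfun1_integrable _ _).1 (Lfun_subset12 mufin fR).
have {}fI := (Lfun1_integrable _ _).1 (Lfun_subset12 mufin fI).
have Rint_cst (k : R) : \int[mu]_y k = k.
  rewrite Rintegral_cst//.
  have -> : (mu : {measure set Y -> \bar R}) [set: Y] = 1%E
    by exact: probability_setT.
  by rewrite /= mulr1.
have Theta_cst : inner mu f (cst 1) = cintegral mu f.
  by congr cintegral; apply/funext => y; rewrite -[RHS]mulr1;
    congr (_ * _); exact: conjc1.
have int_lin (g : Y -> R) (k l : R) : mu.-integrable [set: Y] (EFin \o g) ->
    mu.-integrable [set: Y] (EFin \o (fun y => (g y - k) * l)) /\
    \int[mu]_y ((g y - k) * l) = (\int[mu]_y g y - k) * l.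
  move=> gi; have ki : mu.-integrable [set: Y] (EFin \o (cst k : Y -> R)).
    by apply: (Lfun1_integrable _ _).1; apply: Lfun_cst.
  have gki : mu.-integrable [set: Y] (EFin \o (fun y => g y - k)).
    by rewrite (_ : _ \o _ = (EFin \o g) \- (EFin \o cst k))%E//;
      exact: integrableB.
  split; last by rewrite RintegralZr// RintegralB// Rint_cst.
  rewrite (_ : _ \o _ = (fun y => ((EFin \o (fun y => g y - k)%R) y * l%:E)%E))//.
  exact: integrableZr.
rewrite /inner /Theta Theta_cst /cintegral; case: c => c1 c2 /=.
set k1 := \int[mu]_y complex.Re (f y); set k2 := \int[mu]_y complex.Im (f y).
have [iR1 eR1] := int_lin _ k1 c1 fR; have [iR2 eR2] := int_lin _ k1 (- c2) fR.
have [iI1 eI1] := int_lin _ k2 c1 fI; have [iI2 eI2] := int_lin _ k2 (- c2) fI.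
rewrite (_ : (fun y => complex.Re _) =
  fun y => (complex.Re (f y) - k1) * c1 - (complex.Im (f y) - k2) * - c2); last first.
  by apply/funext => y; case: (f y).
rewrite (_ : (fun y => complex.Im _) =
  fun y => (complex.Re (f y) - k1) * - c2 + (complex.Im (f y) - k2) * c1); last first.
  by apply/funext => y; case: (f y).
rewrite RintegralB// RintegralD// eR1 eR2 eI1 eI2 !subrr !mul0r subrr addr0.
by [].
Qed.

Section Actions.
Context d (Y : measurableType d) (R : realType).
Variable mu : {measure set Y -> \bar R}.
Variable S : int * int -> Y -> Y.
Implicit Types (C D : set (Y -> R[i])) (f g h : Y -> R[i]) (z : int * int).

Definition Z2_action : Prop :=
  (forall z, automorphism mu (S z)) /\
  (forall z1 z2, {ae mu, forall y, S z1 (S z2 y) = S (z1 + z2) y}).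

Definition totally_ergodic : Prop := forall z, z != 0 -> ergodic mu (S z).

Definition koopman z f : Y -> R[i] := fun y => f (S z y).

Definition weak_limit (Q : (Y -> R[i]) -> Y -> R[i]) : Prop :=
  exists zs : nat -> int * int, forall f g, L2 mu f -> L2 mu g ->
    (inner mu (koopman (zs n) f) g : R[i]^o) @[n --> \oo] -->
      (inner mu (Q f) g : R[i]^o).

(* The closed linear span of the orbit of h; a linear combination is coded by
   the list of its (index, coefficient) pairs. *)
Definition cyclic_span h : set (Y -> R[i]) :=
  [set f | L2 mu f /\ forall e : R, 0 < e ->
     exists s : seq ((int * int) * R[i]),
       L2norm mu (fun y => f y - \sum_(p <- s) p.2 * koopman p.1 h y) < e].

Definition cyclic C : Prop := exists2 h, L2 mu h & C = cyclic_span h.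

Definition simple_spectrum : Prop := cyclic (L2_0 mu).

(* A unitary operator from C onto D, intertwining the restrictions of the
   action. *)
Definition unitarily_equivalent C D : Prop :=
  exists U : (Y -> R[i]) -> (Y -> R[i]),
    [/\ forall f, C f -> D (U f),
        forall (a b : R[i]) f g, C f -> C g ->
          {ae mu, forall y,
             U (fun y => a * f y + b * g y) y = a * U f y + b * U g y},
        forall f g, C f -> C g -> inner mu (U f) (U g) = inner mu f g,
        forall g, D g -> exists2 f, C f & {ae mu, forall y, U f y = g y} &
        forall z f, C f ->
          {ae mu, forall y, U (koopman z f) y = koopman z (U f) y}].

Definition homogeneous_spectrum (n : nat) : Prop :=
  exists C : 'I_n -> set (Y -> R[i]),
    [/\ forall i, cyclic (C i),
        forall i j, i != j ->
          forall f g, C i f -> C j g -> inner mu f g = 0,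
        L2_0 mu = [set f | L2 mu f /\
          exists2 c : 'I_n -> (Y -> R[i]), (forall i, C i (c i)) &
            {ae mu, forall y, f y = \sum_(i < n) c i y}] &
        forall i j, unitarily_equivalent (C i) (C j)].

End Actions.

Definition diagonal_action (X : Type) (T : int * int -> X -> X) :
    int * int -> X * X -> X * X :=
  fun z x => (T z x.1, T z x.2).

Definition mixed_operator d (X : measurableType d) (R : realType)
    (mu : {measure set X -> \bar R}) (T : int * int -> X -> X)
    (a b c : R) (z : int * int) (f : X -> R[i]) : X -> R[i] :=
  fun x => a%:C * f x + b%:C * koopman T z f x + c%:C * Theta mu f x.

(* Main.v *)
(** Write [H] for L_2(mu), [o] for the constant function 1, [H0] for its
    orthogonal complement, [U z] for the Koopman operators, [V z z'] for
    U^z (x) U^z' on L_2(mu \x mu), and [F] for the flip.  The two cyclic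
    subspaces are the symmetric and the antisymmetric functions orthogonal to
    [o (x) o].

    If [h] is cyclic in [H0], then [h (x) h + h (x) o + o (x) h] is cyclic in the
    symmetric part.  Let [w] be symmetric, orthogonal to [o (x) o] and to the
    orbit of this vector.  Letting U^(z_i) tend to a I + b U^e + c Theta shows
    that a combination of [w] and of its translates is orthogonal to every
    U^z h (x) U^z h; the same limits, in three directions [e], show that a symmetric
    vector orthogonal to these is orthogonal to [H0 (x) H0].  In terms of the
    slices [m g] of [w] this reads
      (b(1-b) U^-e - ab) m (U^e g) = (ab U^-e - a(1-a)) m g.
    When a(1-a) <> b(1-b) the slices would grow geometrically along an orbit,
    whereas they are bounded; otherwise suitable norms of them are constant along
    the orbits, and they vanish because the action is mixing along some sequence.

    The unitary V^(e,-e) commutes with the diagonal action and is conjugated to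
    its inverse by [F].  Hence the sign of its imaginary part commutes with the
    action and exchanges the symmetric and the antisymmetric part.  Using
    e = (0, 1) on the kernel of the sign obtained from e = (1, 0), one gets an
    involution on the complement of [o (x) o], again by mixing. *)

Require Import Defs.
From HB Require Import structures.
From mathcomp Require Import all_boot all_order all_algebra.
From mathcomp Require Import all_classical all_reals all_analysis.
From mathcomp Require Import measurable_realfun.
From mathcomp Require Import complex.
From mathcomp Require Import ring lra zify.
Set Implicit Arguments.
Unset Strict Implicit.
Unset Printing Implicit Defensive.
Import Order.TTheory GRing.Theory Num.Theory.
Import numFieldNormedType.Exports.
Local Open Scope classical_set_scope.
Local Open Scope ring_scope.
Local Open Scope complex_scope.

(** * Hilbert spaces *)

(** On the spectral side [K] lives over pairs (s, t) of characters of Z^2, the diagonal action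
    multiplies by (s t)^z and [F] exchanges s and t; multiplicity two says that the product s t
    determines the unordered pair. No spectral measure is formed: this injectivity appears as the
    totality of an orbit, and the choice of an order in each pair as a sign, that of the sine of the
    angle of s_1 / t_1, then of s_2 / t_2. Both sines vanish only where s^2 = t^2, whence the even
    indices.

    The term h (x) o + o (x) h is forced: besides the symmetric square of H0, the symmetric part
    contains a copy of H0, and one vector has to generate both. The limits Q separate them, because
    Q x (x) Q x is quadratic in a and b while Q x (x) o is linear; eliminating the linear terms
    leaves a^2 - a, b^2 - b and ab. Theta vanishes on H0, but c > 0 means a + b < 1: the powers of Q
    tend to 0 on H0, which gives mixing, and ab is smaller than a(1-a) and b(1-b), which makes the
    operators acting on the slices injective. *)

Record hilbert (R : realType) := Hilbert {
  hsort :> lmodType R[i];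
  ip : hsort -> hsort -> R[i];
  ipDl : forall x y z, ip (x + y) z = ip x z + ip y z;
  ipZl : forall a x z, ip (a *: x) z = a * ip x z;
  ipC : forall x y, ip y x = conjc (ip x y);
  ip_ge0 : forall x, 0 <= complex.Re (ip x x);
  ip_eq0 : forall x, complex.Re (ip x x) = 0 -> x = 0;
  hilbert_complete : forall u : nat -> hsort,
    (forall e : R, 0 < e -> exists N, forall m n, (N <= m)%N -> (N <= n)%N ->
       complex.Re (ip (u m - u n) (u m - u n)) < e) ->
    exists l, forall e : R, 0 < e -> exists N, forall n, (N <= n)%N ->
       complex.Re (ip (u n - l) (u n - l)) < e }.

Section ComplexFacts.
Variable R : realType.
Implicit Types a b : R[i].

Lemma ReD a b : complex.Re (a + b) = complex.Re a + complex.Re b.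
Proof. by case: a b => [? ?] [? ?]. Qed.

Lemma ReN a : complex.Re (- a) = - complex.Re a.
Proof. by case: a. Qed.

Lemma ReZ (r : R) a : complex.Re (r%:C * a) = r * complex.Re a.
Proof. by case: a => x y /=; rewrite mul0r subr0. Qed.

Lemma Re_conjc a : complex.Re (conjc a) = complex.Re a.
Proof. by case: a. Qed.

Lemma conjcD a b : conjc (a + b) = conjc a + conjc b.
Proof. exact: rmorphD. Qed.

Lemma conjcM a b : conjc (a * b) = conjc a * conjc b.
Proof. exact: rmorphM. Qed.

Lemma conjcN a : conjc (- a) = - conjc a.
Proof. exact: rmorphN. Qed.

Lemma ReiM a : complex.Re ('i * a) = - complex.Im a.
Proof. by rewrite mulrC ReiNIm. Qed.

Lemma complex_eq0 a : complex.Re a = 0 -> complex.Im a = 0 -> a = 0.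
Proof. by case: a => x y /= -> ->. Qed.

Lemma Re_le_normc a : complex.Re a <= Normc.normc a.
Proof.
by apply: le_trans (ler_norm _) _; rewrite -lecR; exact: normc_ge_Re.
Qed.

Lemma normcE_sqr a : (Normc.normc a) ^+ 2 = complex.Re (a * conjc a).
Proof.
case: a => x y /=; rewrite sqr_sqrtr ?addr_ge0 ?sqr_ge0//.
by rewrite mulrN opprK !expr2.
Qed.

Lemma normc_real (r : R) : Normc.normc (r%:C) = `|r|.
Proof. by rewrite /= expr0n /= addr0 sqrtr_sqr. Qed.

Lemma normc_ge0 a : 0 <= Normc.normc a.
Proof. by case: a => x y /=; exact: sqrtr_ge0. Qed.

End ComplexFacts.

Section HilbertFacts.
Variables (R : realType) (H : hilbert R).
Implicit Types (x y z : H) (a b : R[i]).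

Definition nsq x : R := complex.Re (ip x x).
Definition hn x : R := Num.sqrt (nsq x).

Lemma ipJ x y : conjc (ip x y) = ip y x. Proof. by rewrite -ipC. Qed.
Lemma ip0l x : ip 0 x = 0 :> R[i].
Proof. by have := ipZl 0 (0 : H) x; rewrite scale0r mul0r. Qed.
Lemma ipNl x y : ip (- x) y = - ip x y.
Proof. by rewrite -scaleN1r ipZl mulN1r. Qed.
Lemma ipBl x y z : ip (x - y) z = ip x z - ip y z.
Proof. by rewrite ipDl ipNl. Qed.
Lemma ipDr x y z : ip x (y + z) = ip x y + ip x z.
Proof. by rewrite ipC ipDl conjcD !ipJ. Qed.
Lemma ipZr a x y : ip x (a *: y) = conjc a * ip x y.
Proof. by rewrite ipC ipZl conjcM ipJ. Qed.
Lemma ip0r x : ip x 0 = 0 :> R[i].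
Proof. by rewrite ipC ip0l conjc0. Qed.
Lemma ipNr x y : ip x (- y) = - ip x y.
Proof. by rewrite ipC ipNl conjcN ipJ. Qed.
Lemma ipBr x y z : ip x (y - z) = ip x y - ip x z.
Proof. by rewrite ipDr ipNr. Qed.
Lemma ip_suml I (s : seq I) (F : I -> H) y :
  ip (\sum_(i <- s) F i) y = \sum_(i <- s) ip (F i) y.
Proof.
elim: s => [|i s IH]; first by rewrite !big_nil ip0l.
by rewrite !big_cons ipDl IH.
Qed.
Lemma ip_sumr I (s : seq I) (F : I -> H) y :
  ip y (\sum_(i <- s) F i) = \sum_(i <- s) ip y (F i).
Proof.
elim: s => [|i s IH]; first by rewrite !big_nil ip0r.
by rewrite !big_cons ipDr IH.
Qed.

Lemma ip_real x : ip x x = (nsq x)%:C.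
Proof.
rewrite /nsq; have := ipC x x; case: (ip x x) => r s [] /eqP.
by rewrite -subr_eq0 opprK -mulr2n mulrn_eq0 /= => /eqP->.
Qed.

Lemma Re_ipC x y : complex.Re (ip y x) = complex.Re (ip x y).
Proof. by rewrite ipC Re_conjc. Qed.

Lemma nsq_ge0 x : 0 <= nsq x. Proof. exact: ip_ge0. Qed.
Lemma hn_ge0 x : 0 <= hn x. Proof. exact: sqrtr_ge0. Qed.
Lemma hn_sqr x : hn x ^+ 2 = nsq x. Proof. by rewrite sqr_sqrtr ?nsq_ge0. Qed.
Lemma nsq_eq0 x : nsq x = 0 -> x = 0. Proof. exact: ip_eq0. Qed.
Lemma hn_eq0 x : hn x = 0 -> x = 0.
Proof. by move=> hx; apply: nsq_eq0; rewrite -hn_sqr hx expr0n. Qed.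
Lemma nsq0 : nsq (0 : H) = 0. Proof. by rewrite /nsq ip0l. Qed.
Lemma hn0 : hn (0 : H) = 0. Proof. by rewrite /hn nsq0 sqrtr0. Qed.

Lemma nsqZ a x : nsq (a *: x) = Normc.normc a ^+ 2 * nsq x.
Proof. by rewrite /nsq ipZl ipZr mulrA ip_real normcE_sqr mulrC ReZ mulrC. Qed.
Lemma hnZ a x : hn (a *: x) = Normc.normc a * hn x.
Proof. by rewrite /hn nsqZ sqrtrM ?sqr_ge0// sqrtr_sqr ger0_norm ?normc_ge0. Qed.
Lemma hnN x : hn (- x) = hn x.
Proof. by rewrite /hn /nsq ipNl ipNr opprK. Qed.
Lemma hnBC x y : hn (x - y) = hn (y - x). Proof. by rewrite -hnN opprB. Qed.

Lemma nsqD x y : nsq (x + y) = nsq x + nsq y + 2 * complex.Re (ip x y).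
Proof.
rewrite /nsq ipDl !ipDr !ReD (Re_ipC x y); lra.
Qed.
Lemma nsqB x y : nsq (x - y) = nsq x + nsq y - 2 * complex.Re (ip x y).
Proof. by rewrite nsqD ipNr ReN mulrN /nsq ipNl ipNr opprK. Qed.

Lemma CauchySchwarz x y : Normc.normc (ip x y) <= hn x * hn y.
Proof.
have [->|y0] := eqVneq y 0; first by rewrite ip0r hn0 mulr0 Normc.normc0.
have ny : 0 < nsq y.
  by rewrite lt_def nsq_ge0 andbT; apply: contra y0 => /eqP/nsq_eq0 ->.
rewrite -(@ler_pXn2r _ 2)// ?nnegrE ?normc_ge0 ?mulr_ge0 ?hn_ge0//.
rewrite exprMn !hn_sqr.
(* This vector is [nsq y] times the component of [x] orthogonal to [y]. *)
have := nsq_ge0 ((nsq y)%:C *: x - ip x y *: y).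
rewrite nsqB !nsqZ ipZl ipZr ReZ ipJ (ipC x y).
rewrite -(Re_conjc (_ * _)) conjcM conjcK -/(nsq _).
rewrite normc_real ger0_norm ?nsq_ge0// -normcE_sqr.
set n := Normc.normc _ ^+ 2.
move=> h; rewrite -(ler_pM2l ny).
by move: h; nra.
Qed.

Lemma Re_ip_le x y : complex.Re (ip x y) <= hn x * hn y.
Proof. exact: le_trans (Re_le_normc _) (CauchySchwarz _ _). Qed.

Lemma hnD x y : hn (x + y) <= hn x + hn y.
Proof.
rewrite -(@ler_pXn2r _ 2)// ?nnegrE ?addr_ge0 ?hn_ge0//.
rewrite hn_sqr nsqD -!hn_sqr; have := Re_ip_le x y; nra.
Qed.
Lemma hnB x y : hn (x - y) <= hn x + hn y.
Proof. by rewrite -(hnN y); exact: hnD. Qed.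
Lemma hn_dist z x y : hn (x - y) <= hn (x - z) + hn (z - y).
Proof. by have := hnD (x - z) (z - y); rewrite addrA subrK. Qed.

Lemma nsq_lt x (e : R) : 0 < e -> (nsq x < e ^+ 2) = (hn x < e).
Proof. by move=> e0; rewrite -hn_sqr ltr_pXn2r// nnegrE ?hn_ge0 ?ltW. Qed.

Definition hcvg (u : nat -> H) (l : H) :=
  forall e : R, 0 < e -> exists N, forall n, (N <= n)%N -> hn (u n - l) < e.

Lemma hcvg_complete (u : nat -> H) :
  (forall e : R, 0 < e -> exists N, forall m n, (N <= m)%N -> (N <= n)%N ->
     hn (u m - u n) < e) -> exists l, hcvg u l.
Proof.
move=> cu; have [|l hl] := @hilbert_complete _ H u.
  move=> e e0; have [|N hN] := cu (Num.sqrt e); first by rewrite sqrtr_gt0.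
  exists N => m n Nm Nn; rewrite -[ltRHS]sqr_sqrtr ?ltW//.
  by rewrite nsq_lt ?sqrtr_gt0//; exact: hN.
exists l => e e0; have [|N hN] := hl (e ^+ 2); first by rewrite exprn_gt0.
by exists N => n Nn; rewrite -nsq_lt//; exact: hN.
Qed.

Lemma hcvg_small x : (forall e : R, 0 < e -> hn x < e) -> x = 0.
Proof.
move=> h; apply: hn_eq0; apply/eqP; rewrite eq_le hn_ge0 andbT leNgt.
by apply/negP => /h; rewrite ltxx.
Qed.

Lemma hcvg_unique u l l' : hcvg u l -> hcvg u l' -> l = l'.
Proof.
move=> hl hl'; apply/eqP; rewrite -subr_eq0; apply/eqP/hcvg_small => e e0.
have [|N hN] := hl (e / 2); first by rewrite divr_gt0.
have [|N' hN'] := hl' (e / 2); first by rewrite divr_gt0.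
apply: (le_lt_trans (hn_dist (u (maxn N N')) _ _)).
rewrite hnBC [ltRHS]splitr ltrD//; [apply: hN|apply: hN'].
- exact: leq_maxl.
- exact: leq_maxr.
Qed.

Lemma hcvg_cst x : hcvg (fun=> x) x.
Proof. by move=> e e0; exists 0%N => n _; rewrite subrr hn0. Qed.

Lemma hcvgD u v l m : hcvg u l -> hcvg v m -> hcvg (fun n => u n + v n) (l + m).
Proof.
move=> hl hm e e0.
have [|N hN] := hl (e / 2); first by rewrite divr_gt0.
have [|N' hN'] := hm (e / 2); first by rewrite divr_gt0.
exists (maxn N N') => n; rewrite geq_max => /andP[h1 h2].
rewrite opprD addrACA (le_lt_trans (hnD _ _))// [ltRHS]splitr ltrD//.
- exact: hN.
- exact: hN'.
Qed.

Lemma hcvgZ a u l : hcvg u l -> hcvg (fun n => a *: u n) (a *: l).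
Proof.
move=> hl e e0; have p : 0 < Normc.normc a + 1.
  by rewrite ltr_wpDl ?normc_ge0.
have [|N hN] := hl (e / (Normc.normc a + 1)); first by rewrite divr_gt0.
exists N => n /hN; rewrite -scalerBr hnZ ltr_pdivlMr// => h.
by apply: le_lt_trans h; rewrite mulrC ler_wpM2l ?hn_ge0// lerDl.
Qed.

End HilbertFacts.

Definition lin (R : realType) (H K : hilbert R) (A : H -> K) :=
  forall a x y, A (a *: x + y) = a *: A x + A y.
Definition contr (R : realType) (H K : hilbert R) (A : H -> K) :=
  forall x, hn (A x) <= hn x.

Section LinFacts.
Variables (R : realType) (H K : hilbert R) (A : H -> K).
Hypothesis linA : lin A.

Lemma lin0 : A 0 = 0.
Proof.
have := linA (-1) 0 0; rewrite scaleN1r oppr0 addr0 scaleN1r => h.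
by rewrite h addNr.
Qed.
Lemma linD x y : A (x + y) = A x + A y.
Proof. by have := linA 1 x y; rewrite !scale1r. Qed.
Lemma linZ a x : A (a *: x) = a *: A x.
Proof. by have := linA a x 0; rewrite lin0 !addr0. Qed.
Lemma linN x : A (- x) = - A x.
Proof. by rewrite -scaleN1r linZ scaleN1r. Qed.
Lemma linB x y : A (x - y) = A x - A y.
Proof. by rewrite linD linN. Qed.
Lemma lin_sum I (s : seq I) (F : I -> H) :
  A (\sum_(i <- s) F i) = \sum_(i <- s) A (F i).
Proof.
elim: s => [|i s IH]; first by rewrite !big_nil lin0.
by rewrite !big_cons linD IH.
Qed.

Lemma hcvg_contr u l : contr A -> hcvg u l -> hcvg (fun n => A (u n)) (A l).
Proof.
move=> cA hl e /hl[N hN]; exists N => n /hN; rewrite -linB.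
exact: le_lt_trans (cA _).
Qed.

End LinFacts.

(** * Riesz representation on a subspace *)

Section Riesz.
Variables (R : realType) (H : hilbert R) (D : H -> Prop) (phi : H -> R[i]).
Variable M : R.
Hypotheses (D0 : D 0) (Dlin : forall a x y, D x -> D y -> D (a *: x + y)).
Hypothesis phi_lin : forall a x y, phi (a *: x + y) = a * phi x + phi y.
Hypothesis phi_bnd : forall x, D x -> Normc.normc (phi x) <= M * hn x.

(* The representing vector is the limit of a minimising sequence of [E] in [D]. *)
Let E (x : H) : R := nsq x - 2 * complex.Re (phi x).

Let E_ge x : D x -> - (M ^+ 2) <= E x.
Proof.
move=> Dx; have := phi_bnd Dx; have := Re_le_normc (phi x).
rewrite /E -hn_sqr; set r := complex.Re _; set n := hn x => h1 h2.
have : 0 <= (n - M) ^+ 2 by rewrite sqr_ge0.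
nra.
Qed.

Let phiD x y : phi (x + y) = phi x + phi y.
Proof. by have := phi_lin 1 x y; rewrite scale1r mul1r. Qed.
Let phiZ a x : phi (a *: x) = a * phi x.
Proof.
have h0 : phi 0 = 0.
  have := phi_lin (-1) 0 0; rewrite scaleN1r oppr0 addr0 mulN1r => h.
  by rewrite h addNr.
by have := phi_lin a x 0; rewrite h0 !addr0.
Qed.

(** [D] is a subspace that may fail to be closed, so the representing vector is only a limit of
    elements of [D]. With [D] the whole space this yields the slices of a tensor; with [D] a span it
    yields the projection onto its closure. *)
Lemma Riesz : exists u, (exists2 us : nat -> H, forall n, D (us n) & hcvg us u)
  /\ forall x, D x -> phi x = ip x u.
Proof.
pose A := [set E x | x in [set x | D x]].
have A0 : A !=set0 by exists (E 0), 0.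
have lbA : has_lbound A.
  by exists (- M ^+ 2) => _ [x Dx <-]; exact: E_ge.
have infA : has_inf A by [].
pose d := inf A.
have dE x : D x -> d <= E x by move=> Dx; apply: ge_inf => //; exists x.
have /choice[us hus] : forall n : nat, exists x, D x /\ E x < d + (n.+1%:R)^-1.
  move=> n; have [|_ [x Dx <-] hx] := @inf_adherent _ A (n.+1%:R^-1) _ infA.
    by rewrite invr_gt0.
  by exists x.
have Dus n : D (us n) by case: (hus n).
(* Parallelogram law: [E] is at least [d] at the midpoint of [x] and [y], so vectors that nearly
   minimise [E] are close to each other. *)
have half x y : D x -> D y -> nsq (x - y) <= 2 * (E x - d) + 2 * (E y - d).
  move=> Dx Dy; have Dm : D ((2^-1)%:C *: (x + y)).
    rewrite -[_ *: _]addr0; apply: Dlin => //.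
    by rewrite -[x]scale1r; apply: Dlin.
  have := dE _ Dm; rewrite /E nsqZ nsqB nsqD phiZ phiD ReZ ReD.
  rewrite normc_real; have -> : `|2^-1 : R| ^+ 2 = 4^-1.
    rewrite real_normK ?num_real//; lra.
  lra.
have inv_small (e : R) : 0 < e -> exists N, forall n, (N <= n)%N -> (n.+1%:R)^-1 < e.
  move=> e0; exists (Num.truncn e^-1) => n Nn; rewrite invf_plt ?posrE//.
  by apply: lt_le_trans (truncnS_gt _) _; rewrite ler_nat.
have [u hu] : exists u, hcvg us u.
  apply: hcvg_complete => e e0.
  have [|N hN] := inv_small (e ^+ 2 / 4); first by rewrite divr_gt0// exprn_gt0.
  exists N => m n /hN hm /hN hn0; rewrite -nsq_lt//.
  have := half _ _ (Dus m) (Dus n); have [_] := hus m; have [_] := hus n.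
  move: hm hn0; move: (m.+1%:R^-1 : R) (n.+1%:R^-1 : R) => p q.
  lra.
exists u; split; first by exists us.
have key x : D x -> complex.Re (ip x u) = complex.Re (phi x).
  move=> Dx; set p := complex.Re (phi x).
  (* First variation: [us n] minimises [E] up to [1 / (n + 1)], so moving it by [s] times [x] cannot
     lower [E] by more. *)
  have step n (s : R) : - (n.+1%:R)^-1 <=
      2 * s * (complex.Re (ip x (us n)) - p) + s ^+ 2 * nsq x.
    have Ds : D (s%:C *: x + us n) by apply: Dlin.
    have := dE _ Ds; have [_] := hus n; rewrite /E nsqD nsqZ phi_lin ReD ReZ ipZl ReZ.
    rewrite normc_real real_normK ?num_real//.
    rewrite -/p; move: (n.+1%:R^-1 : R) => r; lra.
  pose q := complex.Re (ip x u) - p.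
  have lims (s : R) : 0 <= 2 * s * q + s ^+ 2 * nsq x.
    rewrite leNgt; apply/negP => neg.
    set t := 2 * s * q + _ in neg.
    have t4 : 0 < - t / 4 by lra.
    have [N1 hN1] := inv_small _ t4.
    have dpos : 0 < 2 * `|s| * hn x + 1.
      by rewrite ltr_wpDl// !mulr_ge0// hn_ge0.
    have [|N2 hN2] := hu ((- t / 4) / (2 * `|s| * hn x + 1)).
      by rewrite divr_gt0.
    pose n := maxn N1 N2.
    have := hN1 n (leq_maxl _ _); have := hN2 n (leq_maxr _ _).
    rewrite ltr_pdivlMr// => c1.
    have := step n s; move: (n.+1%:R^-1 : R) => r + c2.
    have -> : complex.Re (ip x (us n)) - p = q + complex.Re (ip x (us n - u)).
      by rewrite ipBr ReD ReN /q; lra.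
    have : s * complex.Re (ip x (us n - u)) <= `|s| * (hn x * hn (us n - u)).
      apply: le_trans (ler_norm _) _; rewrite normrM ler_wpM2l//.
      apply: le_trans (CauchySchwarz _ _); rewrite -lecR; exact: normc_ge_Re.
    move: c1 c2 neg; rewrite /t.
    set X : R := s * complex.Re _; set Y := hn (_ - _); set Z : R := `|s| * _.
    have Y0 : 0 <= Y by exact: hn_ge0.
    have -> : 2 * s * (q + complex.Re (ip x (us n - u))) = 2 * s * q + 2 * X.
      by rewrite /X; ring.
    have -> : Y * (2 * `|s| * hn x + 1) = 2 * Z + Y by rewrite /Z; ring.
    lra.
  have q0 : q = 0.
    apply/eqP; rewrite -sqrf_eq0 eq_le sqr_ge0 andbT.
    have np : 0 < nsq x + 1 by rewrite ltr_wpDl ?nsq_ge0.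
    (* The minimum of the quadratic in [s], with [nsq x + 1] in place of [nsq x] so that the
       denominator is never 0. *)
    have := lims (- q / (nsq x + 1)).
    have -> : 2 * (- q / (nsq x + 1)) * q + (- q / (nsq x + 1)) ^+ 2 * nsq x =
       - (q ^+ 2 * ((nsq x + 2) / (nsq x + 1) ^+ 2)).
      by field; lra.
    rewrite oppr_ge0 pmulr_lle0// divr_gt0// ?exprn_gt0//.
    have := nsq_ge0 x; lra.
  by move: q0; rewrite /q; lra.
move=> x Dx; apply/eqP; rewrite -subr_eq0; apply/eqP/complex_eq0.
  by rewrite ReD ReN key// subrr.
(* The real parts at ['i *: x] are the imaginary parts at [x], up to sign. *)
have Dix : D ('i *: x) by rewrite -[_ *: _]addr0; exact: Dlin.
have := key _ Dix; rewrite ipZl phiZ !ReiM => /oppr_inj h.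
by move: h; case: (ip x u) => ? ?; case: (phi x) => ? ? /= ->; rewrite subrr.
Qed.

End Riesz.

(** * Projections, total sets and the sign of a self-adjoint operator *)

Section Projection.
Variables (R : realType) (H : hilbert R) (D : H -> Prop).
Hypotheses (D0 : D 0) (Dlin : forall a x y, D x -> D y -> D (a *: x + y)).

Lemma projection w :
  exists u, (exists2 us : nat -> H, forall n, D (us n) & hcvg us u)
    /\ forall x, D x -> ip x (w - u) = 0.
Proof.
have [||u [hu uP]] := @Riesz _ H D (fun x => ip x w) (hn w) D0 Dlin.
- by move=> a x y; rewrite ipDl ipZl.
- by move=> x _; rewrite mulrC; exact: CauchySchwarz.
by exists u; split=> // x /uP; rewrite ipBr => ->; rewrite subrr.
Qed.

Lemma total_dense : (forall w, (forall x, D x -> ip x w = 0) -> w = 0) ->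
  forall w (e : R), 0 < e -> exists2 x, D x & hn (w - x) < e.
Proof.
move=> tot w e e0; have [u [[us Dus hu] uP]] := projection w.
have /eqP := tot _ uP; rewrite subr_eq0 => /eqP ->.
by have [N /(_ _ (leqnn _)) h] := hu _ e0; exists (us N); rewrite // hnBC.
Qed.

End Projection.

Section Limits.
Variable R : realType.

Lemma normcD (a b : R[i]) :
  Normc.normc (a + b) <= Normc.normc a + Normc.normc b.
Proof. exact: le_normcD. Qed.

Lemma normcN (a : R[i]) : Normc.normc (- a) = Normc.normc a.
Proof. exact: normcN. Qed.

Lemma normc_small (a : R[i]) : (forall e, 0 < e -> Normc.normc a <= e) -> a = 0.
Proof.
move=> h; apply: Normc.eq0_normc; apply/eqP; rewrite eq_le normc_ge0 andbT.
by apply/ler_addgt0Pr => e /h; rewrite add0r.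
Qed.

Lemma ip_lim (H H' : hilbert R) (u : nat -> H) l y (v : nat -> H') m x :
  hcvg u l -> hcvg v m -> (forall n, ip (u n) y = ip x (v n)) ->
  ip l y = ip x m.
Proof.
move=> hu hv uv; apply/eqP; rewrite -subr_eq0; apply/eqP/normc_small => e e0.
have d0 : 0 < hn x + hn y + 1 by rewrite ltr_wpDl// addr_ge0 ?hn_ge0.
have [|N hN] := hu (e / (hn x + hn y + 1)); first by rewrite divr_gt0.
have [|N' hN'] := hv (e / (hn x + hn y + 1)); first by rewrite divr_gt0.
have := hN _ (leq_maxl N N'); have := hN' _ (leq_maxr N N').
set n := maxn N N'; rewrite !ltr_pdivlMr// => h1 h2.
have -> : ip l y - ip x m = ip x (v n - m) - ip (u n - l) y.
  by rewrite ipBr ipBl uv; ring.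
apply: le_trans (normcD _ _) _; rewrite normcN.
have := CauchySchwarz x (v n - m); have := CauchySchwarz (u n - l) y.
have := hn_ge0 x; have := hn_ge0 y; have := hn_ge0 (u n - l).
have := hn_ge0 (v n - m); move: h1 h2.
move: (hn x) (hn y) (hn _) (hn _) (Normc.normc _) (Normc.normc _).
move=> X Y' U V a b; nra.
Qed.

End Limits.

Section SignOperator.
Variables (R : realType) (K : hilbert R) (S : K -> K).
Hypotheses (linS : lin S) (contrS : contr S).
Hypothesis saS : forall x y, ip (S x) y = ip x (S y).
Implicit Types (p q : {poly R}) (x y w : K).

(* The sign of S is the strong limit of S q_n(T), where
   q_(n+1) = q_n (1 + r_n / 2) and r_n = 1 - (1 - X) q_n^2
   is Newton's iteration for (1 - X)^(-1/2).  The q_n and the r_n have nonnegative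
   coefficients and X^(n+1) divides r_n, so that convergence follows from the
   positivity of the moments <T^n w, w>. *)
Let T x := x - S (S x).

Let linT : lin T.
Proof.
move=> a x y; rewrite /T !linS; rewrite scalerBr opprD.
by rewrite !addrA; congr (_ + _); rewrite addrAC.
Qed.

Let saT x y : ip (T x) y = ip x (T y).
Proof. by rewrite /T ipBl ipBr !saS. Qed.

Let lin_iter n : lin (iter n T).
Proof. by move=> a x y; elim: n => //= n ->; rewrite linT. Qed.

Let sa_iter n x y : ip (iter n T x) y = ip x (iter n T y).
Proof. by elim: n x y => //= n IH x y; rewrite saT IH -iterSr. Qed.

Let pev p x := \sum_(i < size p) (p`_i)%:C *: iter i T x.

Let pevE n p x : (size p <= n)%N ->
  pev p x = \sum_(i < n) (p`_i)%:C *: iter i T x.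
Proof.
move=> pn; rewrite /pev.
rewrite (big_ord_widen n (fun i => (p`_i)%:C *: iter i T x) pn) big_mkcond /=.
apply: eq_bigr => i _; case: ltnP => // /(nth_default 0) ->.
by rewrite scale0r.
Qed.

Let pevD p q x : pev (p + q) x = pev p x + pev q x.
Proof.
rewrite (@pevE (maxn (size p) (size q))) ?size_polyD//.
rewrite (@pevE (maxn (size p) (size q)) p) ?leq_maxl//.
rewrite (@pevE (maxn (size p) (size q)) q) ?leq_maxr// -big_split/=.
by apply: eq_bigr => i _; rewrite coefD rmorphD scalerDl.
Qed.

Let pevC c x : pev c%:P x = c%:C *: x.
Proof. by rewrite (@pevE 1) ?size_polyC ?leq_b1// big_ord1 coefC. Qed.

Let pevMX p x : pev (p * 'X) x = pev p (T x).
Proof.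
rewrite (@pevE (size p).+1); last first.
  by have [->|p0] := eqVneq p 0; rewrite ?mul0r ?size_poly0// size_mulX.
rewrite big_ord_recl coefMX /= scale0r add0r.
by apply: eq_bigr => i _; rewrite coefMX /= -iterSr.
Qed.

Let pev_comm (A : K -> K) p x : lin A -> (forall y, A (T y) = T (A y)) ->
  A (pev p x) = pev p (A x).
Proof.
move=> linA AT; rewrite /pev lin_sum//; apply: eq_bigr => i _.
rewrite linZ//; congr (_ *: _).
by elim: (nat_of_ord i) => //= n IH; rewrite AT IH.
Qed.

Let lin_pev p : lin (pev p).
Proof.
move=> a x y; rewrite /pev scaler_sumr -big_split; apply: eq_bigr => i _ /=.
by rewrite lin_iter scalerDr !scalerA mulrC.
Qed.

Let pevM p q x : pev (p * q) x = pev p (pev q x).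
Proof.
elim/poly_ind: p q x => [|p c IH] q x.
  by rewrite mul0r -polyC0 !pevC !scale0r.
rewrite mulrDl !pevD -mulrA ['X * q]mulrC mulrA pevMX IH !pevMX pevC.
rewrite [T (pev q x)](@pev_comm T)//; congr (_ + _).
elim/poly_ind: q {IH} x => [|q d IH] x.
  by rewrite mulr0 -polyC0 !pevC scale0r scaler0.
rewrite mulrDr !pevD mulrA pevMX IH -pevMX -polyCM pevC pevC rmorphM scalerDr.
by rewrite scalerA pevMX.
Qed.

Let pevB p q x : pev (p - q) x = pev p x - pev q x.
Proof.
by rewrite -mulN1r -(rmorphN1 (@polyC R)) pevD pevM pevC rmorphN1 scaleN1r.
Qed.

Let pev1 x : pev 1 x = x. Proof. by rewrite -polyC1 pevC scale1r. Qed.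

Let sa_pev p x y : ip (pev p x) y = ip x (pev p y).
Proof.
rewrite /pev ip_suml ip_sumr; apply: eq_bigr => i _.
by rewrite ipZl ipZr sa_iter conjc_real.
Qed.

Let ST x : S (T x) = T (S x).
Proof. by rewrite /T linB. Qed.

Let S_pev p x : S (pev p x) = pev p (S x).
Proof. exact: pev_comm. Qed.

Let mom n w := complex.Re (ip (iter n T w) w).

(** [S (S x) = x - T x], so replacing [w] by [S w] takes differences of consecutive moments. With
    [mom_ge0] this makes the moments decrease, and their telescoping sum gives the rate in
    [mom_small]. *)
Let mom_S n w : mom n (S w) = mom n w - mom n.+1 w.
Proof.
have -> : mom n.+1 w = mom n w - complex.Re (ip (S (S (iter n T w))) w).
  by rewrite /mom iterS {1}/T ipBl ReD ReN.
rewrite opprB addrC subrK /mom -saS.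
by congr (complex.Re (ip (S _) _)); elim: n => //= n ->; rewrite ST.
Qed.

(** An even power of [T] gives a squared norm; an odd one gives [<T x, x> = |x|^2 - |S x|^2], which
    is nonnegative because [S] is a contraction. *)
Let mom_ge0 n w : 0 <= mom n w.
Proof.
rewrite /mom -(odd_double_half n) iterD -addnn iterD.
have cT m x : iter m T (T x) = T (iter m T x) by rewrite -iterSr.
case: (odd n) => /=.
  rewrite -cT sa_iter; set x := iter _ T w.
  rewrite /T ipBl ReD ReN saS subr_ge0 -/(nsq x) -/(nsq (S x)).
  by rewrite -!hn_sqr ler_pXn2r ?nnegrE ?hn_ge0.
by rewrite sa_iter; exact: nsq_ge0.
Qed.

Let Lam w p := complex.Re (ip (pev p w) w).

Let LamE w p : Lam w p = \sum_(i < size p) p`_i * mom i w.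
Proof.
rewrite /Lam /pev ip_suml.
have -> : forall n (F : 'I_n -> R[i]),
    complex.Re (\sum_i F i) = \sum_i complex.Re (F i).
  move=> n F; elim: n F => [|n IH] F; first by rewrite !big_ord0.
  by rewrite !big_ord_recl ReD IH.
by apply: eq_bigr => i _; rewrite ipZl ReZ.
Qed.

Let LamB w p q : Lam w (p - q) = Lam w p - Lam w q.
Proof. by rewrite /Lam pevB ipBl ReD ReN. Qed.

Let nn p := forall i, 0 <= p`_i.

Let Lam_ge0 w p : nn p -> 0 <= Lam w p.
Proof. by move=> pp; rewrite LamE sumr_ge0// => i _; rewrite mulr_ge0. Qed.

Let nnD p q : nn p -> nn q -> nn (p + q).
Proof. by move=> hp hq i; rewrite coefD addr_ge0. Qed.
Let nnM p q : nn p -> nn q -> nn (p * q).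
Proof. by move=> hp hq i; rewrite coefM sumr_ge0// => j _; rewrite mulr_ge0. Qed.
Let nnC c : 0 <= c -> nn c%:P.
Proof. by move=> c0 i; rewrite coefC; case: ifP. Qed.
Let nnXn n : nn 'X^n.
Proof. by move=> i; rewrite coefXn; case: eqP. Qed.
Let nn1 : nn 1. Proof. by rewrite -polyC1; exact: nnC. Qed.

Let Lam_S w p : Lam (S w) p = Lam w ((1 - 'X) * p).
Proof.
rewrite /Lam -S_pev -saS pevM pevB pev1 -['X]mul1r pevMX pev1.
by rewrite /T subKr.
Qed.

Let nsq_pev p w : nsq (pev p w) = Lam w (p * p).
Proof. by rewrite /Lam pevM sa_pev. Qed.

Let h : {poly R} := (2^-1)%:P.
Let h2 : h * 2 = 1.
Proof. by rewrite /h -[2]/(2%:R) -polyC_natr -polyCM mulVf ?polyC1. Qed.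

Fixpoint sign_poly n : {poly R} :=
  if n is m.+1 then
    sign_poly m * (1 + h * (1 - (1 - 'X) * sign_poly m ^+ 2))
  else 1.
Let q n := sign_poly n.
Let r n := 1 - (1 - 'X) * q n ^+ 2.

Let qS n : q n.+1 = q n * (1 + h * r n). Proof. by []. Qed.

(** With s = r_n, [1 - (1 - s) (1 + s/2)^2 = s^2 (3 + s) / 4]. The right side shows both facts
    needed in [rP]: coefficients stay nonnegative, and the order of vanishing at 0 at least
    doubles. *)
Let rS n : r n.+1 = r n * (h * h * r n * (3 + r n)).
Proof.
have e : (1 - 'X) * q n ^+ 2 = 1 - r n by rewrite /r subKr.
rewrite {1}/r qS exprMn mulrA e; move: (r n) => s.
have -> : s * (h * h * s * (3 + s)) =
  (h * 2) ^+ 2 * s ^+ 2 - h ^+ 2 * s ^+ 2 + h ^+ 2 * s ^+ 3 by ring.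
have -> : 1 - (1 - s) * (1 + h * s) ^+ 2 =
  s - h * 2 * s + h * 2 * s ^+ 2 - h ^+ 2 * s ^+ 2 + h ^+ 2 * s ^+ 3 by ring.
by rewrite h2; ring.
Qed.

Let rP n : exists2 t, nn t & r n = 'X^(n.+1) * t.
Proof.
elim: n => [|n [t nt rE]].
  exists 1; first exact: nn1.
  by rewrite /r /q /= expr1n !mulr1 subKr expr1.
have nr : nn (r n) by rewrite rE; exact: nnM.
exists ('X^n * t * (h * h * t * (3 + r n))).
  have n3 : nn 3 by rewrite -[3]/(3%:R) -polyC_natr; exact: nnC.
  by do !apply: nnM => //; do ?[exact: nnC|exact: nnD].
rewrite rS {1 2}rE (exprS _ n.+1) ['X^(n.+1)]exprS; ring.
Qed.

Let nn_r n : nn (r n).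
Proof. by have [t nt ->] := rP n; exact: nnM. Qed.

Let nn_h : nn h. Proof. by apply: nnC; rewrite invr_ge0. Qed.

Let nn_q n : nn (q n).
Proof.
elim: n => [|n IH]; first exact: nn1.
by rewrite qS; apply: nnM => //; apply: nnD; [exact: nn1|exact: nnM].
Qed.

Let nn_qB m n : (n <= m)%N -> nn (q m - q n).
Proof.
move=> /subnK <-; elim: (m - n)%N => [|k IH].
  by rewrite add0n subrr => i; rewrite coef0.
rewrite addSn qS mulrDr mulr1 addrAC; apply: nnD => //.
by apply: nnM => //; exact: nnM.
Qed.

Let r1 n : (r n).[1] = 1.
Proof. by rewrite /r !hornerE /= ?subrr ?mul0r ?subr0. Qed.

Let mom_decr n m w : mom (n + m) w <= mom n w.
Proof.
elim: m => [|m IH]; first by rewrite addn0.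
by apply: le_trans IH; rewrite addnS -subr_ge0 -mom_S mom_ge0.
Qed.

(** The coefficients of [t] are nonnegative with sum 1, so the left side is an average of moments of
    order at least [n], and moments decrease. *)
Let Lam_le n t w : nn t -> t.[1] = 1 -> Lam w ('X^n * t) <= mom n w.
Proof.
move=> nt t1; have -> : Lam w ('X^n * t) = \sum_(i < size t) t`_i * mom (n + i) w.
  rewrite /Lam pevM; have -> y : pev 'X^n y = iter n T y.
    elim: n y => [|n IH] y; first by rewrite expr0 pev1.
    by rewrite exprSr pevMX IH iterSr.
  rewrite sa_iter -[LHS]/(complex.Re (ip (\sum_(i < _) _) _)) ip_suml.
  have -> : forall n (F : 'I_n -> R[i]),
      complex.Re (\sum_i F i) = \sum_i complex.Re (F i).
    move=> k F; elim: k F => [|k IH] F; first by rewrite !big_ord0.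
    by rewrite !big_ord_recl ReD IH.
  by apply: eq_bigr => i _; rewrite ipZl ReZ -sa_iter -iterD.
rewrite -[leRHS]mul1r -t1 horner_coef mulr_suml ler_sum// => i _.
by rewrite expr1n mulr1 ler_wpM2l.
Qed.

(** The moments of [S w] are the differences of those of [w], so the first n + 1 of them sum to at
    most [nsq w]; since they decrease, the last is at most the mean. *)
Let mom_small n w : mom n (S w) <= nsq w / n.+1%:R.
Proof.
rewrite ler_pdivlMr ?ltr0n//.
have sum_le m : \sum_(i < m) mom i (S w) = nsq w - mom m w.
  elim: m => [|m IH]; first by rewrite big_ord0 /mom /= subrr.
  by rewrite big_ord_recr /= IH mom_S; lra.
apply: (@le_trans _ _ (\sum_(i < n.+1) mom i (S w))).
  rewrite mulr_natr -[in X in _ *+ X](card_ord n.+1) -sumr_const ler_sum// => i _.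
  have := mom_decr i (n - i) (S w).
  by rewrite subnKC// -ltnS.
by rewrite sum_le gerBl mom_ge0.
Qed.

Let Y n w := S (pev (q n) w).

Let Y_lin n : lin (Y n).
Proof. by move=> a x y; rewrite /Y lin_pev linS. Qed.

Let Y_sa n x y : ip (Y n x) y = ip x (Y n y).
Proof. by rewrite /Y saS sa_pev -S_pev. Qed.

Let nsqY n w : nsq (Y n w) = Lam (S w) (q n * q n).
Proof. by rewrite /Y S_pev nsq_pev. Qed.

(** The square of [Y n] is [1 - r n] evaluated at [T], and [r n] has nonnegative coefficients. *)
Let Y_contr n : contr (Y n).
Proof.
move=> w; rewrite -(@ler_pXn2r _ 2)// ?nnegrE ?hn_ge0// !hn_sqr.
rewrite nsqY Lam_S; have -> : (1 - 'X) * (q n * q n) = 1 - r n.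
  by rewrite /r subKr expr2.
by rewrite LamB {1}/Lam pev1 gerBl Lam_ge0.
Qed.

(** The difference of the two sides is the value of [Lam (S w)] at 2 q_n (q_m - q_n), whose
    coefficients are nonnegative. Thus the squared norms increase and control the distances, as in
    monotone convergence. *)
Let Y_incr m n w : (n <= m)%N -> nsq (Y m w - Y n w) <= nsq (Y m w) - nsq (Y n w).
Proof.
move=> nm; have -> : nsq (Y m w - Y n w) = Lam (S w) ((q m - q n) * (q m - q n)).
  by rewrite -nsq_pev pevB /Y !S_pev.
rewrite !nsqY -LamB -subr_ge0 -LamB.
have -> : q m * q m - q n * q n - (q m - q n) * (q m - q n) =
  (1 + 1) * (q n * (q m - q n)) by ring.
by apply: Lam_ge0; apply: nnM; [apply: nnD; exact: nn1 | apply: nnM => //; exact: nn_qB].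
Qed.

Let Y_cvg w : exists l, hcvg (fun n => Y n w) l.
Proof.
apply: hcvg_complete => e e0.
pose A := [set nsq (Y n w) | n in [set: nat]].
have supA : has_sup A.
  split; first by exists (nsq (Y 0%N w)), 0%N.
  exists (nsq w) => _ [n _ <-].
  by rewrite -!hn_sqr ler_pXn2r// ?nnegrE ?hn_ge0//; exact: Y_contr.
have [|_ [N _ <-] hN] := @sup_adherent _ A (e ^+ 2) _ supA.
  by rewrite exprn_gt0.
have ub n : nsq (Y n w) <= sup A.
  by apply: ub_le_sup; [case: supA | exists n].
exists N; suff st m n : (N <= n)%N -> (n <= m)%N -> hn (Y m w - Y n w) < e.
  move=> m n Nm Nn; case: (leqP n m) => nm; first exact: st.
  by rewrite hnBC st// ltnW.
move=> Nn nm; rewrite -nsq_lt//; apply: le_lt_trans (Y_incr w nm) _.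
have := ub m; have := Y_incr w Nn; have := nsq_ge0 (Y n w - Y N w).
move: hN; lra.
Qed.

(** The fourth clause says that [J] is an involution off the kernel of [S] and vanishes on it. In
    the last one, [c * c = 1] makes [A] commute with [T], hence with every polynomial in [T], so the
    relation between [A] and [S] passes to each [Y n] and to the limit. It serves with [c = 1] for
    operators commuting with [S] and with [c = -1] for the flip. *)
Lemma sign_operator : exists J : K -> K,
  [/\ lin J, contr J, forall x y, ip (J x) y = ip x (J y),
      (forall x, S (x - J (J x)) = 0) /\ (forall x, S x = 0 -> J x = 0) &
      forall (A : K -> K) (c : R[i]), lin A -> contr A -> c * c = 1 ->
        (forall x, A (S x) = c *: S (A x)) -> forall x, A (J x) = c *: J (A x)].
Proof.
have /choice[J hJ] := Y_cvg; exists J.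
have linJ : lin J.
  move=> a x y; apply: hcvg_unique (hJ _) _.
  rewrite (_ : (fun n => _) = fun n => a *: Y n x + Y n y).
    by apply: hcvgD => //; exact: hcvgZ.
  by apply/funext => n; rewrite Y_lin.
have contrJ : contr J.
  move=> x; apply/ler_addgt0Pr => e e0.
  have [N /(_ _ (leqnn _)) hN] := hJ x _ e0.
  have := hnD (J x - Y N x) (Y N x); rewrite subrK hnBC.
  have := Y_contr N x; lra.
have saJ x y : ip (J x) y = ip x (J y).
  by apply: ip_lim (hJ x) (hJ y) _ => n; exact: Y_sa.
have YY x : hcvg (fun n => Y n (Y n x)) (J (J x)).
  move=> e e0; have e2 : 0 < e / 2 by rewrite divr_gt0.
  have [N1 d1] := hJ x _ e2; have [N2 d2] := hJ (J x) _ e2.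
  exists (maxn N1 N2) => n; rewrite geq_max => /andP[n1 n2].
  apply: le_lt_trans (hn_dist (Y n (J x)) _ _) _; rewrite [ltRHS]splitr.
  rewrite ltrD ?d2// -linB//; apply: le_lt_trans (Y_contr _ _) _; exact: d1.
split=> //.
- split=> [x|x Sx0].
    have lim : hcvg (fun n => S (x - Y n (Y n x))) (S (x - J (J x))).
      apply: hcvg_contr => //; have := hcvgD (hcvg_cst x) (hcvgZ (-1) (YY x)).
      by under eq_fun do rewrite scaleN1r; rewrite scaleN1r.
    apply: hcvg_unique lim _ => e e0.
    exists (Num.truncn (nsq x / e ^+ 2)) => n Nn; rewrite subr0.
    (* The square of r_n is ['X^(2n+2)] times a polynomial with nonnegative coefficients of sum 1,
       so the squared norm of r_n(T) S x is at most a moment of [S x] of order 2n + 2, which is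
       O(1/n). *)
    have -> : S (x - Y n (Y n x)) = pev (r n) (S x).
      rewrite -S_pev; congr S; rewrite /Y !S_pev.
      rewrite /r expr2 (mulrC (1 - 'X)) pevB pev1 !pevM pevB pev1 -['X]mul1r pevMX.
      by rewrite pev1 /T subKr.
    rewrite -nsq_lt// nsq_pev; have [t nt rE] := rP n; rewrite rE.
    have -> : 'X^(n.+1) * t * ('X^(n.+1) * t) = 'X^(n.+1 + n.+1) * (t * t) :> {poly R}.
      by rewrite exprD; ring.
    have t1 : t.[1] = 1.
      by have := r1 n; rewrite rE hornerM hornerXn expr1n mul1r.
    apply: le_lt_trans (Lam_le _ _ _ _) _; first exact: nnM.
      by rewrite hornerM t1 mulr1.
    apply: le_lt_trans (mom_small _ _) _.
    rewrite ltr_pdivrMr ?ltr0n// mulrC -ltr_pdivrMr ?exprn_gt0//.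
    apply: lt_le_trans (truncnS_gt _) _; rewrite ler_nat ltnS.
    by apply: leq_trans Nn _; rewrite addSn ltnW// ltnS leq_addr.
  apply: hcvg_unique (hJ x) _; rewrite (_ : (fun n => _) = fun=> 0).
    exact: hcvg_cst.
  by apply/funext => n; rewrite /Y S_pev Sx0 lin0.
- move=> A c linA contrA c1 AS x.
  have AT y : A (T y) = T (A y).
    by rewrite /T (linB linA) !AS (linZ linS) scalerA c1 scale1r.
  apply: hcvg_unique (hcvg_contr linA contrA (hJ x)) _.
  rewrite (_ : (fun n => _) = fun n => c *: Y n (A x)); first exact: hcvgZ.
  by apply/funext => n; rewrite /Y AS (pev_comm _ _ linA AT).
Qed.

End SignOperator.

(** * The symmetric and antisymmetric parts of the tensor square *)

Section ComplexSequences.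
Variable R : realType.
Implicit Types (u v : nat -> R[i]) (l m : R[i]).
Local Notation normc := Normc.normc.

Definition ccvg u l :=
  forall e : R, 0 < e -> exists N, forall n, (N <= n)%N -> normc (u n - l) < e.

Lemma ccvg_cst l : ccvg (fun=> l) l.
Proof. by move=> e e0; exists 0%N => n _; rewrite subrr Normc.normc0. Qed.

Lemma ccvg_unique u l m : ccvg u l -> ccvg u m -> l = m.
Proof.
move=> hl hm; apply/eqP; rewrite -subr_eq0; apply/eqP/normc_small => e e0.
have [|N hN] := hl (e / 2); first by rewrite divr_gt0.
have [|N' hN'] := hm (e / 2); first by rewrite divr_gt0.
have := hN _ (leq_maxl N N'); have := hN' _ (leq_maxr N N').
set n := maxn N N' => h1 h2.
have -> : l - m = (u n - m) - (u n - l) by ring.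
by apply: le_trans (normcD _ _) _; rewrite normcN; lra.
Qed.

Lemma ccvgD u v l m : ccvg u l -> ccvg v m -> ccvg (fun n => u n + v n) (l + m).
Proof.
move=> hl hm e e0.
have [|N hN] := hl (e / 2); first by rewrite divr_gt0.
have [|N' hN'] := hm (e / 2); first by rewrite divr_gt0.
exists (maxn N N') => n; rewrite geq_max => /andP[/hN h1 /hN' h2].
rewrite opprD addrACA; apply: le_lt_trans (normcD _ _) _; lra.
Qed.

Lemma ccvgM u v l m : ccvg u l -> ccvg v m -> ccvg (fun n => u n * v n) (l * m).
Proof.
move=> hl hm e e0.
have p0 : 0 < normc l + normc m + 1 by rewrite ltr_wpDl// addr_ge0 ?normc_ge0.
pose d := Num.min 1 (e / (2 * (normc l + normc m + 1))).
have d0 : 0 < d by rewrite lt_min ltr01/= divr_gt0// mulr_gt0.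
have d1 : d <= 1 by rewrite ge_min lexx.
have dp : d * (2 * (normc l + normc m + 1)) <= e.
  by rewrite -ler_pdivlMr ?mulr_gt0// ge_min lexx orbT.
have [N hN] := hl d d0; have [N' hN'] := hm d d0.
exists (maxn N N') => n; rewrite geq_max => /andP[/hN h1 /hN' h2].
have -> : u n * v n - l * m =
  (u n - l) * (v n - m) + (l * (v n - m) + (u n - l) * m) by ring.
apply: le_lt_trans (normcD _ _) _.
have := normcD (l * (v n - m)) ((u n - l) * m); rewrite !Normc.normcM.
move: h1 h2 dp p0 d0 d1 (normc_ge0 l) (normc_ge0 m) (normc_ge0 (u n - l))
  (normc_ge0 (v n - m)).
move: (normc (u n - l)) (normc (v n - m)) (normc (_ + _)) (normc l) (normc m).
move=> A B X L M; nra.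
Qed.

Lemma ccvg_sum I (s : seq I) (F : I -> nat -> R[i]) (l : I -> R[i]) :
  (forall i, ccvg (F i) (l i)) ->
  ccvg (fun n => \sum_(i <- s) F i n) (\sum_(i <- s) l i).
Proof.
move=> Fl; elim: s => [|i s IH].
  by rewrite big_nil; under eq_fun do rewrite big_nil; exact: ccvg_cst.
by rewrite big_cons; under eq_fun do rewrite big_cons; exact: ccvgD.
Qed.

Lemma normc_sum I (s : seq I) (F : I -> R[i]) :
  normc (\sum_(i <- s) F i) <= \sum_(i <- s) normc (F i).
Proof.
elim: s => [|i s IH]; first by rewrite !big_nil Normc.normc0.
by rewrite !big_cons; apply: le_trans (normcD _ _) _; rewrite lerD2l.
Qed.

End ComplexSequences.

(** The linear lower bound [y 0 (1 + n k)] of the geometric growth already exceeds [C], unless [y 0]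
    vanishes. *)
Lemma growth0 (R : realType) (y : nat -> R) (k C : R) : 0 < k ->
  (forall n, 0 <= y n) -> (forall n, y n <= C) ->
  (forall n, y n + k * y n <= y n.+1) -> y 0%N = 0.
Proof.
move=> k0 y0 yC yS.
have mono n : y 0%N <= y n.
  elim: n => // n IH; apply: le_trans IH _; apply: le_trans (yS n).
  by rewrite lerDl mulr_ge0// ltW.
have lin n : y 0%N + n%:R * (k * y 0%N) <= y n.
  elim: n => [|n IH]; first by rewrite mul0r addr0.
  apply: le_trans (yS n); rewrite -natr1 mulrDl mul1r addrA lerD//.
  by rewrite ler_pM2l.
apply/eqP; rewrite eq_le y0 andbT leNgt; apply/negP => yp.
have kp : 0 < k * y 0%N by rewrite mulr_gt0.
have := lin (Num.truncn (C / (k * y 0%N))).+1.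
rewrite leNgt => /negP; apply; apply: le_lt_trans (yC _) _.
rewrite ltr_wpDl//; rewrite -ltr_pdivrMr//; exact: truncnS_gt.
Qed.

Lemma pair_span (z : int * int) : z = (1, 0) *~ z.1 + (0, 1) *~ z.2.
Proof.
have f1 (n : int) (x : int * int) : (x *~ n).1 = x.1 *~ n by exact: (raddfMz fst).
have f2 (n : int) (x : int * int) : (x *~ n).2 = x.2 *~ n by exact: (raddfMz snd).
apply/eqP; rewrite -pair_eqE /pair_eq /= !f1 !f2 /=.
by rewrite !intz !mul0rz addr0 add0r !eqxx.
Qed.

Definition parity_classes : seq (int * int) := [:: (0, 0); (1, 0); (0, 1); (1, 1)].

Lemma even_part (z : int * int) :
  exists2 p, p \in parity_classes & exists y, z - p = y + y.
Proof.
have h (n : int) : exists (b : bool) (y : int), n - b%:Z = y + y.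
  case: n => n.
    exists (odd n), (n./2)%:Z; have := odd_double_half n; lia.
  exists (odd n.+1), (- ((odd n.+1 + n.+1./2)%N)%:Z).
  rewrite NegzE; have := odd_double_half n.+1; lia.
case: z => z1 z2; have [b1 [y1 e1]] := h z1; have [b2 [y2 e2]] := h z2.
exists ((b1%:Z, b2%:Z) : int * int).
  by case: b1 {e1}; case: b2 {e2}; rewrite !inE !eqxx ?orbT.
exists ((y1, y2) : int * int); apply/eqP; rewrite -pair_eqE /pair_eq /=.
by rewrite e1 e2 !eqxx.
Qed.

Section HomogeneousSpectrum.
Variables (R : realType) (K : hilbert R) (V : int * int -> K -> K).

Definition closed_span (v x : K) := forall e : R, 0 < e ->
  exists s : seq ((int * int) * R[i]), hn (x - \sum_(p <- s) p.2 *: V p.1 v) < e.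

(* The Hilbert space form of [homogeneous_spectrum]: the i-th cyclic subspace is
   [closed_span (v i)], and [W i j] is the unitary equivalence. *)
Definition homogeneous_complement (o : K) (n : nat) :=
  exists (v : 'I_n -> K) (W : 'I_n -> 'I_n -> K -> K),
  [/\ forall i j x y, i != j -> closed_span (v i) x -> closed_span (v j) y ->
        ip x y = 0,
      forall x, ip x o = 0 <-> exists2 c : 'I_n -> K,
        forall i, closed_span (v i) (c i) & x = \sum_i c i &
      forall i j, [/\ lin (W i j), forall z x, W i j (V z x) = V z (W i j x),
        forall x, closed_span (v i) x -> closed_span (v j) (W i j x),
        forall x y, closed_span (v i) x -> closed_span (v i) y ->
          ip (W i j x) (W i j y) = ip x y &
        forall y, closed_span (v j) y ->
          exists2 x, closed_span (v i) x & W i j x = y]].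

End HomogeneousSpectrum.

Section TensorSquare.
Variables (R : realType) (H K : hilbert R).
Local Notation C := R[i].
Local Notation Z2 := (int * int)%type.
Local Notation normc := Normc.normc.

(* [K] is the tensor square of [H] and [V z z'] is [U z (x) U z']. *)
Variables (U : Z2 -> H -> H) (t : H -> H -> K) (V : Z2 -> Z2 -> K -> K).
Variables (F : K -> K) (o : H).
Hypothesis U_lin : forall z, lin (U z).
Hypothesis ip_U : forall z x y, ip (U z x) (U z y) = ip x y.
Hypothesis UD : forall z w x, U (z + w) x = U z (U w x).
Hypothesis t_linl : forall g, lin (t^~ g).
Hypothesis t_linr : forall f, lin (t f).
Hypothesis ip_t : forall f g f' g', ip (t f g) (t f' g') = ip f f' * ip g g'.
Hypothesis t_total : forall w, (forall f g, ip (t f g) w = 0) -> w = 0.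
Hypothesis V_lin : forall z z', lin (V z z').
Hypothesis ip_V : forall z z' x y, ip (V z z' x) (V z z' y) = ip x y.
Hypothesis V_t : forall z z' f g, V z z' (t f g) = t (U z f) (U z' g).
Hypothesis F_lin : lin F.
Hypothesis ip_F : forall x y, ip (F x) (F y) = ip x y.
Hypothesis F_t : forall f g, F (t f g) = t g f.
Hypothesis o1 : ip o o = 1.
Hypothesis Uo : forall z, U z o = o.

Let H0 x := ip x o = 0.

Let isom_hn (L L' : hilbert R) (A : L -> L') :
  (forall x y, ip (A x) (A y) = ip x y) -> forall x, hn (A x) = hn x.
Proof. by move=> iA x; rewrite /hn /nsq iA. Qed.

Let hn_U z x : hn (U z x) = hn x. Proof. exact: isom_hn. Qed.
Let hn_V z z' x : hn (V z z' x) = hn x. Proof. exact: isom_hn. Qed.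
Let hn_F x : hn (F x) = hn x. Proof. exact: isom_hn. Qed.

Let U0 x : U 0 x = x.
Proof.
apply/eqP; rewrite -subr_eq0; apply/eqP/hn_eq0.
by rewrite -(hn_U 0) (linB (U_lin 0)) -UD addr0 subrr hn0.
Qed.

Let adjU z x y : ip (U z x) y = ip x (U (- z) y).
Proof. by rewrite -(ip_U (- z)) -UD addNr U0. Qed.

Let hn_t f g : hn (t f g) = hn f * hn g.
Proof.
rewrite /hn /nsq ip_t (ip_real f) (ip_real g) -rmorphM/= sqrtrM//.
exact: nsq_ge0.
Qed.

Let tensors x := exists s : seq (H * H), x = \sum_(p <- s) t p.1 p.2.

Let tensors_dense w (e : R) : 0 < e -> exists2 x, tensors x & hn (w - x) < e.
Proof.
apply: total_dense.
- by exists [::]; rewrite big_nil.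
- move=> a _ _ [s ->] [s' ->].
  exists ([seq (a *: p.1, p.2) | p <- s] ++ s').
  rewrite big_cat big_map /= scaler_sumr; congr (_ + _).
  by apply: eq_bigr => p _; rewrite (linZ (t_linl _)).
- move=> w' hw; apply: t_total => f g; apply: hw.
  by exists [:: (f, g)]; rewrite big_seq1.
Qed.

Let eq_on_tensors (A B : K -> K) : lin A -> contr A -> lin B -> contr B ->
  (forall f g, A (t f g) = B (t f g)) -> forall w, A w = B w.
Proof.
move=> lA cA lB cB AB w; apply/eqP; rewrite -subr_eq0; apply/eqP/hcvg_small.
move=> e e0; have [|x [s xE] hx] := @tensors_dense w (e / 2).
  by rewrite divr_gt0.
have -> : A w - B w = A (w - x) - B (w - x).
  rewrite (linB lA) (linB lB) opprB addrA; suff -> : A x = B x by rewrite subrK.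
  by rewrite xE (lin_sum lA) (lin_sum lB); apply: eq_bigr => p _.
apply: le_lt_trans (hnB _ _) _.
by have := cA (w - x); have := cB (w - x); lra.
Qed.

Let contr_V z z' : contr (V z z'). Proof. by move=> x; rewrite hn_V. Qed.
Let contr_F : contr F. Proof. by move=> x; rewrite hn_F. Qed.

Let lin_comp (A B : K -> K) : lin A -> lin B -> lin (fun x => A (B x)).
Proof. by move=> lA lB a x y; rewrite lB lA. Qed.

Let VD z1 z2 w1 w2 x : V z1 w1 (V z2 w2 x) = V (z1 + z2) (w1 + w2) x.
Proof.
apply: (@eq_on_tensors (fun x => V z1 w1 (V z2 w2 x)) (V _ _)) => //.
- exact: lin_comp.
- by move=> y; rewrite !hn_V.
- by move=> f g; rewrite !V_t -!UD.
Qed.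

Let V0 x : V 0 0 x = x.
Proof.
apply: (@eq_on_tensors (V 0 0) id) => //.
- by move=> f g; rewrite V_t !U0.
Qed.

Let FV z z' x : F (V z z' x) = V z' z (F x).
Proof.
apply: (@eq_on_tensors (fun x => F (V z z' x)) (fun x => V z' z (F x))).
- exact: lin_comp.
- by move=> y; rewrite hn_F hn_V.
- exact: lin_comp.
- by move=> y; rewrite hn_V hn_F.
- by move=> f g; rewrite V_t !F_t V_t.
Qed.

Let FF x : F (F x) = x.
Proof.
apply: (@eq_on_tensors (fun x => F (F x)) id) => //.
- exact: lin_comp.
- by move=> y; rewrite !hn_F.
- by move=> f g; rewrite !F_t.
Qed.

Let adjV z z' x y : ip (V z z' x) y = ip x (V (- z) (- z') y).
Proof. by rewrite -(ip_V (- z) (- z')) VD !addNr V0. Qed.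

Let adjF x y : ip (F x) y = ip x (F y).
Proof. by rewrite -ip_F FF. Qed.

Let ip_t_sym w f g : F w = w -> ip (t f g) w = ip (t g f) w.
Proof. by move=> Fw; rewrite -{1}Fw -adjF F_t. Qed.

Let ip_tDl f f' g w : ip (t (f + f') g) w = ip (t f g) w + ip (t f' g) w.
Proof. by rewrite (linD (t_linl g)) ipDl. Qed.
Let ip_tDr f g g' w : ip (t f (g + g')) w = ip (t f g) w + ip (t f g') w.
Proof. by rewrite (linD (t_linr f)) ipDl. Qed.
Let ip_tZl a f g w : ip (t (a *: f) g) w = a * ip (t f g) w.
Proof. by rewrite (linZ (t_linl g)) ipZl. Qed.
Let ip_tZr a f g w : ip (t f (a *: g)) w = a * ip (t f g) w.
Proof. by rewrite (linZ (t_linr f)) ipZl. Qed.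

Lemma slice_exists g w : exists m, forall f, ip (t f g) w = ip f m.
Proof.
have [//|//|||m [_ hm]] := @Riesz _ H (fun=> True) (fun f => ip (t f g) w)
  (hn g * hn w).
- by move=> a x y; rewrite (t_linl g) ipDl ipZl.
- move=> x _; apply: le_trans (CauchySchwarz _ _) _.
  by rewrite hn_t; have -> : hn x * hn g * hn w = hn g * hn w * hn x by ring.
by exists m => f; exact: hm.
Qed.

Let H0_proj x : H0 (x - ip x o *: o).
Proof. by rewrite /H0 ipBl ipZl o1 mulr1 subrr. Qed.

(** The partial inner product of [w] with [g] is made to lie in [H0] by removing its component along
    [o], which test vectors in [H0] do not see. *)
Lemma slice0_exists w : exists m : H -> H, forall g,
  H0 (m g) /\ forall f, H0 f -> ip (t f g) w = ip f (m g).
Proof.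
have /choice[m hm] : forall g, exists m,
    H0 m /\ forall f, H0 f -> ip (t f g) w = ip f m; last by exists m.
move=> g; have [m hm] := slice_exists g w.
exists (m - ip m o *: o); split=> [|f f0]; first exact: H0_proj.
by rewrite ipBr ipZr f0 mulr0 subr0.
Qed.

Definition wlim (zs : nat -> Z2) (Q : H -> H) :=
  forall x y, ccvg (fun n => ip (U (zs n) x) y) (ip (Q x) y).

(** Against a simple tensor the coefficient is a product of two convergent scalar sequences. General
    [w] are reached by density, since all the tensors involved have norm at most [hn f * hn g]. *)
Lemma wlim_tensor zs Q f g w : wlim zs Q -> contr Q ->
  ccvg (fun n => ip (t (U (zs n) f) (U (zs n) g)) w) (ip (t (Q f) (Q g)) w).
Proof.
move=> zQ cQ e e0; have p0 : 0 < hn f * hn g + 1.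
  by rewrite ltr_wpDl// mulr_ge0 ?hn_ge0.
have [|x [s xE] hx] := @tensors_dense w (e / (4 * (hn f * hn g + 1))).
  by rewrite divr_gt0// mulr_gt0.
have cx : ccvg (fun n => ip (t (U (zs n) f) (U (zs n) g)) x) (ip (t (Q f) (Q g)) x).
  rewrite xE ip_sumr; under eq_fun do rewrite ip_sumr.
  apply: ccvg_sum => p; rewrite ip_t; under eq_fun do rewrite ip_t.
  exact: ccvgM.
have [|N hN] := cx (e / 2); first by rewrite divr_gt0.
exists N => n /hN h.
set A := t (U _ f) _ in h *; set B := t (Q f) _ in h *.
have -> : ip A w - ip B w = (ip A x - ip B x) + (ip A (w - x) - ip B (w - x)).
  by rewrite !ipBr; ring.
apply: le_lt_trans (normcD _ _) _.
have bnd D : hn D <= hn f * hn g -> normc (ip D (w - x)) <= e / 4.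
  move=> hD; apply: le_trans (CauchySchwarz _ _) _.
  move: hx; rewrite ltr_pdivlMr ?mulr_gt0// => hx.
  have := hn_ge0 D; have := hn_ge0 (w - x); nra.
have hA : normc (ip A (w - x)) <= e / 4 by apply: bnd; rewrite /A hn_t !hn_U.
have hB : normc (ip B (w - x)) <= e / 4.
  by apply: bnd; rewrite /B hn_t ler_pM ?hn_ge0//; exact: cQ.
have := normcD (ip A (w - x)) (- ip B (w - x)); rewrite normcN; lra.
Qed.

(** * Consequences of one weak limit: mixing and relations for symmetric vectors *)

Section OneLimit.
Variables (zs : nat -> Z2) (a b c : R) (e : Z2).
Hypotheses (a0 : 0 < a) (b0 : 0 < b) (c0 : 0 < c) (abc : a + b + c = 1).
Definition Qop x := a%:C *: x + b%:C *: U e x + c%:C *: (ip x o *: o).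
Hypothesis zsQ : wlim zs Qop.

Let hn_o : hn o = 1.
Proof. by rewrite /hn /nsq o1 /= sqrtr1. Qed.

Let hn_cZ (r : R) (x : H) : 0 < r -> hn (r%:C *: x) = r * hn x.
Proof. by move=> r0; rewrite hnZ normc_real gtr0_norm. Qed.

Lemma contr_Q : contr Qop.
Proof.
move=> x; rewrite /Qop; apply: le_trans (hnD _ _) _.
apply: le_trans (lerD (hnD _ _) (lexx _)) _.
rewrite !hn_cZ// hn_U hnZ hn_o mulr1.
have := CauchySchwarz x o; rewrite hn_o mulr1 => /(ler_wpM2l (ltW c0)).
have : a * hn x + b * hn x + c * hn x = hn x by rewrite -!mulrDl abc mul1r.
lra.
Qed.

Lemma Qo : Qop o = o.
Proof. by rewrite /Qop Uo o1 scale1r -!scalerDl -!rmorphD/= abc scale1r. Qed.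

Lemma Q0 x : H0 x -> Qop x = a%:C *: x + b%:C *: U e x.
Proof. by move=> x0; rewrite /Qop x0 scale0r scaler0 addr0. Qed.

Let H0U z x : H0 x -> H0 (U z x).
Proof. by rewrite /H0 adjU Uo. Qed.

Let H0Q x : H0 x -> H0 (Qop x).
Proof.
by move=> x0; rewrite Q0// /H0 ipDl !ipZl H0U// x0 !mulr0 addr0.
Qed.

(* The powers of [Qop], which tend to 0 on [H0], are weak limits of the action. *)
Lemma mixing (s : seq (H * H)) (eps : R) : 0 < eps ->
  (forall p, p \in s -> H0 p.1) ->
  exists z, forall p, p \in s -> normc (ip (U z p.1) p.2) < eps.
Proof.
move=> e0 sH0.
have fin (P : H * H -> nat -> Prop) (s' : seq (H * H)) :
    (forall p, exists N, forall n, (N <= n)%N -> P p n) ->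
    exists n, forall p, p \in s' -> P p n.
  move=> hP; suff [N hN] : exists N, forall n, (N <= n)%N ->
      forall p, p \in s' -> P p n by exists N; exact: hN.
  elim: s' => [|p s' [N IH]]; first by exists 0%N.
  have [N' hN'] := hP p; exists (maxn N N') => n.
  rewrite geq_max => /andP[h1 h2] q; rewrite inE => /predU1P[->|]; first exact: hN'.
  exact: IH.
(* Induction on [k]: first [n] is chosen so that [U (zs n)] approximates the outermost [Qop] on
   finitely many coefficients; then [U (zs n)] is moved to the second arguments, where it is fixed,
   and the induction hypothesis is applied to the shifted list. *)
have approx k : forall (s' : seq (H * H)) d, 0 < d -> exists z, forall p, p \in s' ->
    normc (ip (U z p.1) p.2 - ip (iter k Qop p.1) p.2) < d.
  elim: k => [|k IH] s' d d0.
    by exists 0 => p _; rewrite U0 subrr Normc.normc0.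
  have [|n hn] := fin (fun p n => normc (ip (U (zs n) (iter k Qop p.1)) p.2 -
      ip (iter k.+1 Qop p.1) p.2) < d / 2) s'.
    by move=> p; apply: zsQ; rewrite divr_gt0.
  have [|z hz] := IH [seq (p.1, U (- zs n) p.2) | p <- s'] (d / 2).
    by rewrite divr_gt0.
  exists (zs n + z) => p ps.
  have /hz/= : (p.1, U (- zs n) p.2) \in [seq (p.1, U (- zs n) p.2) | p <- s'].
    by apply/mapP; exists p.
  move=> h1; have h2 := hn p ps.
  rewrite -[ip (U _ _) _](subrK (ip (U (zs n) (iter k Qop p.1)) p.2)) -addrA.
  rewrite UD (adjU (zs n) (U z _)).
  apply: le_lt_trans (normcD _ _) _; rewrite [ltRHS]splitr.
  by apply: ltrD => //; rewrite (adjU (zs n)).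
have Qk k x : H0 x -> H0 (iter k Qop x) /\ hn (iter k Qop x) <= (a + b) ^+ k * hn x.
  move=> x0; elim: k => [|k [h1 h2]] /=; first by rewrite expr0 mul1r.
  split; first exact: H0Q.
  rewrite Q0//; apply: le_trans (hnD _ _) _; rewrite !hn_cZ// hn_U -mulrDl.
  by rewrite exprS -mulrA ler_pM2l// addr_gt0.
pose M := \sum_(p <- s) hn p.1 * hn p.2.
have M0 : 0 <= M by rewrite sumr_ge0// => p _; rewrite mulr_ge0 ?hn_ge0.
have [k hk] : exists k, M * (a + b) ^+ k < eps / 2.
  have ab1 : `|a + b| < 1 by rewrite gtr0_norm ?addr_gt0// -abc ltrDl.
  have := cvg_expr ab1 => /cvgr0_norm_lt/(_ (eps / (2 * (M + 1)))).
  rewrite divr_gt0 ?mulr_gt0 ?ltr_wpDl// => /(_ isT)[k _ /(_ k (leqnn _))].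
  rewrite /= ger0_norm ?exprn_ge0 ?addr_ge0 ?ltW// => hk; exists k.
  move: hk; rewrite ltr_pdivlMr ?mulr_gt0 ?ltr_wpDl//.
  have : 0 <= (a + b) ^+ k by rewrite exprn_ge0// addr_ge0 ?ltW.
  move: M0 e0; nra.
have [|z hz] := approx k s (eps / 2); first by rewrite divr_gt0.
exists z => p ps; have h1 := hz _ ps.
have [_ h2] := Qk k _ (sH0 _ ps).
have h3 : hn p.1 * hn p.2 <= M.
  rewrite /M (big_rem p)//= lerDl sumr_ge0// => q _; rewrite mulr_ge0 ?hn_ge0//.
have h4 := CauchySchwarz (iter k Qop p.1) p.2.
have -> : ip (U z p.1) p.2 = (ip (U z p.1) p.2 - ip (iter k Qop p.1) p.2) +
  ip (iter k Qop p.1) p.2 by rewrite subrK.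
apply: le_lt_trans (normcD _ _) _; rewrite [ltRHS]splitr ltrD//.
apply: le_lt_trans h4 _; apply: le_lt_trans hk.
apply: le_trans (ler_wpM2r (hn_ge0 _) h2) _.
by rewrite -mulrA mulrC ler_wpM2r// exprn_ge0// addr_ge0 ?ltW.
Qed.

(** The bound is uniform in [f]: approximating [w] by a finite sum of tensors leaves finitely many
    coefficients of [U z g] to be made small. The finite set of shifts [ps] lets the index be
    corrected afterwards to one of prescribed parity. *)
Lemma slice_mixing w g (eps : R) (ps : seq Z2) : H0 g -> 0 < eps ->
  exists z, forall p, p \in ps ->
    forall f, normc (ip (t f (U (z - p) g)) w) <= eps * hn f.
Proof.
move=> g0 e0; have G0 : 0 < 2 * (hn g + 1) by rewrite mulr_gt0 ?ltr_wpDl ?hn_ge0.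
have [|x [s xE] hx] := @tensors_dense w (eps / (2 * (hn g + 1))).
  by rewrite divr_gt0.
pose M := \sum_(q <- s) hn q.1.
have M0 : 0 <= M by rewrite sumr_ge0// => q _; rewrite hn_ge0.
have M1 : 0 < 2 * (M + 1) by rewrite mulr_gt0 ?ltr_wpDl.
have [||z hz] := @mixing [seq (g, U p q.2) | p <- ps, q <- s] (eps / (2 * (M + 1))).
- by rewrite divr_gt0.
- by move=> _ /allpairsP[/= q [_ _ ->]].
exists z => p pps f; set T := t f _.
have h1 : normc (ip T x) <= eps / (2 * (M + 1)) * (M * hn f).
  rewrite xE ip_sumr /M mulr_suml mulr_sumr; apply: le_trans (normc_sum _ _) _.
  rewrite big_seq [leRHS]big_seq; apply: ler_sum => q qs.
  rewrite ip_t Normc.normcM (mulrC (hn q.1)) [leLHS]mulrC.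
  apply: ler_pM; rewrite ?normc_ge0//; last exact: CauchySchwarz.
  apply: ltW; have /hz/= : (g, U p q.2) \in [seq (g, U p q.2) | p <- ps, q <- s].
    by apply/allpairsP; exists (p, q).
  by rewrite -(opprK p) -adjU -UD addrC opprK.
have h2 := CauchySchwarz T (w - x).
have hT : hn T = hn f * hn g by rewrite /T hn_t hn_U.
have -> : ip T w = ip T x + ip T (w - x) by rewrite ipBr addrC subrK.
apply: le_trans (normcD _ _) _.
have h3 : eps / (2 * (M + 1)) * (M * hn f) <= eps / 2 * hn f.
  rewrite mulrA ler_wpM2r ?hn_ge0// mulrAC ler_pdivrMr//.
  have -> : eps / 2 * (2 * (M + 1)) = eps * (M + 1) by field.
  by rewrite ler_pM2l// lerDl.
have h4 : hn T * hn (w - x) <= eps / 2 * hn f.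
  rewrite hT mulrC -mulrA [leRHS]mulrC; move: hx; rewrite ltr_pdivlMr// => hx.
  have := hn_ge0 f; have := hn_ge0 g; have := hn_ge0 (w - x); nra.
lra.
Qed.

Let ip_Qx_Qx w x : F w = w -> H0 x -> ip (t (Qop x) (Qop x)) w =
  (a ^+ 2)%:C * ip (t x x) w + (b ^+ 2)%:C * ip (t (U e x) (U e x)) w
  + (2 * a * b)%:C * ip (t (U e x) x) w.
Proof.
move=> Fw x0; rewrite Q0// !(ip_tDl, ip_tDr, ip_tZl, ip_tZr).
rewrite (ip_t_sym x (U e x) Fw) !(rmorphXn, rmorphM, rmorph_nat) /=.
move: (ip _ _) (ip _ _) (ip _ _) => *; ring.
Qed.

Let real_neq0 (r : R) : 0 < r -> r%:C != 0 :> C.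
Proof. by move=> r0; rewrite (inj_eq (@complexI R) r 0) gt_eqF. Qed.

(** Expanding [t (Qop x) (Qop x)], the limit of vectors orthogonal to [w]: the two square terms are
    orthogonal to [w] by hypothesis, and the cross term remains with the nonzero factor 2ab. *)
Lemma limit_cross w x : F w = w -> H0 x ->
  (forall z, ip (t (U z x) (U z x)) w = 0) -> ip (t (U e x) x) w = 0.
Proof.
move=> Fw x0 h; have hQ : ip (t (Qop x) (Qop x)) w = 0.
  apply: ccvg_unique (wlim_tensor x x w zsQ contr_Q) _.
  by under eq_fun do rewrite h; exact: ccvg_cst.
have hx := h 0; rewrite !U0 in hx.
move: hQ; rewrite ip_Qx_Qx// h hx !mulr0 !add0r => /eqP.
by rewrite mulf_eq0 (negPf (real_neq0 _)) ?mulr_gt0//= => /eqP.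
Qed.

(** [Qop] fixes [o], so the limit of the hypothesis is its analogue with [Qop x] in place of
    [U z x]. Subtracting [a] times the hypothesis at 0 and [b] times the hypothesis at [e] cancels
    all terms containing [o], and changes a^2 into a^2 - a and b^2 into b^2 - b. *)
Lemma limit_relation w x : F w = w -> H0 x ->
  (forall z, ip (t (U z x) (U z x) + t (U z x) o + t o (U z x)) w = 0) ->
  (a * (1 - a))%:C * ip (t x x) w + (b * (1 - b))%:C * ip (t (U e x) (U e x)) w
  - (a * b)%:C * (ip (t (U e x) x) w + ip (t x (U e x)) w) = 0.
Proof.
move=> Fw x0 h.
have hQ : ip (t (Qop x) (Qop x)) w + ip (t (Qop x) (Qop o)) w
    + ip (t (Qop o) (Qop x)) w = 0.
  apply: ccvg_unique (ccvgD (ccvgD (wlim_tensor x x w zsQ contr_Q)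
    (wlim_tensor x o w zsQ contr_Q)) (wlim_tensor o x w zsQ contr_Q)) _.
  rewrite (_ : (fun n => _) = fun=> 0); first exact: ccvg_cst.
  by apply/funext => n; rewrite !Uo -!ipDl h.
have l1 := h 0; have l2 := h e.
move: hQ l1 l2; rewrite ip_Qx_Qx// Qo !U0 Q0// !ipDl.
rewrite !(ip_tDl, ip_tDr, ip_tZl, ip_tZr) (ip_t_sym x (U e x) Fw).
rewrite !(rmorphXn, rmorphM, rmorphB, rmorph1, rmorph_nat) /=.
move: a%:C b%:C => A B.
move: (ip (t x x) w) (ip (t (U e x) (U e x)) w) (ip (t (U e x) x) w) => X Y W.
move: (ip _ _) (ip _ _) (ip _ _) (ip _ _) => p q r s hQ l1 l2.
rewrite -[RHS]oppr0 -{1}hQ; apply/eqP; rewrite -subr_eq0; apply/eqP.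
transitivity (A * (X + s + q) + B * (Y + r + p)); first by ring.
by rewrite l1 l2 !mulr0 addr0.
Qed.

End OneLimit.

Definition limit_at e := exists (zs : nat -> Z2) (a b c : R),
  [/\ 0 < a, 0 < b, 0 < c, a + b + c = 1 & wlim zs (Qop a b c e)].

(** * Three directions: the diagonal orbit is total in the symmetric square of [H0] *)

Section ThreeLimits.
Variable h : H.
Hypothesis h0 : H0 h.
Hypothesis h_total : forall x, H0 x -> (forall z, ip (U z h) x = 0) -> x = 0.
Hypotheses (L10 : limit_at (1, 0)) (L01 : limit_at (0, 1)).
Hypothesis L11 : limit_at (1, 1).

Let H0U z x : H0 x -> H0 (U z x).
Proof. by rewrite /H0 adjU Uo. Qed.

Let diag w := F w = w /\ forall z, ip (t (U z h) (U z h)) w = 0.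

Let diagB w w' : diag w -> diag w' -> diag (w - w').
Proof.
move=> [Fw dw] [Fw' dw']; split; first by rewrite (linB F_lin) Fw Fw'.
by move=> z; rewrite ipBr dw dw' subrr.
Qed.

Let diagV z w : diag w -> diag (V z z w).
Proof.
move=> [Fw dw]; split; first by rewrite FV Fw.
by move=> y; rewrite -[z]opprK -adjV V_t -!UD.
Qed.

(* On sequences of coordinates this is multiplication by the polarised power
   sum x_1^z + x_2^z. *)
Let sop z w := V z 0 w + V 0 z w.

Let F_sop z w : F w = w -> F (sop z w) = sop z w.
Proof. by move=> Fw; rewrite /sop (linD F_lin) !FV Fw addrC. Qed.

(* The set of the z with [G z] contains the three given directions up to sign, and
   s_(z+w) = s_z s_w - (x_1 x_2)^w s_(z-w) makes it all of Z^2. *)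
Let G z := forall w, diag w -> diag (sop z w).

Let ip_sop z y w : F w = w -> ip (t (U y h) (U y h)) (sop z w) =
  2 * ip (t (U (y - z) h) (U y h)) w.
Proof.
move=> Fw; have adj u v x : ip x (V u v w) = ip (V (- u) (- v) x) w.
  by rewrite adjV !opprK.
rewrite /sop ipDr !adj !V_t !oppr0 !U0 -UD (ip_t_sym (U y h) _ Fw) addrC.
by rewrite [- z + y]addrC; ring.
Qed.

(** By [ip_sop], the coefficients of [sop (- e) w] on the diagonal orbit are twice those of [w] at
    [t (U (y + e) h) (U y h)], the cross terms annihilated by [limit_cross]. *)
Let G_limit e : limit_at e -> G (- e).
Proof.
move=> [zs [a [b [c [a0 b0 c0 abc zQ]]]]] w [Fw dw]; split; first exact: F_sop.
move=> y; rewrite ip_sop// opprK addrC UD.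
rewrite (@limit_cross zs a b c e) ?mulr0//; first exact: H0U.
by move=> z; rewrite -!UD.
Qed.

Let GN z : G z -> G (- z).
Proof.
move=> Gz w /Gz /(diagV (- z)); rewrite /sop (linD (V_lin _ _)) !VD addNr addr0.
by rewrite addrC.
Qed.

Let G_rec z w : G z -> G w -> G (z - w) -> G (z + w).
Proof.
move=> Gz Gw Gzw x dx.
have -> : sop (z + w) x = sop z (sop w x) - V w w (sop (z - w) x).
  rewrite /sop !(linD (V_lin _ _)) !VD !addr0 !add0r addrACA (addrC w) subrK.
  by rewrite [V z w x + V 0 _ x]addrC addrACA [V z w x + _]addrC addrK.
by apply: diagB; [apply: Gz; apply: Gw | apply: diagV; apply: Gzw].
Qed.

Let G0 : G 0.
Proof.
move=> w dw; rewrite /sop V0 -[w in _ + w]opprK; apply: diagB => //.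
rewrite -sub0r; apply: diagB => //; rewrite -(subrr w); exact: diagB.
Qed.

Let G_line z w : G w -> G z -> G (z + w) -> forall n : nat, G (z + w *+ n).
Proof.
move=> Gw Gz Gzw n; suff [] : G (z + w *+ n) /\ G (z + w *+ n.+1) by [].
elim: n => [|n [IH1 IH2]]; first by rewrite mulr0n addr0 mulr1n.
by split=> //; rewrite mulrSr addrA; apply: G_rec => //; rewrite mulrSr addrA addrK.
Qed.

Let G_lineZ z w : G w -> G z -> G (z + w) -> forall n : int, G (z + w *~ n).
Proof.
move=> Gw Gz Gzw [n|n]; first exact: G_line.
rewrite NegzE mulrNz -mulNrn; apply: G_line => //; first exact: GN.
by apply: G_rec => //; rewrite ?opprK//; exact: GN.
Qed.

Let G_all z : G z.
Proof.
have g10 : G (1, 0) by rewrite -[(1, 0)]opprK; apply/GN/G_limit.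
have g01 : G (0, 1) by rewrite -[(0, 1)]opprK; apply/GN/G_limit.
have g11 : G (1, 1) by rewrite -[(1, 1)]opprK; apply/GN/G_limit.
have -> : z = (0 + (1, 0) *~ z.1) + (0, 1) *~ z.2.
  by rewrite add0r; exact: pair_span.
(* The recursion propagates along a line from two consecutive points: (0, 0) and (1, 0) give the
   axis, (0, 1) and (1, 1) the parallel line, and these two lines give every vertical line. The
   direction (1, 1) supplies the fourth starting point. *)
apply: G_lineZ => //; first by apply: G_lineZ => //; rewrite add0r.
rewrite add0r addrC; apply: G_lineZ => //.
Qed.

(** [G_all] makes [w] orthogonal to all [t (U z h) (U z' h)], with independent exponents; the
    totality of the orbit of [h] is then used in one variable at a time, on slices. *)
Lemma diag_total w : F w = w -> (forall z, ip (t (U z h) (U z h)) w = 0) ->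
  forall f g, H0 f -> H0 g -> ip (t f g) w = 0.
Proof.
move=> Fw dw.
have W z z' : ip (t (U z h) (U z' h)) w = 0.
  have [_ /(_ z')] := @G_all (z' - z) w (conj Fw dw).
  by rewrite ip_sop// subKr => /eqP; rewrite mulf_eq0 pnatr_eq0 => /eqP.
have slice0 g : (forall z, ip (t (U z h) g) w = 0) ->
    forall f, H0 f -> ip (t f g) w = 0.
  have [m /(_ g)[m0 hm]] := slice0_exists w.
  move=> hg f f0; rewrite hm// (_ : m g = 0) ?ip0r//; apply: h_total => // z.
  by rewrite -hm//; exact: H0U.
move=> f g f0 g0; apply: (slice0) => // z; rewrite ip_t_sym//.
by apply: slice0 => // z'; rewrite W.
Qed.

End ThreeLimits.

(** * Vanishing of the slices of a kernel satisfying the relations *)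

Section Kernel.
Variable w : K.

Let Aop (e : Z2) (p q : R) x := p%:C *: U (- e) x - q%:C *: x.
Let rho e x := complex.Re (ip (U (- e) x) x).

Let linA e p q : lin (Aop e p q).
Proof.
move=> a x y; rewrite /Aop U_lin !scalerDr !scalerN !scalerA opprD addrACA.
by rewrite ![a * _]mulrC.
Qed.

Let A_U z e p q x : U z (Aop e p q x) = Aop e p q (U z x).
Proof.
by rewrite /Aop (linB (U_lin z)) !(linZ (U_lin z)) -!UD [z + _]addrC.
Qed.

Let AA e p q e' p' q' x :
  Aop e p q (Aop e' p' q' x) = Aop e' p' q' (Aop e p q x).
Proof.
by rewrite {1}/Aop A_U [RHS](linB (linA _ _ _)) !(linZ (linA _ _ _)).
Qed.

Let rho_le e x : rho e x <= nsq x.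
Proof.
by apply: le_trans (Re_ip_le _ _) _; rewrite hn_U -hn_sqr expr2.
Qed.

Let rho_ge e x : - nsq x <= rho e x.
Proof.
rewrite lerNl /rho -ReN -ipNl; apply: le_trans (Re_ip_le _ _) _.
by rewrite hnN hn_U -hn_sqr expr2.
Qed.

(** The formula is symmetric in [p] and [q], because [U] is unitary: [Aop e p q x] and [Aop e q p x]
    have the same norm. Both cases below rest on this. *)
Let nsqA e p q x :
  nsq (Aop e p q x) = (p ^+ 2 + q ^+ 2) * nsq x - 2 * p * q * rho e x.
Proof.
rewrite /Aop nsqB !nsqZ !normc_real !real_normK ?num_real// ipZl ipZr.
rewrite conjc_real !ReZ {1}/nsq ip_U -/(nsq x) -/(rho e x); ring.
Qed.

Let nsqA_ge e p q x : 0 < p -> 0 < q -> (p - q) ^+ 2 * nsq x <= nsq (Aop e p q x).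
Proof.
move=> p0 q0; rewrite nsqA; have := rho_le e x.
rewrite -(ler_pM2l (mulr_gt0 p0 q0)); nra.
Qed.

Let nsqA_le e p q x : 0 < p -> 0 < q -> nsq (Aop e p q x) <= (p + q) ^+ 2 * nsq x.
Proof.
move=> p0 q0; rewrite nsqA; have := rho_ge e x.
rewrite -(ler_pM2l (mulr_gt0 p0 q0)); nra.
Qed.

Let A_inj e p q x : 0 < p -> 0 < q -> p != q -> nsq (Aop e p q x) = 0 -> x = 0.
Proof.
move=> p0 q0 pq h; apply: nsq_eq0; apply/eqP; rewrite eq_le nsq_ge0 andbT.
have pq0 : 0 < (p - q) ^+ 2 by rewrite exprn_even_gt0//= subr_eq0.
by rewrite -(ler_pM2l pq0) mulr0 -h nsqA_ge.
Qed.

Let rel e (al be ga : R) := forall f g, H0 f -> H0 g ->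
  al%:C * ip (t f g) w + be%:C * ip (t (U e f) (U e g)) w
  - ga%:C * (ip (t (U e f) g) w + ip (t f (U e g)) w) = 0.

(* [m] is the operator on [H0] whose kernel is [w]. *)
Variable m : H -> H.
Hypothesis m0 : forall g, H0 (m g).
Hypothesis hm : forall g f, H0 f -> ip (t f g) w = ip f (m g).

Let H0U z x : H0 x -> H0 (U z x).
Proof. by rewrite /H0 adjU Uo. Qed.

Let H0A e p q x : H0 x -> H0 (Aop e p q x).
Proof. by move=> x0; rewrite /H0 ipBl !ipZl H0U// x0 !mulr0 subr0. Qed.

(** The relation tested with [f] equal to the difference of the two sides, an element of [H0], says
    that this difference has norm 0. *)
Let A_rel e al be ga g : rel e al be ga -> H0 g ->
  Aop e be ga (m (U e g)) = Aop e ga al (m g).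
Proof.
move=> r g0; apply/eqP; rewrite -subr_eq0; apply/eqP.
set d := _ - _; have d0 : H0 d by rewrite /H0 ipBl !H0A ?subrr.
apply: nsq_eq0; rewrite /nsq (_ : ip d d = 0)//.
rewrite {2}/d /Aop !ipBr !ipZr !conjc_real -!adjU -!hm//; do ?exact: H0U.
by rewrite -[RHS](r d g d0 g0); ring.
Qed.

Let m_bnd g : nsq (m g) <= (hn w * hn g) ^+ 2.
Proof.
have h1 : nsq (m g) <= hn (m g) * (hn w * hn g).
  rewrite {1}/nsq -hm//; apply: le_trans (Re_ip_le _ _) _.
  by rewrite hn_t -mulrA [hn g * _]mulrC.
have : 0 <= (hn (m g) - hn w * hn g) ^+ 2 by rewrite sqr_ge0.
move: h1; rewrite -hn_sqr; nra.
Qed.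

Let growth_step k D n y (y' : R) : 0 < k -> 0 < D -> y <= D * n ->
  y + k * n <= y' -> y + k / D * y <= y'.
Proof.
move=> k0 D0 yD; apply: le_trans; rewrite lerD2l mulrAC ler_pdivrMr//.
by rewrite -mulrA ler_pM2l// mulrC.
Qed.

(* [nsq (Aop e ga al x) - nsq (Aop e be ga x)] has the sign of [al - be], so by
   [A_rel] the slices grow geometrically forwards or backwards along the orbit. *)
Let kernel_neq e al be ga : rel e al be ga -> 0 < ga -> ga < al -> ga < be ->
  al != be -> forall g, H0 g -> m g = 0.
Proof.
move=> r ga0 gaal gabe; have al0 := lt_trans ga0 gaal; have be0 := lt_trans ga0 gabe.
have dif x : nsq (Aop e ga al x) - nsq (Aop e be ga x) =
  (al - be) * ((al + be) * nsq x - 2 * ga * rho e x) by rewrite !nsqA; ring.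
have pos x : (al + be - 2 * ga) * nsq x <= (al + be) * nsq x - 2 * ga * rho e x.
  by rewrite mulrBl lerD2l lerN2 -!mulrA ler_pM2l// ler_pM2l// rho_le.
have abg : 0 < al + be - 2 * ga by lra.
rewrite neq_lt => /orP[albe|beal] g g0.
- have k0 : 0 < (be - al) * (al + be - 2 * ga) by apply: mulr_gt0; rewrite // subr_gt0.
  have D0 : 0 < (ga + al) ^+ 2 by rewrite exprn_gt0 ?addr_gt0.
  (* Along the backward orbit [A_rel] reads [Aop e ga al (x n.+1) = Aop e be ga (x n)], and for
     [al < be] the right side is the larger of the two norms at [x n]. The other case runs
     forwards. *)
  pose x n := m (U (- (e *+ n)) g); have -> : m g = x 0%N by rewrite /x mulr0n oppr0 U0.
  apply: (@A_inj e ga al) => //; first by rewrite lt_eqF.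
  apply: (@growth0 _ (fun n => nsq (Aop e ga al (x n)))
    ((be - al) * (al + be - 2 * ga) / (ga + al) ^+ 2)
    ((ga + al) ^+ 2 * (hn w * hn g) ^+ 2)).
  + by rewrite divr_gt0.
  + by move=> n; exact: nsq_ge0.
  + move=> n; apply: le_trans (nsqA_le _ _ ga0 al0) _.
    rewrite ler_wpM2l ?sqr_ge0//; apply: le_trans (m_bnd _) _.
    by rewrite hn_U.
  + move=> n; have -> : nsq (Aop e ga al (x n.+1)) = nsq (Aop e be ga (x n)).
      rewrite /x -(A_rel r); last exact: H0U.
      rewrite -UD mulrSr opprD addrCA subrr addr0 //.
    apply: growth_step (nsqA_le _ _ ga0 al0) _ => //.
    have := dif (x n); have := pos (x n).
    rewrite -(@ler_pM2l _ (be - al)) ?subr_gt0//; lra.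
- have k0 : 0 < (al - be) * (al + be - 2 * ga) by apply: mulr_gt0; rewrite // subr_gt0.
  have D0 : 0 < (be + ga) ^+ 2 by rewrite exprn_gt0 ?addr_gt0.
  pose x n := m (U (e *+ n) g); have -> : m g = x 0%N by rewrite /x mulr0n U0.
  apply: (@A_inj e be ga) => //; first by rewrite gt_eqF.
  apply: (@growth0 _ (fun n => nsq (Aop e be ga (x n)))
    ((al - be) * (al + be - 2 * ga) / (be + ga) ^+ 2)
    ((be + ga) ^+ 2 * (hn w * hn g) ^+ 2)).
  + by rewrite divr_gt0.
  + by move=> n; exact: nsq_ge0.
  + move=> n; apply: le_trans (nsqA_le _ _ be0 ga0) _.
    rewrite ler_wpM2l ?sqr_ge0//; apply: le_trans (m_bnd _) _.
    by rewrite hn_U.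
  + move=> n; have -> : nsq (Aop e be ga (x n.+1)) = nsq (Aop e ga al (x n)).
      by rewrite /x mulrS UD (A_rel r)//; exact: H0U.
    apply: growth_step (nsqA_le _ _ be0 ga0) _ => //.
    have := dif (x n); have := pos (x n).
    rewrite -(@ler_pM2l _ (al - be)) ?subr_gt0//; lra.
Qed.

(* For [al = be] the two operators in [A_rel] have the same norm at every vector,
   hence [y] below is constant, and mixing makes it small. *)
Let kernel_eq e1 al1 ga1 e2 al2 ga2 :
  rel e1 al1 al1 ga1 -> 0 < ga1 -> ga1 < al1 ->
  rel e2 al2 al2 ga2 -> 0 < ga2 -> ga2 < al2 ->
  (forall z : Z2, z = e1 *~ z.1 + e2 *~ z.2) ->
  (forall g (eps : R), H0 g -> 0 < eps -> exists z,
     forall f, normc (ip (t f (U z g)) w) <= eps * hn f) ->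
  forall g, H0 g -> m g = 0.
Proof.
move=> r1 g1 ga1l r2 g2 ga2l span mix g g0.
have l1 := lt_trans g1 ga1l; have l2 := lt_trans g2 ga2l.
(* Both operators are applied so that both shifts can be followed: a shift by [e1] exchanges [al1]
   and [ga1] in the first factor, which commutes with the second, and leaves the norm unchanged;
   likewise for [e2]. *)
pose y z := nsq (Aop e1 al1 ga1 (Aop e2 al2 ga2 (m (U z g)))).
have swap e p q x : nsq (Aop e p q x) = nsq (Aop e q p x).
  by rewrite !nsqA; ring.
have y1 z : y (z + e1) = y z.
  rewrite /y addrC UD AA (A_rel r1); last exact: H0U.
  rewrite AA swap //.
have y2 z : y (z + e2) = y z.
  rewrite /y addrC UD (A_rel r2); last exact: H0U.
  by rewrite AA swap AA.
have line e : (forall z, y (z + e) = y z) -> forall (n : int) z, y (z + e *~ n) = y z.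
  move=> ye; have L n z : y (z + e *+ n) = y z.
    by elim: n => [|n IH]; rewrite ?mulr0n ?addr0// mulrSr addrA ye.
  move=> [n|n] z; first exact: L.
  by rewrite NegzE mulrNz -[LHS](L n.+1) -pmulrn subrK.
have yc z : y z = y 0.
  by rewrite (span z) line// -[e1 *~ _]add0r line.
pose Cst := (al1 + ga1) ^+ 2 * (al2 + ga2) ^+ 2.
have C0 : 0 < Cst by rewrite mulr_gt0// exprn_gt0// addr_gt0.
have y_small eps : 0 < eps -> y 0 <= Cst * eps ^+ 2.
  move=> eps0; have [z hz] := mix g eps g0 eps0.
  have mz : hn (m (U z g)) <= eps.
    have [->|mn0] := eqVneq (m (U z g)) 0; first by rewrite hn0 ltW.
    have mp : 0 < hn (m (U z g)).
      by rewrite lt_def hn_ge0 andbT; apply: contra mn0 => /eqP/hn_eq0 ->.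
    have := hz (m (U z g)); rewrite hm// ip_real normc_real ger0_norm ?nsq_ge0//.
    by rewrite -hn_sqr expr2 ler_pM2r.
  rewrite -(yc z) /Cst -mulrA; apply: le_trans (nsqA_le _ _ l1 g1) _.
  rewrite ler_wpM2l ?sqr_ge0//; apply: le_trans (nsqA_le _ _ l2 g2) _.
  rewrite ler_wpM2l ?sqr_ge0// -hn_sqr ler_pXn2r ?nnegrE ?hn_ge0//.
  exact: ltW.
have y0 : y 0 = 0.
  apply/eqP; rewrite eq_le nsq_ge0 andbT leNgt; apply/negP => yp.
  have := y_small (Num.sqrt (y 0 / Cst / 2)); rewrite sqrtr_gt0 !divr_gt0//.
  move=> /(_ isT); rewrite sqr_sqrtr; last by rewrite ltW// !divr_gt0.
  have -> : Cst * (y 0 / Cst / 2) = y 0 / 2 by field; rewrite gt_eqF.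
  by move: yp; move: (y 0) => v; lra.
apply: (@A_inj e2 al2 ga2) => //; first by rewrite gt_eqF.
move: y0; rewrite /y U0 => h0.
have ne1 : al1 != ga1 by rewrite gt_eqF.
by rewrite (A_inj l1 g1 ne1 h0) nsq0.
Qed.

Lemma kernel_total e1 a1 b1 c1 e2 a2 b2 c2 :
  (forall z : Z2, z = e1 *~ z.1 + e2 *~ z.2) ->
  [/\ 0 < a1, 0 < b1, 0 < c1 & a1 + b1 + c1 = 1] ->
  [/\ 0 < a2, 0 < b2, 0 < c2 & a2 + b2 + c2 = 1] ->
  rel e1 (a1 * (1 - a1)) (b1 * (1 - b1)) (a1 * b1) ->
  rel e2 (a2 * (1 - a2)) (b2 * (1 - b2)) (a2 * b2) ->
  (forall g (eps : R), H0 g -> 0 < eps -> exists z,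
     forall f, normc (ip (t f (U z g)) w) <= eps * hn f) ->
  forall f g, H0 f -> H0 g -> ip (t f g) w = 0.
Proof.
move=> span [a10 b10 c10 s1] [a20 b20 c20 s2] r1 r2 mix f g f0 g0.
rewrite hm// (_ : m g = 0) ?ip0r//.
(* Positivity of [c] gives [b < 1 - a] and [a < 1 - b]. *)
have bnd (a b c : R) : 0 < a -> 0 < b -> 0 < c -> a + b + c = 1 ->
    a * b < a * (1 - a) /\ a * b < b * (1 - b).
  move=> a0 b0 c0 abc; rewrite [a * b in X in _ /\ X]mulrC !ltr_pM2l//; split; lra.
have [l1 l1'] := bnd _ _ _ a10 b10 c10 s1; have [l2 l2'] := bnd _ _ _ a20 b20 c20 s2.
have g1 : 0 < a1 * b1 by rewrite mulr_gt0.
have g2 : 0 < a2 * b2 by rewrite mulr_gt0.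
have [E1|ne] := eqVneq (a1 * (1 - a1)) (b1 * (1 - b1)); last first.
  exact: kernel_neq r1 g1 l1 l1' ne _ g0.
have [E2|ne] := eqVneq (a2 * (1 - a2)) (b2 * (1 - b2)); last first.
  exact: kernel_neq r2 g2 l2 l2' ne _ g0.
by apply: (kernel_eq (e1 := e1) (al1 := a1 * (1 - a1)) (ga1 := a1 * b1)
  (e2 := e2) (al2 := a2 * (1 - a2)) (ga2 := a2 * b2)) => //;
  [rewrite {2}E1 | rewrite {2}E2].
Qed.

End Kernel.

Lemma decomp w : (forall f g, H0 f -> H0 g -> ip (t f g) w = 0) ->
  (forall f, H0 f -> ip (t f o) w = 0) -> (forall f, H0 f -> ip (t o f) w = 0) ->
  ip (t o o) w = 0 -> w = 0.
Proof.
move=> h1 h2 h3 h4; apply: t_total => f g.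
rewrite -[f](subrK (ip f o *: o)) -[g](subrK (ip g o *: o)).
have := H0_proj f; have := H0_proj g.
move: (g - _) (f - _) => g' f' g0 f0; rewrite !(ip_tDl, ip_tDr, ip_tZl, ip_tZr).
by rewrite (h1 _ _ f0 g0) (h2 _ f0) (h3 _ g0) h4 !mulr0 !addr0.
Qed.

(** * A cyclic vector of the symmetric part *)

Section CyclicVector.
Variable h : H.
Hypothesis h0 : H0 h.
Hypothesis h_total : forall x, H0 x -> (forall z, ip (U z h) x = 0) -> x = 0.
Hypotheses (L10 : limit_at (1, 0)) (L01 : limit_at (0, 1)).
Hypothesis L11 : limit_at (1, 1).

Definition sym_vector := t h h + t h o + t o h.

Theorem sym_vector_total w : F w = w -> ip (t o o) w = 0 ->
  (forall z, ip (V z z sym_vector) w = 0) -> w = 0.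
Proof.
move=> Fw woo hw.
have hw' z : ip (t (U z h) (U z h) + t (U z h) o + t o (U z h)) w = 0.
  by rewrite -(hw z) /sym_vector !(linD (V_lin _ _)) !V_t !Uo.
have H0U z : H0 (U z h) by rewrite /H0 adjU Uo.
have rel e a b c zs : 0 < a -> 0 < b -> 0 < c -> a + b + c = 1 ->
    wlim zs (Qop a b c e) -> forall f g, H0 f -> H0 g ->
    (a * (1 - a))%:C * ip (t f g) w + (b * (1 - b))%:C * ip (t (U e f) (U e g)) w
    - (a * b)%:C * (ip (t (U e f) g) w + ip (t f (U e g)) w) = 0.
  move=> a0 b0 c0 abc zQ.
  (* The relation of [limit_relation] is a pairing with the symmetric vector [w']. It is known on
     the diagonal orbit of [h] only; [diag_total] applied to [w'] polarises it to all [f] and [g] in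
     [H0]. *)
  pose w' := (a * (1 - a))%:C *: w + (b * (1 - b))%:C *: V (- e) (- e) w
    - (a * b)%:C *: (V (- e) 0 w + V 0 (- e) w).
  have w'E f g : ip (t f g) w' = (a * (1 - a))%:C * ip (t f g) w +
      (b * (1 - b))%:C * ip (t (U e f) (U e g)) w
      - (a * b)%:C * (ip (t (U e f) g) w + ip (t f (U e g)) w).
    have adj u v x : ip x (V u v w) = ip (V (- u) (- v) x) w.
      by rewrite adjV !opprK.
    rewrite /w' ipBr !(ipDr, ipZr) !conjc_real !adj !V_t !opprK.
    by rewrite !oppr0 !U0.
  move=> f g f0 g0; rewrite -w'E; apply: (diag_total h0) => //.
    rewrite /w' (linB F_lin) (linD F_lin) !(linZ F_lin) (linD F_lin) !FV Fw.
    by rewrite [V 0 _ w + _]addrC.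
  move=> z; rewrite w'E; apply: (@limit_relation zs a b c e) => //.
  by move=> z'; rewrite -UD.
have HH f g : H0 f -> H0 g -> ip (t f g) w = 0.
  case: L10 => zs1 [a1 [b1 [c1 [a10 b10 c10 s1 z1]]]].
  case: L01 => zs2 [a2 [b2 [c2 [a20 b20 c20 s2 z2]]]].
  have [m /all_and2[m0 hm]] := slice0_exists w.
  apply: (@kernel_total w m m0 hm (1, 0) a1 b1 c1 (0, 1) a2 b2 c2) => //.
  - exact: pair_span.
  - exact: rel z1.
  - exact: rel z2.
  - move=> g' eps g'0 e0.
    have [z hz] := @slice_mixing zs1 a1 b1 c1 (1, 0) a10 b10 c10 s1 z1 w g' eps [:: 0] g'0 e0.
    by exists z => f'; have := hz 0; rewrite inE eqxx subr0; apply.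
have ho z : ip (t (U z h) o) w = 0.
  have := hw' z; rewrite !ipDl HH// add0r (ip_t_sym o)// -mulr2n => /eqP.
  by rewrite mulrn_eq0 => /eqP.
have Ho f : H0 f -> ip (t f o) w = 0.
  have [m /(_ o)[m0 hm]] := slice0_exists w.
  move=> f0; rewrite hm// (_ : m o = 0) ?ip0r//; apply: h_total => // z.
  by rewrite -hm.
by apply: decomp => // f f0; rewrite (ip_t_sym o)// Ho.
Qed.

Lemma F_sym_vector : F sym_vector = sym_vector.
Proof.
by rewrite /sym_vector !(linD F_lin) !F_t -!addrA [t o h + _]addrC.
Qed.

Lemma sym_vector_oo : ip sym_vector (t o o) = 0.
Proof. by rewrite /sym_vector !ipDl !ip_t h0 !(mul0r, mulr0) !addr0. Qed.

(** The projection of [x] onto the closed span of the orbit is again symmetric and orthogonal to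
    [t o o], so [sym_vector_total] applies to the remainder. *)
Lemma sym_vector_dense x (eps : R) : F x = x -> ip x (t o o) = 0 -> 0 < eps ->
  exists s : seq (Z2 * C),
    hn (x - \sum_(p <- s) p.2 *: V p.1 p.1 sym_vector) < eps.
Proof.
move=> Fx xoo e0.
pose D y := exists s : seq (Z2 * C), y = \sum_(p <- s) p.2 *: V p.1 p.1 sym_vector.
have D0 : D 0 by exists [::]; rewrite big_nil.
have Dlin a y y' : D y -> D y' -> D (a *: y + y').
  move=> [s ->] [s' ->]; exists ([seq (p.1, a * p.2) | p <- s] ++ s').
  rewrite big_cat big_map /= scaler_sumr; congr (_ + _).
  by apply: eq_bigr => p _; rewrite scalerA.
have FD y : D y -> F y = y.
  move=> [s ->]; rewrite (lin_sum F_lin); apply: eq_bigr => p _.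
  by rewrite (linZ F_lin) FV F_sym_vector.
have Doo y : D y -> ip y (t o o) = 0.
  move=> [s ->]; rewrite ip_suml big1// => p _.
  by rewrite ipZl adjV V_t !Uo sym_vector_oo mulr0.
have [u [[us Dus hu] uP]] := projection D0 Dlin x.
have Fu : F u = u.
  apply: hcvg_unique (hcvg_contr F_lin contr_F hu) _.
  by under eq_fun do rewrite FD//.
have uoo : ip u (t o o) = 0.
  rewrite -(ip0r (0 : K)); apply: ip_lim hu (hcvg_cst 0) _ => n.
  by rewrite Doo// ip0r.
have : x - u = 0.
  apply: sym_vector_total.
  - by rewrite (linB F_lin) Fx Fu.
  - by rewrite ipC ipBl xoo uoo subrr conjc0.
  - by move=> z; apply: uP; exists [:: (z, 1)]; rewrite big_seq1 scale1r.
move=> /eqP; rewrite subr_eq0 => /eqP xu.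
have [N /(_ N (leqnn _))] := hu _ e0; have [s ->] := Dus N.
by rewrite hnBC -xu => h1; exists s.
Qed.

End CyclicVector.

(** * An involution exchanging the two parities *)

Section SwapOperator.
Hypothesis L10 : limit_at (1, 0).

(* sin(theta), where W = V e (- e) has spectral parameter exp(i theta). *)
Let S e x := (- (2^-1 : C) * 'i) *: (V e (- e) x - V (- e) e x).

Let S_lin e : lin (S e).
Proof.
move=> a x y; rewrite /S !V_lin opprD addrACA -scalerBr scalerDr !scalerA.
by rewrite [a * _]mulrC.
Qed.

Let S_sa e x y : ip (S e x) y = ip x (S e y).
Proof.
rewrite /S ipZl ipZr ipBl ipBr !adjV !opprK conjcM conjcN.
have -> : conjc ('i : C) = - 'i.
  by apply/eqP; rewrite eq_complex /= ?oppr0 !eqxx.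
have -> : conjc (2^-1 : C) = 2^-1 by rewrite conjc_inv conjc_nat.
ring.
Qed.

Let S_contr e : contr (S e).
Proof.
move=> x; rewrite /S hnZ Normc.normcM normcN.
have -> : normc ('i : C) = 1 by rewrite /= expr0n expr1n add0r sqrtr1.
have -> : normc (2^-1 : C) = 2^-1.
  by rewrite -[2^-1]/((2%:R : C)^-1) -(rmorph_nat (real_complex R)) -fmorphV normc_real
    ger0_norm// invr_ge0.
rewrite mulr1 mulrC ler_pdivrMr//; apply: le_trans (hnB _ _) _.
by rewrite !hn_V mulr_natr mulr2n.
Qed.

Let FS e x : F (S e x) = (-1) *: S e (F x).
Proof.
by rewrite /S (linZ F_lin) (linB F_lin) !FV scaleN1r -scalerN opprB.
Qed.

Let SV e z z' x : V z z' (S e x) = 1 *: S e (V z z' x).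
Proof.
rewrite scale1r /S (linZ (V_lin _ _)) (linB (V_lin _ _)) !VD.
by rewrite ![z + _]addrC ![z' + _]addrC.
Qed.

Let SS e e' x : S e (S e' x) = 1 *: S e' (S e x).
Proof.
have h z z' : V z z' (S e x) = S e (V z z' x) by rewrite SV scale1r.
rewrite scale1r [RHS]/S !h -(linB (S_lin _)) -(linZ (S_lin _)).
by [].
Qed.

(** A vanishing sine means that [V e (- e)] and its inverse agree at [x]; hence only the square of
    [V e (- e)] is known to fix [x]. *)
Let S0 e x : S e x = 0 -> V (e + e) (- (e + e)) x = x.
Proof.
move=> /eqP; rewrite /S scaler_eq0 mulf_eq0 oppr_eq0 invr_eq0 pnatr_eq0 /=.
rewrite eq_complex /= oner_eq0 andbF /= subr_eq0 => /eqP h.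
by rewrite opprD -VD h VD addrN addNr V0.
Qed.

(** Invariance rewrites the coefficient as that of [t (U (- (y + y)) f) (U (y + y) g)], which
    [slice_mixing] makes small uniformly in the first factor. Mixing does not let the parity of its
    index be chosen, so smallness is requested at all four [z - p], one of which is even. *)
Let even_fixed x : (forall z, V (z + z) (- (z + z)) x = x) ->
  forall f g, H0 g -> ip (t f g) x = 0.
Proof.
move=> hx f g g0; apply: normc_small => eps eps0.
case: L10 => zs1 [a1 [b1 [c1 [a10 b10 c10 s1 z1]]]].
have e1 : 0 < eps / (hn f + 1) by rewrite divr_gt0// ltr_wpDl ?hn_ge0.
have [z hz] := @slice_mixing zs1 a1 b1 c1 (1, 0) a10 b10 c10 s1 z1 x g _
  parity_classes g0 e1.
have [p pin [y zy]] := even_part z.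
have := hz p pin (U (- (y + y)) f); rewrite zy hn_U.
have -> : t (U (- (y + y)) f) (U (y + y) g) = V (- (y + y)) (y + y) (t f g).
  by rewrite V_t.
rewrite adjV opprK hx => /le_trans; apply.
by rewrite mulrAC ler_pdivrMr ?ltr_wpDl ?hn_ge0// ler_pM2l// lerDl.
Qed.

Theorem swap_operator : exists J : K -> K,
  [/\ lin J, forall x y, ip (J x) y = ip x (J y), J (t o o) = 0,
      forall x, ip x (t o o) = 0 -> J (J x) = x &
      (forall z x, J (V z z x) = V z z (J x)) /\
      (forall x, F (J x) = - J (F x))].
Proof.
have [J1 [J1l J1c J1s [J1S J10] J1A]] := sign_operator (S_lin (1, 0)) (@S_contr _) (@S_sa _).
have [J2 [J2l J2c J2s [J2S J20] J2A]] := sign_operator (S_lin (0, 1)) (@S_contr _) (@S_sa _).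
have c11 : (1 : C) * 1 = 1 by rewrite mulr1.
have SJ1 e x : S e (J1 x) = J1 (S e x).
  by rewrite (J1A (S e) 1) ?scale1r//; move=> y; rewrite SS.
have SJ2 e x : S e (J2 x) = J2 (S e x).
  by rewrite (J2A (S e) 1) ?scale1r//; move=> y; rewrite SS.
have J12 x : J1 (J2 x) = J2 (J1 x).
  by rewrite (J2A J1 1) ?scale1r// => y; rewrite -SJ1 scale1r.
have J111 x : J1 (J1 (J1 x)) = J1 x.
  apply/eqP; rewrite eq_sym -subr_eq0 -(linB J1l); apply/eqP; exact: J10.
(* [J1] satisfies [J1^3 = J1], so [x - J1 (J1 x)] is the projection of [x] onto its kernel: [J] is
   [J1] off this kernel and [J2] on it. *)
pose J x := J1 x + J2 (x - J1 (J1 x)).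
have Jl : lin J.
  move=> a x y; rewrite /J !J1l opprD addrACA -scalerBr J2l scalerDr.
  by rewrite addrACA.
have Joo : J (t o o) = 0.
  have Soo e : S e (t o o) = 0 by rewrite /S !V_t !Uo subrr scaler0.
  by rewrite /J J10// (lin0 J1l) subr0 J20// addr0.
have Js x y : ip (J x) y = ip x (J y).
  rewrite /J ipDl ipDr J1s J2s ipBl J1s J1s (linB J2l) ipBr.
  by rewrite -!J12.
exists J; split=> //.
- move=> x xoo; pose u := x - J1 (J1 x).
  have J1u : J1 u = 0 by rewrite /u (linB J1l) J111 subrr.
  have JJ : J (J x) = J1 (J1 x) + J2 (J2 u).
    have J1J : J1 (J x) = J1 (J1 x).
      by rewrite /J -/u (linD J1l) J12 J1u (lin0 J2l) addr0.
    rewrite {1}/J !J1J J111; congr (_ + J2 _).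
    by rewrite /J addrC addKr.
  apply/eqP; rewrite eq_sym -subr_eq0 JJ opprD addrA -/u; apply/eqP.
  (* On [y] both sines vanish, so it is fixed by all [V (z + z) (- (z + z))], and so is [F y]. By
     [even_fixed] its only possible coefficient is the one at [t o o], which is 0 by the choice of
     [x]. *)
  set y := u - _.
  have S1y : S (1, 0) y = 0.
    by rewrite /y (linB (S_lin _)) !SJ2 /u J1S !(lin0 J2l) subrr.
  have S2y : S (0, 1) y = 0 by rewrite /y J2S.
  have W z : V (z + z) (- (z + z)) y = y.
    have NV z' : V z' (- z') y = y -> V (- z') z' y = y.
      by move=> e; rewrite -{1}e VD addNr addrN V0.
    have nV z' (n : nat) : V z' (- z') y = y -> V (z' *+ n) (- (z' *+ n)) y = y.
      move=> e; elim: n => [|n IH]; first by rewrite mulr0n oppr0 V0.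
      by rewrite mulrSr opprD -VD e.
    have zV z' (n : int) : V z' (- z') y = y -> V (z' *~ n) (- (z' *~ n)) y = y.
      case: n => n e; first exact: nV.
      by rewrite NegzE mulrNz opprK; apply: NV; exact: nV.
    rewrite {1 2}[z]pair_span [in X in V _ X y](pair_span z).
    rewrite addrACA -!mulrzDl opprD -VD.
    by rewrite !zV ?S0.
  have Fy z : V (z + z) (- (z + z)) (F y) = F y.
    by rewrite -{2}(W (- z)) FV -!opprD opprK.
  apply: decomp.
  + by move=> f g _ g0; exact: even_fixed.
  + by move=> f f0; rewrite -F_t adjF; exact: even_fixed.
  + by move=> f f0; exact: even_fixed.
  have -> : y = x - J (J x) by rewrite JJ opprD addrA.
  by rewrite ipBr -Js Joo ip0l subr0 ipC xoo conjc0.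
- split=> [z x|x].
    have V1 y : J1 (V z z y) = V z z (J1 y).
      by rewrite (J1A (V z z) 1) ?scale1r//; move=> y'; rewrite SV.
    have V2 y : J2 (V z z y) = V z z (J2 y).
      by rewrite (J2A (V z z) 1) ?scale1r//; move=> y'; rewrite SV.
    by rewrite /J !V1 -(linB (V_lin _ _)) V2 (linD (V_lin _ _)).
  have F1 y : F (J1 y) = - J1 (F y).
    rewrite (J1A F (-1)) ?scaleN1r ?mulrNN ?mulr1//; exact: FS.
  have F2 y : F (J2 y) = - J2 (F y).
    rewrite (J2A F (-1)) ?scaleN1r ?mulrNN ?mulr1//; exact: FS.
  by rewrite /J (linD F_lin) F1 F2 (linB F_lin) !F1 (linN J1l) opprK opprD.
Qed.

End SwapOperator.

Definition parity (c : C) (x : K) := F x = c *: x /\ ip x (t o o) = 0.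

Lemma parity_comb c a x y : parity c x -> parity c y -> parity c (a *: x + y).
Proof.
move=> [Fx xo] [Fy yo]; split.
  by rewrite F_lin Fx Fy scalerDr !scalerA mulrC.
by rewrite ipDl ipZl xo yo mulr0 addr0.
Qed.

Lemma parity_sum c (s : seq (Z2 * C)) x : parity c x ->
  parity c (\sum_(p <- s) p.2 *: V p.1 p.1 x).
Proof.
move=> [Fx xo]; elim: s => [|p s IH].
  by rewrite big_nil; split; rewrite ?ip0l// (lin0 F_lin) scaler0.
rewrite big_cons; apply: parity_comb => //; split.
  by rewrite FV Fx (linZ (V_lin _ _)).
by rewrite adjV V_t !Uo.
Qed.

Lemma parity_closed c x :
  (forall e : R, 0 < e -> exists2 y, parity c y & hn (x - y) < e) -> parity c x.
Proof.
move=> hx; split; apply/eqP; rewrite -subr_eq0; apply/eqP.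
  apply: hcvg_small => e e0.
  have p0 : 0 < 1 + normc c by rewrite ltr_wpDr ?normc_ge0.
  have [|y [Fy _] hy] := hx (e / (1 + normc c)); first by rewrite divr_gt0.
  have -> : F x - c *: x = F (x - y) - c *: (x - y).
    by rewrite (linB F_lin) Fy scalerBr opprB addrA subrK.
  apply: le_lt_trans (hnB _ _) _; rewrite hn_F hnZ.
  by move: hy; rewrite ltr_pdivlMr// mulrDr mulr1 (mulrC (hn _)).
rewrite subr0; apply: normc_small => e e0.
have p0 : 0 < hn (t o o) + 1 by rewrite ltr_wpDl ?hn_ge0.
have [|y [_ yo] hy] := hx (e / (hn (t o o) + 1)); first by rewrite divr_gt0.
rewrite -[x](subrK y) ipDl yo addr0; apply: le_trans (CauchySchwarz _ _) _.
move: hy; rewrite ltr_pdivlMr//; have := hn_ge0 (x - y); lra.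
Qed.

(** * The two cyclic subspaces and their equivalence *)

Section TwoCyclicSubspaces.
Variable h : H.
Hypothesis h0 : H0 h.
Hypothesis h_total : forall x, H0 x -> (forall z, ip (U z h) x = 0) -> x = 0.
Hypotheses (L10 : limit_at (1, 0)) (L01 : limit_at (0, 1)).
Hypothesis L11 : limit_at (1, 1).

Definition generates (c : C) (v : K) := parity c v /\
  forall x, parity c x -> forall e : R, 0 < e -> exists s : seq (Z2 * C),
    hn (x - \sum_(p <- s) p.2 *: V p.1 p.1 v) < e.

(** [J] is isometric off [t o o], commutes with the action and reverses parity, so it carries the
    cyclic vector of the symmetric part to one of the antisymmetric part: density there is
    transported by [J]. *)
Theorem two_cyclic_subspaces : exists (J : K -> K) (v w : K),
  [/\ generates 1 v, generates (-1) w, lin J,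
    forall z x, J (V z z x) = V z z (J x) &
    forall c x, parity c x -> [/\ parity (- c) (J x), J (J x) = x &
      forall c' y, parity c' y -> ip (J x) (J y) = ip x y]].
Proof.
have [J [J_lin J_sa Joo JJ [JV JF]]] := swap_operator L10.
have Jpar c x : parity c x -> parity (- c) (J x).
  move=> [Fx xo]; split; first by rewrite JF Fx (linZ J_lin) scaleNr.
  by rewrite J_sa Joo ip0r.
have pv : parity 1 (sym_vector h).
  by split; [rewrite F_sym_vector scale1r|exact: sym_vector_oo].
have dense x : parity 1 x -> forall e : R, 0 < e -> exists s : seq (Z2 * C),
    hn (x - \sum_(p <- s) p.2 *: V p.1 p.1 (sym_vector h)) < e.
  move=> [Fx xo] e; apply: sym_vector_dense => //; by rewrite Fx scale1r.
exists J, (sym_vector h), (J (sym_vector h)); split=> //.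
- split; first exact: Jpar.
  move=> x px e e0; have := Jpar _ _ px; rewrite opprK => pJx.
  have [s hs] := dense _ pJx e e0; exists s; apply: le_lt_trans hs.
  set y := \sum_(p <- s) p.2 *: V p.1 p.1 (sym_vector h).
  have [_ yo] : parity 1 (- y + J x).
    by rewrite -scaleN1r; apply: parity_comb => //; exact: parity_sum.
  have -> : x - \sum_(p <- s) p.2 *: V p.1 p.1 (J (sym_vector h)) = J (J x - y).
    rewrite (linB J_lin) (JJ x px.2) /y (lin_sum J_lin); congr (_ - _).
    by apply: eq_bigr => p _; rewrite (linZ J_lin) JV.
  by rewrite addrC in yo; rewrite /hn /nsq J_sa JJ.
- move=> c x px; split; [exact: Jpar|exact: JJ px.2|].
  by move=> c' y py; rewrite J_sa (JJ y py.2).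
Qed.

Theorem homogeneous_tensor_square :
  homogeneous_complement (fun z => V z z) (t o o) 2.
Proof.
have [J [v [w [[pv hv] [pw hw] J_lin JV hJ]]]] := two_cyclic_subspaces.
pose cf (i : 'I_2) : C := (-1) ^+ i.
pose vf (i : 'I_2) : K := if i == ord0 then v else w.
have cfN i j : i != j -> cf j = - cf i.
  case: i j => [[|[|//]] hi] [[|[|//]] hj] //= _; rewrite /cf /= expr0 expr1//.
  by rewrite opprK.
have cf2 i : cf i * cf i = 1.
  by rewrite /cf -exprD addnn -mul2n exprM sqrrN expr1n expr1n.
have cfR i : conjc (cf i) = cf i.
  case: i => [[|[|//]] hi]; rewrite /cf /= ?expr0 ?expr1 ?conjcN.
    by apply/eqP; rewrite eq_complex /= ?oppr0 !eqxx.
  by apply/eqP; rewrite eq_complex /= ?oppr0 !eqxx.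
have EP i x : closed_span (fun z => V z z) (vf i) x <-> parity (cf i) x.
  have [pvf hvf] : parity (cf i) (vf i) /\ forall x, parity (cf i) x ->
      closed_span (fun z => V z z) (vf i) x.
    by case: i => [[|[|//]] hi]; rewrite /cf /vf ?expr0 ?expr1.
  split=> [hx|]; last exact: hvf.
  apply: parity_closed => e e0; have [s hs] := hx e e0.
  by exists (\sum_(p <- s) p.2 *: V p.1 p.1 (vf i)) => //; exact: parity_sum.
exists vf, (fun i j => if i == j then id else J); split.
- move=> i j x y ij /EP[Fx _] /EP[Fy _].
  have : ip x y = - ip x y.
    rewrite -[LHS]ip_F Fx Fy (cfN _ _ ij) ipZl ipZr conjcN mulNr mulrN mulrA.
    congr (- _); rewrite -[RHS]mul1r; congr (_ * _).
    by rewrite cfR cf2.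
  by move/eqP; rewrite -addr_eq0 -mulr2n mulrn_eq0 => /eqP.
- move=> x; split=> [xo|[c hc ->]]; last first.
    by rewrite ip_suml big1// => i _; have /EP[] := hc i.
  have Fxo : ip (F x) (t o o) = 0 by rewrite adjF F_t.
  exists (fun i => 2^-1 *: (x + cf i *: F x)).
    move=> i; apply/EP; split; last first.
      by rewrite ipZl ipDl ipZl xo Fxo mulr0 addr0 mulr0.
    rewrite (linZ F_lin) (linD F_lin) (linZ F_lin) FF.
    rewrite [RHS]scalerA mulrC -[RHS]scalerA; congr (_ *: _).
    by rewrite scalerDr scalerA cf2 scale1r addrC.
  rewrite !big_ord_recl big_ord0 addr0 /cf /= expr0 expr1 -scalerDr scale1r scaleN1r.
  rewrite addrACA subrr addr0 -mulr2n -scalerMnr scalerMnl.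
  by rewrite -mulr_natr mulVf ?pnatr_eq0// scale1r.
- move=> i j; have [->|ij] := eqVneq i j; first by split=> // x; exists x.
  split=> //.
  + by move=> x /EP/hJ[pJ _ _]; apply/EP; rewrite (cfN _ _ ij).
  + by move=> x y /EP/hJ[_ _ JJ] /EP; exact: JJ.
  + move=> y /EP/hJ[pJ JJ _]; exists (J y) => //; apply/EP.
    by move: pJ; rewrite (cfN _ _ ij) opprK.
Qed.

End TwoCyclicSubspaces.

End TensorSquare.

(** * Completeness of L_2 *)

Section RealRieszFischer.
Context d (Y : measurableType d) (R : realType).
Variable mu : {measure set Y -> \bar R}.
Implicit Types f g : Y -> R.

Definition sqint f : \bar R := (\int[mu]_y ((f y) ^+ 2)%:E)%E.

Definition sqdist f g : \bar R := sqint (fun y => f y - g y).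

Lemma measurable_sqr f : measurable_fun [set: Y] f ->
  measurable_fun [set: Y] (fun y => ((f y) ^+ 2)%:E).
Proof. by move=> mf; apply/measurable_EFinP; exact: measurable_funX. Qed.

Lemma sqint_ge0 f : (0 <= sqint f)%E.
Proof. by apply: integral_ge0 => y _; rewrite lee_fin sqr_ge0. Qed.

Lemma Lfun2P f :
  f \in Lfun mu 2%:E <-> measurable_fun [set: Y] f /\ (sqint f < +oo)%E.
Proof.
split=> [f2|[mf fi]].
  move: (f2); rewrite inE => /andP[]; rewrite inE /= => mf _; split=> //.
  have /integrableP[_] := Lfun2_integrable_sqr f2.
  rewrite (_ : (\int[mu]_y `|_|)%E = sqint f)//; apply: eq_integral => y _.
  by rewrite gee0_abs// lee_fin sqr_ge0.
rewrite inE; apply/andP; split; rewrite inE//= /finite_norm unlock /Lnorm.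
rewrite poweR_lty// (_ : (\int[mu]_y _)%E = sqint f)//; apply: eq_integral => y _.
by rewrite /= powR_mulrn// real_normK ?num_real.
Qed.

(* The weights 4^k turn integrability of the series into |f_(k+1) - f_k| = O(2^-k)
   almost everywhere. *)
Lemma Lfun2_fast_cvg (f : nat -> Y -> R) : (forall n, measurable_fun [set: Y] (f n)) ->
  (forall k, (sqdist (f k.+1) (f k) <= ((1 / 8) ^+ k)%:E)%E) ->
  {ae mu, forall y, cvgn (fun k => f k y)}.
Proof.
move=> mf hf; pose g k y := ((4 ^+ k * (f k.+1 y - f k y) ^+ 2)%:E : \bar R).
have g0 k y : (0 <= g k y)%E by rewrite lee_fin mulr_ge0 ?sqr_ge0// exprn_ge0.
have mg k : measurable_fun [set: Y] (g k).
  apply/measurable_EFinP; apply: measurable_funM => //.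
  by apply: measurable_funX; exact: measurable_funB.
have mG : measurable_fun [set: Y] (fun y => \sum_(0 <= k <oo) g k y)%E.
  exact: ge0_emeasurable_sum.
have iG : mu.-integrable [set: Y] (fun y => \sum_(0 <= k <oo) g k y)%E.
  apply/integrableP; split=> //.
  under eq_integral => y _ do rewrite gee0_abs ?nneseries_ge0//.
  rewrite integral_nneseries//.
  apply: (@le_lt_trans _ _ (2%:E)); last by rewrite ltry.
  have -> : (2%:E : \bar R) =
      (\sum_(0 <= k <oo) (2 / (2 ^ (k + 1))%:R)%:E)%E.
    have := @cvg_geometric_eseries_half R 2 0; rewrite expr0 divr1 => h.
    by apply/esym/cvg_lim.
  apply: lee_nneseries => [k _ _|k _]; first exact: integral_ge0.
  under eq_integral do rewrite /g EFinM.
  rewrite ge0_integralZl//; last 2 first.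
  - by apply: measurable_sqr; exact: measurable_funB.
  - by move=> y _; rewrite lee_fin sqr_ge0.
  apply: (@le_trans _ _ ((4 ^+ k)%:E * ((1 / 8) ^+ k)%:E)%E).
    by apply: lee_wpmul2l; [rewrite lee_fin exprn_ge0|exact: hf].
  rewrite -EFinM lee_fin -exprMn (_ : 4 * (1 / 8) = 2^-1); last by field.
  by rewrite addn1 expnS natrM natrX invfM mulVKf ?pnatr_eq0// exprVn.
have := integrable_ae measurableT iG.
apply: filterS => y /(_ I) fin.
set C := (\sum_(0 <= k <oo) g k y)%E in fin.
have gC k : 4 ^+ k * (f k.+1 y - f k y) ^+ 2 <= fine C.
  rewrite -lee_fin fineK//; apply: (@le_trans _ _ (\sum_(0 <= i < k.+1) g i y)%E).
    by rewrite big_nat_recr//= leeDr// sume_ge0.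
  exact: nneseries_lim_ge.
have C0 : 0 <= fine C by apply: fine_ge0; exact: nneseries_ge0.
have bnd k : `|f k.+1 y - f k y| <= Num.sqrt (fine C) * 2^-1 ^+ k.
  rewrite -ler_sqr ?nnegrE ?mulr_ge0 ?sqrtr_ge0 ?exprn_ge0//.
  rewrite real_normK ?num_real// exprMn sqr_sqrtr// -exprM mulnC exprM.
  have -> : (2^-1 : R) ^+ 2 = 4^-1 by field.
  by rewrite exprVn ler_pdivlMr ?exprn_gt0// mulrC.
have cs : cvgn (series (telescope (fun k => f k y))).
  apply: normed_cvg; apply: (@series_le_cvg _ _
    (geometric (Num.sqrt (fine C)) 2^-1)) => //.
  - by move=> k; exact: normr_ge0.
  - by move=> k; rewrite /geometric /= mulr_ge0 ?sqrtr_ge0 ?exprn_ge0.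
  - by apply: is_cvg_geometric_series; rewrite ger0_norm; lra.
rewrite (_ : (fun k => f k y) =
    (fun k => f 0%N y + series (telescope (fun k => f k y)) k)).
  by apply: is_cvgD => //; exact: is_cvg_cst.
by apply/funext => k; rewrite -eq_sum_telescope.
Qed.

Lemma limn_einf_le (u : (\bar R)^nat) (l : \bar R) N :
  (forall n, (N <= n)%N -> (u n <= l)%E) -> (limn_einf u <= l)%E.
Proof.
move=> h; rewrite limn_einf_lim; apply: lime_le; first exact: is_cvg_einfs.
exists N => // n /= Nn; apply: le_trans (h _ Nn).
by apply: ereal_inf_lbound; exists n => /=.
Qed.

Lemma limn_einf_ge0 (u : (\bar R)^nat) :
  (forall n, (0 <= u n)%E) -> (0 <= limn_einf u)%E.
Proof.
move=> h; rewrite limn_einf_lim; apply: lime_ge; first exact: is_cvg_einfs.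
by apply: nearW => n; apply: le_ereal_inf_tmp => _ [k _ <-].
Qed.

Lemma measurable_limn_einf (u : nat -> Y -> \bar R) :
  (forall n, measurable_fun [set: Y] (u n)) ->
  measurable_fun [set: Y] (fun y => limn_einf (u ^~ y)).
Proof.
move=> mu'; rewrite (_ : (fun y => _) = fun y => (- limn_esup (fun n => - u n y))%E).
  apply: measurableT_comp => //; apply: measurable_fun_limn_esup => n.
  exact: measurableT_comp.
apply/funext => y; rewrite -limn_einfN; congr limn_einf.
by apply/funext => n /=; rewrite oppeK.
Qed.

(** A subsequence converges almost everywhere, and Fatou's lemma along it carries the Cauchy bound
    to the limit. *)
Lemma Lfun2_complete (f : nat -> Y -> R) : (forall n, measurable_fun [set: Y] (f n)) ->
  (forall e : R, 0 < e -> exists N, forall m n, (N <= m)%N -> (N <= n)%N ->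
     (sqdist (f m) (f n) <= e%:E)%E) ->
  exists2 g, measurable_fun [set: Y] g &
    forall e : R, 0 < e -> exists N, forall n, (N <= n)%N ->
      (sqdist (f n) g <= e%:E)%E.
Proof.
move=> mf cf.
have /choice[N hN] : forall k, exists N, forall m n, (N <= m)%N -> (N <= n)%N ->
    (sqdist (f m) (f n) <= ((1 / 8) ^+ k)%:E)%E.
  by move=> k; apply: cf; rewrite exprn_gt0//; lra.
(* The sums make [s] nondecreasing with [s k] at least both [N k] and [k]. *)
pose s k := (\sum_(i < k.+1) (N i).+1)%N.
have sS k : (s k <= s k.+1)%N by rewrite /s [in leqRHS]big_ord_recr leq_addr.
have sN k : (N k <= s k)%N by rewrite /s big_ord_recr /= addnS ltnW// ltnS leq_addl.
have sk k : (k <= s k)%N.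
  by elim: k => // k IH; rewrite /s big_ord_recr /= addnS ltnS (leq_trans IH)// leq_addr.
have s_mono : {homo s : m n / (m <= n)%N}.
  by apply: homo_leq => //; exact: leq_trans.
have ae_cvg := @Lfun2_fast_cvg (fun k => f (s k)) (fun k => mf _) (fun k =>
  hN k _ _ (leq_trans (sN k) (sS k)) (sN k)).
(* The limit superior is measurable everywhere and equals the limit where that exists; [fine] sends
   infinite values to 0, which happens only on a null set. *)
pose g y := fine (limn_esup (fun k => (f (s k) y)%:E)).
have mg : measurable_fun [set: Y] g.
  apply: measurableT_comp; first exact: fine_measurable.
  by apply: measurable_fun_limn_esup => k; exact/measurable_EFinP.
have gE y : cvgn (fun k => f (s k) y) -> f (s k) y @[k --> \oo] --> g y.
  move=> /cvg_ex[l fl]; rewrite (_ : g y = l)//.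
  have cl : (f (s k) y)%:E @[k --> \oo] --> l%:E.
    by apply: cvg_EFin fl; exact: nearW.
  by rewrite /g (is_cvg_limn_esupE (cvgP _ cl)) (cvg_lim _ cl).
exists g => // e e0; have [M hM] := cf _ e0; exists M => n Mn.
apply: (@le_trans _ _ (\int[mu]_y
    limn_einf (fun k => ((f n y - f (s k) y) ^+ 2)%:E))%E).
  apply: ae_ge0_le_integral => //.
  - by move=> y _; rewrite lee_fin sqr_ge0.
  - by apply: measurable_sqr; exact: measurable_funB.
  - by move=> y _; apply: limn_einf_ge0 => k; rewrite lee_fin sqr_ge0.
  - apply: measurable_limn_einf => k; apply: measurable_sqr.
    exact: measurable_funB.
  - apply: filterS ae_cvg => y /gE cy _.
    have cl : ((f n y - f (s k) y) ^+ 2)%:E @[k --> \oo] --> ((f n y - g y) ^+ 2)%:E.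
      apply: cvg_EFin; first exact: nearW.
      by under eq_fun do rewrite expr2; rewrite expr2; apply: cvgM;
        (apply: cvgB => //; exact: cvg_cst).
    by rewrite (is_cvg_limn_einfE (cvgP _ cl)) (cvg_lim _ cl).
apply: le_trans (fatou _ measurableT _ _) _.
- by move=> k; apply: measurable_sqr; exact: measurable_funB.
- by move=> k y _; rewrite lee_fin sqr_ge0.
apply: (@limn_einf_le _ _ M) => k Mk; apply: hM => //.
exact: leq_trans Mk (sk k).
Qed.

End RealRieszFischer.

(** * The Hilbert space of classes of square-integrable complex functions *)

Section ComplexL2.
Context d (Y : measurableType d) (R : realType).
Variable mu : {measure set Y -> \bar R}.
Local Notation C := R[i].
Implicit Types f g h : Y -> C.
Local Notation Re := complex.Re.
Local Notation Im := complex.Im.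
Local Notation L2 := (L2 mu).

Definition aeq f g := {ae mu, forall y, f y = g y}.

Lemma aeq_refl f : aeq f f. Proof. exact: aeW. Qed.
Lemma aeq_sym f g : aeq f g -> aeq g f.
Proof. by apply: filterS => y ->. Qed.
Lemma aeq_trans g f h : aeq f g -> aeq g h -> aeq f h.
Proof. by apply: filterS2 => y -> ->. Qed.

Definition cintegrable f :=
  mu.-integrable [set: Y] (EFin \o (fun y => Re (f y))) /\
  mu.-integrable [set: Y] (EFin \o (fun y => Im (f y))).

Lemma integrable_RD (u v : Y -> R) : mu.-integrable [set: Y] (EFin \o u) ->
  mu.-integrable [set: Y] (EFin \o v) ->
  mu.-integrable [set: Y] (EFin \o (fun y => u y + v y)).
Proof. by move=> iu iv; exact: (integrableD measurableT iu iv). Qed.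

Lemma integrable_RZ (k : R) (u : Y -> R) : mu.-integrable [set: Y] (EFin \o u) ->
  mu.-integrable [set: Y] (EFin \o (fun y => k * u y)).
Proof. by move=> iu; exact: (integrableZl measurableT k iu). Qed.

Lemma cintegralD f g : cintegrable f -> cintegrable g ->
  cintegral mu (fun y => f y + g y) = cintegral mu f + cintegral mu g.
Proof.
move=> [f1 f2] [g1 g2]; rewrite /cintegral.
rewrite (_ : (fun y => Re (f y + g y)) = fun y => Re (f y) + Re (g y)); last first.
  by apply/funext => y; rewrite ReD.
rewrite (_ : (fun y => Im (f y + g y)) = fun y => Im (f y) + Im (g y)); last first.
  by apply/funext => y; case: (f y) (g y) => [? ?] [? ?].
by rewrite !RintegralD.
Qed.

Lemma cintegralZ (a : C) f : cintegrable f ->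
  cintegral mu (fun y => a * f y) = a * cintegral mu f.
Proof.
move=> [f1 f2]; rewrite /cintegral; case: a => p q.
rewrite (_ : (fun y => Re _) = fun y => p * Re (f y) + (- q) * Im (f y)); last first.
  by apply/funext => y; case: (f y) => r s /=; rewrite mulNr.
rewrite (_ : (fun y => Im _) = fun y => p * Im (f y) + q * Re (f y)); last first.
  by apply/funext => y; case: (f y) => r s /=.
rewrite !RintegralD//; try exact: integrable_RZ.
rewrite !RintegralZl//; apply/eqP; rewrite eq_complex /= mulNr !eqxx //.
Qed.

Lemma cintegral_conj f : cintegrable f ->
  cintegral mu (fun y => conjc (f y)) = conjc (cintegral mu f).
Proof.
move=> [f1 f2]; rewrite /cintegral /=.
rewrite (_ : (fun y => Re _) = fun y => Re (f y)); last first.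
  by apply/funext => y; case: (f y).
rewrite (_ : (fun y => Im _) = fun y => (-1) * Im (f y)); last first.
  by apply/funext => y; case: (f y) => r s /=; rewrite mulN1r.
by rewrite RintegralZl// mulN1r.
Qed.

Lemma Rintegral_ae (u v : Y -> R) : measurable_fun [set: Y] u ->
  measurable_fun [set: Y] v -> {ae mu, forall y, u y = v y} ->
  \int[mu]_y u y = \int[mu]_y v y.
Proof.
move=> mmu mv uv; rewrite /Rintegral; congr fine.
apply: ae_eq_integral => //; [exact/measurable_EFinP|exact/measurable_EFinP|].
by apply: filterS uv => y -> _.
Qed.

Definition cmeasurable f :=
  measurable_fun [set: Y] (fun y => Re (f y)) /\
  measurable_fun [set: Y] (fun y => Im (f y)).

Lemma cintegrable_measurable f : cintegrable f -> cmeasurable f.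
Proof.
by move=> [/integrableP[h1 _] /integrableP[h2 _]]; split; apply/measurable_EFinP.
Qed.

Lemma L2_measurable f : L2 f -> cmeasurable f.
Proof. by move=> [/Lfun2P[h1 _] /Lfun2P[h2 _]]. Qed.

Lemma cintegral_ae f g : cmeasurable f -> cmeasurable g -> aeq f g ->
  cintegral mu f = cintegral mu g.
Proof.
move=> [f1 f2] [g1 g2] fg; rewrite /cintegral.
by congr (_ +i* _); apply: Rintegral_ae => //; apply: filterS fg => y ->.
Qed.

Lemma L2_mul f g : L2 f -> L2 g -> cintegrable (fun y => f y * conjc (g y)).
Proof.
move=> [f1 f2] [g1 g2].
have P u v : u \in Lfun mu 2%:E -> v \in Lfun mu 2%:E ->
    mu.-integrable [set: Y] (EFin \o (fun y => u y * v y)).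
  by move=> hu hv; apply/Lfun1_integrable; exact: Lfun2_mul_Lfun1.
split.
- rewrite (_ : (fun y => Re _) =
    fun y => Re (f y) * Re (g y) + Im (f y) * Im (g y)); last first.
    by apply/funext => y; case: (f y) (g y) => [? ?] [? ?] /=; rewrite mulrN opprK.
  by apply: integrable_RD; exact: P.
- rewrite (_ : (fun y => Im _) =
    fun y => (-1) * (Re (f y) * Im (g y)) + Im (f y) * Re (g y)); last first.
    by apply/funext => y; case: (f y) (g y) => [? ?] [? ?] /=; rewrite mulN1r mulrN.
  by apply: integrable_RD; [apply: integrable_RZ|]; exact: P.
Qed.

Lemma Lfun2Z (k : R) (u : Y -> R) : u \in Lfun mu 2%:E ->
  (fun y => k * u y) \in Lfun mu 2%:E.
Proof.
move=> /Lfun2P[mu' iu]; apply/Lfun2P; split; first exact: measurable_funM.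
rewrite /sqint; under eq_integral do rewrite exprMn EFinM.
rewrite ge0_integralZl//; last 3 first.
- exact: measurable_sqr.
- by move=> y _; rewrite lee_fin sqr_ge0.
- by rewrite lee_fin sqr_ge0.
by rewrite lte_mul_pinfty// lee_fin sqr_ge0.
Qed.

Lemma Lfun2D (u v : Y -> R) : u \in Lfun mu 2%:E -> v \in Lfun mu 2%:E ->
  (fun y => u y + v y) \in Lfun mu 2%:E.
Proof.
move=> /[dup] hu /Lfun2P[mmu iu] /[dup] hv /Lfun2P[mv iv].
apply/Lfun2P; split; first exact: measurable_funD.
have [_ iu2] := (Lfun2P _ _).1 (Lfun2Z 2 hu).
have [_ iv2] := (Lfun2P _ _).1 (Lfun2Z 2 hv).
apply: (@le_lt_trans _ _ (sqint mu (fun y => 2 * u y)%R + sqint mu (fun y => 2 * v y)%R)%E).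
  rewrite /sqint -ge0_integralD//.
  - apply: ge0_le_integral => //.
    + by move=> y _; rewrite lee_fin sqr_ge0.
    + by apply: measurable_sqr; exact: measurable_funD.
    + by apply: emeasurable_funD; apply: measurable_sqr; exact: measurable_funM.
    + move=> y _; rewrite -EFinD lee_fin.
      have : 0 <= (u y - v y) ^+ 2 by rewrite sqr_ge0.
      have : 0 <= (u y) ^+ 2 by rewrite sqr_ge0.
      have : 0 <= (v y) ^+ 2 by rewrite sqr_ge0.
      nra.
  - by move=> y _; rewrite lee_fin sqr_ge0.
  - by apply: measurable_sqr; exact: measurable_funM.
  - by move=> y _; rewrite lee_fin sqr_ge0.
  - by apply: measurable_sqr; exact: measurable_funM.
by rewrite lte_add_pinfty.
Qed.

Lemma L2D f g : L2 f -> L2 g -> L2 (fun y => f y + g y).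
Proof.
move=> [f1 f2] [g1 g2]; split.
- rewrite (_ : (fun y => Re _) = fun y => Re (f y) + Re (g y)); first exact: Lfun2D.
  by apply/funext => y; rewrite ReD.
- rewrite (_ : (fun y => Im _) = fun y => Im (f y) + Im (g y)); first exact: Lfun2D.
  by apply/funext => y; case: (f y) (g y) => [? ?] [? ?].
Qed.

Lemma L2Z (a : C) f : L2 f -> L2 (fun y => a * f y).
Proof.
move=> [f1 f2]; case: a => p q; split.
- rewrite (_ : (fun y => Re _) = fun y => p * Re (f y) + (- q) * Im (f y)).
    by apply: Lfun2D; exact: Lfun2Z.
  by apply/funext => y; case: (f y) => r s /=; rewrite mulNr.
- rewrite (_ : (fun y => Im _) = fun y => p * Im (f y) + q * Re (f y)).
    by apply: Lfun2D; exact: Lfun2Z.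
  by apply/funext => y; case: (f y) => r s /=.
Qed.

Lemma L2N f : L2 f -> L2 (fun y => - f y).
Proof.
by move=> /(L2Z (-1)); congr L2; apply/funext => y; rewrite mulN1r.
Qed.

Lemma L2B f g : L2 f -> L2 g -> L2 (fun y => f y - g y).
Proof. by move=> hf hg; apply: L2D => //; exact: L2N. Qed.

Lemma L2_cst0 : L2 (fun=> 0).
Proof.
have h : (fun=> 0 : R) \in Lfun mu 2%:E.
  apply/Lfun2P; split; first exact: measurable_cst.
  rewrite /sqint; under eq_integral do rewrite expr0n.
  by rewrite integral0 ltry.
by split.
Qed.

Lemma innerDl f g h : L2 f -> L2 g -> L2 h ->
  inner mu (fun y => f y + g y) h = inner mu f h + inner mu g h.
Proof.
move=> hf hg hh; rewrite /inner -cintegralD; try exact: L2_mul.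
by congr cintegral; apply/funext => y; rewrite mulrDl.
Qed.

Lemma innerZl a f h : L2 f -> L2 h ->
  inner mu (fun y => a * f y) h = a * inner mu f h.
Proof.
move=> hf hh; rewrite /inner -cintegralZ; last exact: L2_mul.
by congr cintegral; apply/funext => y; rewrite mulrA.
Qed.

Lemma innerC f g : L2 f -> L2 g -> inner mu g f = conjc (inner mu f g).
Proof.
move=> hf hg; rewrite /inner -cintegral_conj; last exact: L2_mul.
by congr cintegral; apply/funext => y; rewrite conjcM conjcK mulrC.
Qed.

Lemma inner_ae f f' g g' : L2 f -> L2 f' -> L2 g -> L2 g' ->
  aeq f f' -> aeq g g' -> inner mu f g = inner mu f' g'.
Proof.
move=> hf hf' hg hg' ff gg; apply: cintegral_ae.
- exact/cintegrable_measurable/L2_mul.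
- exact/cintegrable_measurable/L2_mul.
by apply: filterS2 ff gg => y -> ->.
Qed.

Lemma Re_inner f : L2 f -> (Re (inner mu f f))%:E =
  (sqint mu (fun y => Re (f y)) + sqint mu (fun y => Im (f y)))%E.
Proof.
move=> hf; have [iR _] := L2_mul hf hf; case: hf => [/Lfun2P[m1 _] /Lfun2P[m2 _]].
rewrite /inner /cintegral /= /Rintegral fineK; last exact: integrable_fin_num.
rewrite /sqint -ge0_integralD//; last 4 first.
- by move=> y _; rewrite lee_fin sqr_ge0.
- exact: measurable_sqr.
- by move=> y _; rewrite lee_fin sqr_ge0.
- exact: measurable_sqr.
apply: eq_integral => y _; rewrite -EFinD; congr EFin.
by case: (f y) => r s /=; rewrite mulrN opprK !expr2.
Qed.

Lemma inner_ge0 f : L2 f -> 0 <= Re (inner mu f f).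
Proof. by move=> hf; rewrite -lee_fin Re_inner// adde_ge0 ?sqint_ge0. Qed.

Lemma sqint_eq0 (u : Y -> R) : measurable_fun [set: Y] u -> sqint mu u = 0%E ->
  {ae mu, forall y, u y = 0}.
Proof.
move=> mmu hu; have ms := measurable_sqr mmu.
have /(ae_eq_integral_abs mu measurableT ms) :
    (\int[mu]_y `|((u y) ^+ 2)%:E| = 0)%E.
  rewrite -[RHS]hu; apply: eq_integral => y _.
  by rewrite gee0_abs// lee_fin sqr_ge0.
apply: filterS => y /(_ I) [] /eqP.
by rewrite sqrf_eq0 => /eqP.
Qed.

Lemma inner_eq0 f : L2 f -> Re (inner mu f f) = 0 -> aeq f (fun=> 0).
Proof.
move=> hf h0; have := Re_inner hf; rewrite h0 => /esym/eqP.
rewrite padde_eq0 ?sqint_ge0// => /andP[/eqP s1 /eqP s2].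
have [m1 m2] := L2_measurable hf.
apply: filterS2 (sqint_eq0 m1 s1) (sqint_eq0 m2 s2) => y.
by case: (f y) => r s /= -> ->.
Qed.

Lemma L2_complete (u : nat -> Y -> C) : (forall n, L2 (u n)) ->
  (forall e : R, 0 < e -> exists N, forall m n, (N <= m)%N -> (N <= n)%N ->
    Re (inner mu (fun y => u m y - u n y) (fun y => u m y - u n y)) < e) ->
  exists2 l, L2 l & forall e : R, 0 < e -> exists N, forall n, (N <= n)%N ->
    Re (inner mu (fun y => u n y - l y) (fun y => u n y - l y)) < e.
Proof.
move=> hu cu.
have part (P : C -> R) (dist : forall a b, P (a - b) = P a - P b) :
    (forall f, L2 f -> (fun y => P (f y)) \in Lfun mu 2%:E) ->
    (forall f, L2 f -> (sqint mu (fun y => P (f y)) <= (Re (inner mu f f))%:E)%E) ->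
    exists2 g, g \in Lfun mu 2%:E & forall e : R, 0 < e -> exists N, forall n, (N <= n)%N ->
      (sqdist mu (fun y => P (u n y)) g <= e%:E)%E.
  move=> P2 Ple.
  have mP n : measurable_fun [set: Y] (fun y => P (u n y)).
    by have /Lfun2P[] := P2 _ (hu n).
  have [|g mg hg] := @Lfun2_complete _ _ _ mu _ mP.
    move=> e e0; have [N hN] := cu e e0; exists N => m n Nm Nn.
    rewrite /sqdist (_ : (fun y => _) = fun y => P (u m y - u n y)).
      by apply: le_trans (Ple _ _) _; [exact: L2B|rewrite lee_fin ltW// hN].
    by apply/funext => y; rewrite dist.
  exists g => //; have [N /(_ N (leqnn _)) hN] := hg 1 ltr01.
  have h2 : (fun y => P (u N y) - g y) \in Lfun mu 2%:E.
    apply/Lfun2P; split; first exact: measurable_funB.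
    by apply: le_lt_trans hN _; rewrite ltry.
  rewrite (_ : g = fun y => P (u N y) + (-1) * (P (u N y) - g y)).
    by apply: Lfun2D; [exact: P2|exact: Lfun2Z].
  by apply/funext => y; rewrite mulN1r opprB addrC subrK.
have [|||gr gr2 hgr] := part (fun z => Re z).
- by move=> a b; rewrite ReD ReN.
- by move=> f [].
- by move=> f hf; rewrite Re_inner// leeDl// sqint_ge0.
have [|||gi gi2 hgi] := part (fun z => Im z).
- by move=> [? ?] [? ?].
- by move=> f [].
- by move=> f hf; rewrite Re_inner// leeDr// sqint_ge0.
have hl : L2 (fun y => gr y +i* gi y) by split.
exists (fun y => gr y +i* gi y) => // e e0.
have [|N1 h1] := hgr (e / 3); first by rewrite divr_gt0.
have [|N2 h2] := hgi (e / 3); first by rewrite divr_gt0.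
exists (maxn N1 N2) => n; rewrite geq_max => /andP[n1 n2].
rewrite -lte_fin Re_inner; last exact: L2B.
apply: (@le_lt_trans _ _ ((e / 3)%:E + (e / 3)%:E)%E); last first.
  by rewrite -EFinD lte_fin; lra.
apply: leeD.
- apply: le_trans (h1 n n1); rewrite /sqdist.
  rewrite (_ : (fun y => _) = fun y => Re (u n y) - gr y)//.
  by apply/funext => y; case: (u n y).
- apply: le_trans (h2 n n2); rewrite /sqdist.
  rewrite (_ : (fun y => _) = fun y => Im (u n y) - gi y)//.
  by apply/funext => y; case: (u n y).
Qed.

(** The selected representative depends only on the set of functions equal to [f] almost everywhere,
    so equality of classes becomes equality of functions. The default is taken only when this set
    contains no element of [L2]. *)
Definition canon f : Y -> C := xget (fun=> 0) [set g | L2 g /\ aeq g f].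

Lemma canonP f : L2 f -> L2 (canon f) /\ aeq (canon f) f.
Proof.
move=> hf; rewrite /canon; case: xgetP => [g _ //|/(_ f)[]].
by split=> //; exact: aeq_refl.
Qed.

Lemma canon_eq f g : aeq f g -> canon f = canon g.
Proof.
move=> fg; rewrite /canon; congr xget; apply/seteqP; split=> h /= [hh1 hh2].
- by split=> //; exact: aeq_trans hh2 fg.
- by split=> //; apply: aeq_trans hh2 (aeq_sym fg).
Qed.

(* A class modulo null sets is represented by the function [canon] selects. *)
Record L2space := MkL2space {
  rep :> Y -> C; rep_canon : L2 rep /\ canon rep = rep }.

Lemma repL2 (x : L2space) : L2 x. Proof. by case: x => f []. Qed.

Lemma canon_canon f : L2 f -> L2 (canon f) /\ canon (canon f) = canon f.
Proof. by move=> /canonP[h1 h2]; split=> //; exact: canon_eq. Qed.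

Definition L2zero := MkL2space (canon_canon L2_cst0).

(** Defined on all functions, with the zero class outside [L2]; hence the hypotheses [L2 f] in the
    lemmas about it. *)
Definition cls f : L2space :=
  if pselect (L2 f) is left h then MkL2space (canon_canon h) else L2zero.

Lemma rep_cls f : L2 f -> aeq (cls f) f.
Proof.
by move=> hf; rewrite /cls; case: pselect => // h /=; have [] := canonP h.
Qed.

Lemma rep_inj (x y : L2space) : rep x = rep y -> x = y.
Proof. by case: x y => f hf [g hg] /= fg; subst g; congr MkL2space. Qed.

Lemma cls_rep (x : L2space) : cls x = x.
Proof.
apply: rep_inj; rewrite /cls; case: pselect => [h|]; last by have := repL2 x.
by case: x h => f [].
Qed.

Lemma cls_eq f g : L2 f -> L2 g -> aeq f g -> cls f = cls g.
Proof.
move=> hf hg fg; apply: rep_inj; rewrite /cls.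
by do 2 case: pselect => //= ?; exact: canon_eq.
Qed.

Lemma cls_inj f g : L2 f -> L2 g -> cls f = cls g -> aeq f g.
Proof.
move=> hf hg fg; apply: aeq_trans (rep_cls hg).
by rewrite -fg; apply: aeq_sym; exact: rep_cls.
Qed.

HB.instance Definition _ := gen_eqMixin L2space.
HB.instance Definition _ := gen_choiceMixin L2space.

Definition L2add (x y : L2space) := cls (fun t => x t + y t).
Definition L2opp (x : L2space) := cls (fun t => - x t).
Definition L2scale (a : C) (x : L2space) := cls (fun t => a * x t).

Lemma L2add_cls f g : L2 f -> L2 g -> L2add (cls f) (cls g) = cls (fun t => f t + g t).
Proof.
move=> hf hg; apply: cls_eq; [|exact: L2D|].
  by apply: L2D; exact: repL2.
by apply: filterS2 (rep_cls hf) (rep_cls hg) => t -> ->.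
Qed.

Lemma L2scale_cls a f : L2 f -> L2scale a (cls f) = cls (fun t => a * f t).
Proof.
move=> hf; apply: cls_eq; [|exact: L2Z|].
  by apply: L2Z; exact: repL2.
by apply: filterS (rep_cls hf) => t ->.
Qed.

Lemma L2addA : associative L2add.
Proof.
move=> x y z; have [hx hy hz] := And3 (repL2 x) (repL2 y) (repL2 z).
rewrite -{1}[x]cls_rep -{2}[z]cls_rep {2}/L2add {3}/L2add.
rewrite !L2add_cls//; try exact: L2D.
by congr cls; apply/funext => t; rewrite addrA.
Qed.

Lemma L2addC : commutative L2add.
Proof. by move=> x y; congr cls; apply/funext => t; rewrite addrC. Qed.

Lemma L2add0 : left_id (cls (fun=> 0)) L2add.
Proof.
move=> x; rewrite -[in LHS](cls_rep x) L2add_cls ?cls_rep//; last 2 first.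
- exact: L2_cst0.
- exact: repL2.
by rewrite -[RHS]cls_rep; congr cls; apply/funext => t; rewrite add0r.
Qed.

Lemma L2addN : left_inverse (cls (fun=> 0)) L2opp L2add.
Proof.
move=> x; have hx := repL2 x; rewrite -{2}[x]cls_rep L2add_cls//; last exact: L2N.
by congr cls; apply/funext => t; rewrite addNr.
Qed.

HB.instance Definition _ := GRing.isZmodule.Build L2space L2addA L2addC L2add0 L2addN.

Lemma L2scaleA a b x : L2scale a (L2scale b x) = L2scale (a * b) x.
Proof.
have hx := repL2 x; rewrite {2}/L2scale L2scale_cls; last exact: L2Z.
by congr cls; apply/funext => t; rewrite mulrA.
Qed.
Lemma L2scale1 : left_id 1 L2scale.
Proof.
move=> x; rewrite -[RHS]cls_rep; congr cls.
by apply/funext => t; rewrite mul1r.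
Qed.
Lemma L2scaleDr : right_distributive L2scale +%R.
Proof.
move=> a x y; have [hx hy] := conj (repL2 x) (repL2 y).
rewrite -[in LHS](cls_rep x) -[in LHS](cls_rep y) -[_ + _]/(L2add _ _).
rewrite L2add_cls// L2scale_cls; last exact: L2D.
rewrite -[RHS]/(L2add _ _) L2add_cls; [|exact: L2Z|exact: L2Z].
by congr cls; apply/funext => t; rewrite mulrDr.
Qed.
Lemma L2scaleDl x : {morph L2scale^~ x : a b / a + b}.
Proof.
move=> a b; have hx := repL2 x.
rewrite -[RHS]/(L2add _ _) L2add_cls; [|exact: L2Z|exact: L2Z].
by congr cls; apply/funext => t; rewrite mulrDl.
Qed.

HB.instance Definition _ :=
  GRing.Zmodule_isLmodule.Build C L2space L2scaleA L2scale1 L2scaleDr L2scaleDl.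

Lemma clsD f g : L2 f -> L2 g -> cls (fun t => f t + g t) = cls f + cls g.
Proof. by move=> hf hg; rewrite -L2add_cls. Qed.
Lemma clsZ a f : L2 f -> cls (fun t => a * f t) = a *: cls f.
Proof. by move=> hf; rewrite -L2scale_cls. Qed.
Lemma clsN f : L2 f -> cls (fun t => - f t) = - cls f.
Proof.
move=> hf; rewrite -scaleN1r -clsZ//; congr cls.
by apply/funext => t; rewrite mulN1r.
Qed.
Lemma clsB f g : L2 f -> L2 g -> cls (fun t => f t - g t) = cls f - cls g.
Proof. by move=> hf hg; rewrite clsD ?clsN//; exact: L2N. Qed.

Definition L2ip (x y : L2space) : C := inner mu x y.

Lemma L2ip_cls f g : L2 f -> L2 g -> L2ip (cls f) (cls g) = inner mu f g.
Proof.
move=> hf hg; apply: inner_ae; rewrite ?hf ?hg//; try exact: repL2; exact: rep_cls.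
Qed.

Lemma L2ipDl (x y z : L2space) : L2ip (x + y) z = L2ip x z + L2ip y z.
Proof.
have [hx hy hz] := And3 (repL2 x) (repL2 y) (repL2 z).
rewrite -{1}[z]cls_rep -[x + y]/(L2add x y) L2ip_cls ?innerDl//.
exact: L2D.
Qed.

Lemma L2ipZl a (x z : L2space) : L2ip (a *: x) z = a * L2ip x z.
Proof.
have [hx hz] := conj (repL2 x) (repL2 z).
rewrite -{1}[z]cls_rep -[a *: x]/(L2scale a x) L2ip_cls ?innerZl//.
exact: L2Z.
Qed.

Lemma L2ipC (x y : L2space) : L2ip y x = conjc (L2ip x y).
Proof. by apply: innerC; exact: repL2. Qed.

Lemma L2ip_ge0 (x : L2space) : 0 <= Re (L2ip x x).
Proof. by apply: inner_ge0; exact: repL2. Qed.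

Lemma L2ip_eq0 (x : L2space) : Re (L2ip x x) = 0 -> x = 0.
Proof.
move=> h; rewrite -[x]cls_rep; apply: cls_eq; [exact: repL2|exact: L2_cst0|].
by apply: inner_eq0 => //; exact: repL2.
Qed.

Lemma L2ip_complete (u : nat -> L2space) :
  (forall e : R, 0 < e -> exists N, forall m n, (N <= m)%N -> (N <= n)%N ->
     Re (L2ip (u m - u n) (u m - u n)) < e) ->
  exists l, forall e : R, 0 < e -> exists N, forall n, (N <= n)%N ->
     Re (L2ip (u n - l) (u n - l)) < e.
Proof.
have sub (x : L2space) f : L2 f ->
    L2ip (x - cls f) (x - cls f) = inner mu (fun t => x t - f t) (fun t => x t - f t).
  move=> hf; have hx := repL2 x; have hxf := L2B hx hf.
  by rewrite -{1 2}[x]cls_rep -!clsB// L2ip_cls.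
move=> cu; have [|e /cu[N hN]|l hl lim] := @L2_complete u.
- by move=> n; exact: repL2.
- exists N => m n Nm Nn; rewrite -sub; last exact: repL2.
  by rewrite cls_rep; exact: hN.
exists (cls l) => e /lim[N hN]; exists N => n Nn.
by rewrite sub//; exact: hN.
Qed.

Definition L2hilbert : hilbert R :=
  @Hilbert R L2space L2ip L2ipDl L2ipZl L2ipC L2ip_ge0 L2ip_eq0 L2ip_complete.

End ComplexL2.

(** * Koopman operators and tensors *)

Section KoopmanOperator.
Context d (Y : measurableType d) (R : realType).
Variable mu : {measure set Y -> \bar R}.
Variable phi : Y -> Y.
Hypothesis mp : measure_preserving mu phi.
Local Notation C := R[i].
Implicit Types f g : Y -> C.

Let mphi : measurable_fun [set: Y] phi. Proof. by case: mp. Qed.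

Lemma mp_ge0_integral (f : Y -> \bar R) : measurable_fun [set: Y] f ->
  (forall y, (0 <= f y)%E) -> (\int[mu]_y f (phi y) = \int[mu]_y f y)%E.
Proof.
move=> mf f0; have := ge0_integral_pushforward mphi mu measurableT mf (fun y _ => f0 y).
rewrite preimage_setT => <-; apply: eq_measure_integral => A mA _.
by case: mp => _ /(_ A mA).
Qed.

Lemma mp_integrable (u : Y -> R) : mu.-integrable [set: Y] (EFin \o u) ->
  mu.-integrable [set: Y] (EFin \o (fun y => u (phi y))).
Proof.
move=> /integrableP[mu' iu]; apply/integrableP; split.
  exact: (measurableT_comp mu' mphi).
rewrite (mp_ge0_integral (f := fun y => `|(u y)%:E|%E))//.
exact: measurableT_comp.
Qed.

Lemma mp_Rintegral (u : Y -> R) : mu.-integrable [set: Y] (EFin \o u) ->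
  \int[mu]_y u (phi y) = \int[mu]_y u y.
Proof.
move=> iu; have /integrableP[mu' _] := iu; rewrite /Rintegral; congr fine.
have := integral_pushforward mphi mu' (D := setT) _ measurableT.
rewrite preimage_setT => /(_ mu (mp_integrable iu)) <-.
apply: eq_measure_integral => A mA _.
by case: mp => _ /(_ A mA).
Qed.

Lemma mp_ae (P : Y -> Prop) : {ae mu, forall y, P y} -> {ae mu, forall y, P (phi y)}.
Proof.
move=> [A [mA A0 PA]]; exists (phi @^-1` A); split.
- by rewrite -[X in measurable X]setTI; exact: mphi.
- by case: mp => _ ->.
- by move=> y /= Py; apply: PA.
Qed.

Lemma mp_L2 f : L2 mu f -> L2 mu (fun y => f (phi y)).
Proof.
have P (u : Y -> R) : u \in Lfun mu 2%:E -> (fun y => u (phi y)) \in Lfun mu 2%:E.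
  move=> /Lfun2P[mu' iu]; apply/Lfun2P; split.
    exact: (measurableT_comp mu' mphi).
  rewrite /sqint (mp_ge0_integral (f := fun y => ((u y) ^+ 2)%:E))//.
    exact: measurable_sqr.
  by move=> y; rewrite lee_fin sqr_ge0.
by move=> [f1 f2]; split; [exact: (P _ f1)|exact: (P _ f2)].
Qed.

Lemma mp_inner f g : L2 mu f -> L2 mu g ->
  inner mu (fun y => f (phi y)) (fun y => g (phi y)) = inner mu f g.
Proof.
move=> hf hg; have [i1 i2] := L2_mul hf hg; rewrite /inner /cintegral.
by congr (_ +i* _); [exact: (mp_Rintegral i1)|exact: (mp_Rintegral i2)].
Qed.

Definition koop (x : L2hilbert mu) : L2hilbert mu := cls mu (fun y => rep x (phi y)).

(** A measure-preserving map pulls null sets back to null sets, so the operator does not depend on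
    the representative. *)
Lemma koop_cls f : L2 mu f -> koop (cls mu f) = cls mu (fun y => f (phi y)).
Proof.
move=> hf; apply: cls_eq.
- by apply: mp_L2; exact: repL2.
- exact: mp_L2.
- by apply: (mp_ae (P := fun y => cls mu f y = f y)); exact: rep_cls.
Qed.

Lemma koop_lin : lin koop.
Proof.
move=> a x y; have [hx hy] := conj (repL2 x) (repL2 y).
rewrite -{1}[x]cls_rep -{1}[y]cls_rep -clsZ// -clsD//; last exact: L2Z.
rewrite koop_cls; last by apply: L2D => //; exact: L2Z.
rewrite /koop -clsZ; last exact: mp_L2.
by rewrite -clsD//; [apply: L2Z|]; exact: mp_L2.
Qed.

Lemma ip_koop x y : ip (koop x) (koop y) = ip x y.
Proof.
rewrite /koop [LHS]L2ip_cls ?mp_inner//; try exact: repL2.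
- by apply: mp_L2; exact: repL2.
- by apply: mp_L2; exact: repL2.
Qed.

End KoopmanOperator.

(** * The product space as a tensor square *)

Section ProductSpace.
Context d (X : measurableType d) (R : realType) (mu : probability X R).
Local Notation C := R[i].
Local Notation P := (mu \x mu)%E.
Implicit Types f g : X -> C.

(** The image measure agrees with the product measure on rectangles, and these determine it. *)
Lemma prod_measure_preserving (phi psi : X -> X) :
  measure_preserving mu phi -> measure_preserving mu psi ->
  measure_preserving P (fun p => (phi p.1, psi p.2)).
Proof.
move=> [m1 p1] [m2 p2]; set F := fun p : X * X => _.
have mF : measurable_fun [set: X * X] F.
  apply: measurable_fun_pair.
  - exact: (measurableT_comp m1 measurable_fst).
  - exact: (measurableT_comp m2 measurable_snd).
split=> // A mA.
apply/esym; apply: (product_measure_unique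
  (m' := measure_function_pushforward__canonical__measure_function_Measure P mF)) => //.
move=> B D mB mD; rewrite -(p1 B)// -(p2 D)// -product_measure1E//.
- by rewrite -[X in measurable X]setTI; exact: m1.
- by rewrite -[X in measurable X]setTI; exact: m2.
Qed.

Lemma swap_measure_preserving : measure_preserving P (fun p => (p.2, p.1)).
Proof.
set F := fun p : X * X => _.
have mF : measurable_fun [set: X * X] F.
  by apply: measurable_fun_pair; [exact: measurable_snd|exact: measurable_fst].
split=> // A mA.
apply/esym; apply: (product_measure_unique
  (m' := measure_function_pushforward__canonical__measure_function_Measure P mF)) => //.
move=> B D mB mD; rewrite muleC -product_measure1E//.
have <- // : F @^-1` (B `*` D) = D `*` B.
by apply/seteqP; split=> -[a b] [].
Qed.

Lemma prod_measurable (u v : X -> R) : measurable_fun [set: X] u ->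
  measurable_fun [set: X] v ->
  measurable_fun [set: X * X] (fun p : X * X => u p.1 * v p.2).
Proof.
move=> mmu mv; apply: measurable_funM.
- exact: (measurableT_comp mmu measurable_fst).
- exact: (measurableT_comp mv measurable_snd).
Qed.

Lemma prod_ge0_integral (u v : X -> R) : measurable_fun [set: X] u ->
  measurable_fun [set: X] v -> (forall x, 0 <= u x) -> (forall x, 0 <= v x) ->
  (\int[mu]_x (v x)%:E < +oo)%E ->
  (\int[P]_p (u p.1 * v p.2)%:E = (\int[mu]_x (u x)%:E) * (\int[mu]_x (v x)%:E))%E.
Proof.
move=> mmu mv u0 v0 fv; rewrite fubini_tonelli1; last 2 first.
- by apply/measurable_EFinP; exact: prod_measurable.
- by move=> p; rewrite lee_fin mulr_ge0.
have fvE : (\int[mu]_x (v x)%:E)%E \is a fin_num.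
  by rewrite ge0_fin_numE// integral_ge0// => x _; rewrite lee_fin.
have inn x : (\int[mu]_y (u x * v y)%:E = (u x)%:E * (fine (\int[mu]_y (v y)%:E))%:E)%E.
  under eq_integral do rewrite EFinM.
  rewrite ge0_integralZl//; first by rewrite fineK.
  - exact/measurable_EFinP.
  - by move=> y _; rewrite lee_fin.
  - by rewrite lee_fin.
rewrite /fubini_F (eq_integral _ _ (fun x _ => inn x)) ge0_integralZr//.
- by rewrite fineK.
- exact/measurable_EFinP.
- by move=> y _; rewrite lee_fin.
- by rewrite lee_fin fine_ge0// integral_ge0// => x _; rewrite lee_fin.
Qed.

Lemma prod_integrable (u v : X -> R) : mu.-integrable [set: X] (EFin \o u) ->
  mu.-integrable [set: X] (EFin \o v) ->
  P.-integrable [set: X * X] (EFin \o (fun p : X * X => u p.1 * v p.2)).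
Proof.
move=> /integrableP[mmu iu] /integrableP[mv iv].
have {}mmu := (measurable_EFinP _ _).1 mmu; have {}mv := (measurable_EFinP _ _).1 mv.
apply/integrableP; split; first by apply/measurable_EFinP; exact: prod_measurable.
under eq_integral => p _ do rewrite /= normrM.
rewrite (prod_ge0_integral (u := fun x => `|u x|) (v := fun x => `|v x|))//.
- by rewrite lte_mul_pinfty// ?ge0_fin_numE// integral_ge0// => x _; rewrite lee_fin.
- exact: measurableT_comp.
- exact: measurableT_comp.
Qed.

Lemma prod_Rintegral (u v : X -> R) : mu.-integrable [set: X] (EFin \o u) ->
  mu.-integrable [set: X] (EFin \o v) ->
  \int[P]_p (u p.1 * v p.2) = (\int[mu]_x u x) * (\int[mu]_x v x).
Proof.
move=> iu iv; have iuv := prod_integrable iu iv.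
rewrite {1}/Rintegral -(integral12_prod_meas1 iuv) /fubini_F.
have fv := integrable_fin_num measurableT iv.
have fu := integrable_fin_num measurableT iu.
rewrite (_ : (\int[mu]_x _)%E = ((\int[mu]_x u x) * (\int[mu]_x v x))%:E)//.
transitivity (\int[mu]_x ((EFin \o u) x * (\int[mu]_x v x)%:E))%E.
  apply: eq_integral => x _; under eq_integral do rewrite /= EFinM.
  by rewrite integralZl//; congr (_ * _)%E; rewrite /Rintegral fineK.
by rewrite integralZr// EFinM; congr (_ * _)%E; rewrite /Rintegral fineK.
Qed.

Lemma prod_Lfun2 (u v : X -> R) : u \in Lfun mu 2%:E -> v \in Lfun mu 2%:E ->
  (fun p : X * X => u p.1 * v p.2) \in Lfun P 2%:E.
Proof.
move=> /Lfun2P[mmu iu] /Lfun2P[mv iv]; apply/Lfun2P; split; first exact: prod_measurable.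
rewrite /sqint; under eq_integral do rewrite exprMn.
rewrite (prod_ge0_integral (u := fun x => (u x) ^+ 2) (v := fun x => (v x) ^+ 2))//.
- by rewrite lte_mul_pinfty// ?ge0_fin_numE// integral_ge0// => x _; rewrite lee_fin sqr_ge0.
- exact: measurable_funX.
- exact: measurable_funX.
- by move=> x; rewrite sqr_ge0.
- by move=> x; rewrite sqr_ge0.
Qed.

Lemma prod_L2 f g : L2 mu f -> L2 mu g -> L2 P (fun p => f p.1 * g p.2).
Proof.
move=> [f1 f2] [g1 g2]; split.
- rewrite (_ : (fun p => complex.Re _) = fun p : X * X =>
    complex.Re (f p.1) * complex.Re (g p.2) + (-1) * (complex.Im (f p.1) * complex.Im (g p.2))).
    exact: Lfun2D (prod_Lfun2 f1 g1) (Lfun2Z _ (prod_Lfun2 f2 g2)).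
  by apply/funext => p; case: (f _) (g _) => [? ?] [? ?] /=; rewrite mulN1r.
- rewrite (_ : (fun p => complex.Im _) = fun p : X * X =>
    complex.Re (f p.1) * complex.Im (g p.2) + complex.Im (f p.1) * complex.Re (g p.2)).
    exact: Lfun2D (prod_Lfun2 f1 g2) (prod_Lfun2 f2 g1).
  by apply/funext => p; case: (f _) (g _) => [? ?] [? ?] /=.
Qed.

Lemma prod_cintegral (f g : X -> C) : cintegrable mu f -> cintegrable mu g ->
  cintegral P (fun p => f p.1 * g p.2) = cintegral mu f * cintegral mu g.
Proof.
move=> [f1 f2] [g1 g2]; rewrite /cintegral.
rewrite (_ : (fun p => complex.Re _) = fun p : X * X =>
  complex.Re (f p.1) * complex.Re (g p.2) - complex.Im (f p.1) * complex.Im (g p.2)); last first.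
  by apply/funext => p; case: (f _) (g _) => [? ?] [? ?].
rewrite (_ : (fun p => complex.Im _) = fun p : X * X =>
  complex.Re (f p.1) * complex.Im (g p.2) + complex.Im (f p.1) * complex.Re (g p.2)); last first.
  by apply/funext => p; case: (f _) (g _) => [? ?] [? ?].
have I1 := prod_integrable f1 g1; have I2 := prod_integrable f2 g2.
have I3 := prod_integrable f1 g2; have I4 := prod_integrable f2 g1.
rewrite RintegralB// RintegralD//.
rewrite (prod_Rintegral f1 g1) (prod_Rintegral f2 g2).
by rewrite (prod_Rintegral f1 g2) (prod_Rintegral f2 g1).
Qed.

Lemma prod_inner f g f' g' : L2 mu f -> L2 mu g -> L2 mu f' -> L2 mu g' ->
  inner P (fun p => f p.1 * g p.2) (fun p => f' p.1 * g' p.2) =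
  inner mu f f' * inner mu g g'.
Proof.
move=> hf hg hf' hg'; rewrite /inner -prod_cintegral; [|exact: L2_mul|exact: L2_mul].
by congr cintegral; apply/funext => p; rewrite conjcM; ring.
Qed.

(** The sets over which [u] integrates to 0 form a Dynkin system containing the rectangles, which
    are stable under intersection and generate the product sigma-algebra. *)
Lemma rect_integral_eq0 (u : X * X -> R) :
  P.-integrable [set: X * X] (EFin \o u) ->
  (forall A B, measurable A -> measurable B ->
     (\int[P]_(p in A `*` B) (u p)%:E = 0)%E) ->
  {ae P, forall p, u p = 0}.
Proof.
move=> iu uAB; have iuS S : measurable S -> P.-integrable S (EFin \o u).
  by move=> mS; exact: integrableS iu.
have zero S : measurable S -> (\int[P]_(p in S) (EFin \o u) p = 0)%E.
  rewrite measurable_prod_measurableType.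
  apply: (dynkin_induction (G := [set A `*` B | A in measurable & B in measurable])
    (P := fun S => (\int[P]_(p in S) (EFin \o u) p = 0)%E)).
  - exact: measurable_prod_measurableType.
  - move=> _ _ [A mA [B mB <-]] [A' mA' [B' mB' <-]].
    exists (A `&` A'); first exact: measurableI.
    by exists (B `&` B'); [exact: measurableI|rewrite setXI].
  - by rewrite -setXTT; exact: uAB.
  - by move=> _ [A mA [B mB <-]]; exact: uAB.
  - move=> E mE E0; have := uAB setT setT measurableT measurableT.
    rewrite setXTT -(setUv E) integral_setU//.
    + by move: E0 => /= ->; rewrite add0e.
    + exact: measurableC.
    + by rewrite setUv; have /integrableP[] := iu.
    + by apply/disj_setPCl.
  - move=> F mF tF F0; rewrite integral_bigcup//.
      by rewrite eseries0// => n _ _; exact: F0.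
    by apply: iuS; exact: bigcup_measurable.
have ae0 : ae_eq P setT (EFin \o u) (cst 0%E).
  apply: integral_ae_eq => //.
  by move=> E _ mE; rewrite zero// integral0.
by apply: filterS ae0 => p /(_ I) [].
Qed.

Lemma ae_fst (Q : X -> Prop) : {ae mu, forall x, Q x} -> {ae P, forall p, Q p.1}.
Proof.
move=> [A [mA A0 QA]]; exists (A `*` setT); split.
- exact: measurableX.
- transitivity (mu A * mu setT)%E; first exact: product_measure1E.
  by rewrite (_ : mu A = 0%E) ?mul0e.
- by move=> p /= Qp; split=> //; exact: QA.
Qed.

Lemma ae_snd (Q : X -> Prop) : {ae mu, forall x, Q x} -> {ae P, forall p, Q p.2}.
Proof.
move=> [A [mA A0 QA]]; exists (setT `*` A); split.
- exact: measurableX.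
- transitivity (mu setT * mu A)%E; first exact: product_measure1E.
  by rewrite [X in (_ * X)%E](_ : mu A = 0%E) ?mule0.
- by move=> p /= Qp; split=> //; exact: QA.
Qed.

Local Notation H := (L2hilbert mu).
Local Notation K := (L2hilbert P).

Definition tens (f g : H) : K := cls P (fun p => rep f p.1 * rep g p.2).

Lemma tens_cls f g : L2 mu f -> L2 mu g ->
  tens (cls mu f) (cls mu g) = cls P (fun p => f p.1 * g p.2).
Proof.
move=> hf hg; apply: cls_eq; try by apply: prod_L2 => //; exact: repL2.
have h1 := ae_fst (rep_cls hf); have h2 := ae_snd (rep_cls hg).
by apply: filterS2 h1 h2 => p -> ->.
Qed.

Lemma tens_linl (g : H) : lin (tens^~ g).
Proof.
move=> a x y; have [hx hy hg] := And3 (repL2 x) (repL2 y) (repL2 g).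
rewrite -{1}[x]cls_rep -{1}[y]cls_rep -{1}[g]cls_rep -clsZ// -clsD//; last exact: L2Z.
rewrite tens_cls//; last by apply: L2D => //; exact: L2Z.
rewrite /tens -clsZ; last exact: prod_L2.
rewrite -clsD; [|by apply: L2Z; exact: prod_L2|exact: prod_L2].
by congr cls; apply/funext => p; rewrite mulrDl mulrA.
Qed.

Lemma tens_linr (f : H) : lin (tens f).
Proof.
move=> a x y; have [hx hy hf] := And3 (repL2 x) (repL2 y) (repL2 f).
rewrite -{1}[x]cls_rep -{1}[y]cls_rep -{1}[f]cls_rep -clsZ// -clsD//; last exact: L2Z.
rewrite tens_cls//; last by apply: L2D => //; exact: L2Z.
rewrite /tens -clsZ; last exact: prod_L2.
rewrite -clsD; [|by apply: L2Z; exact: prod_L2|exact: prod_L2].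
by congr cls; apply/funext => p; rewrite mulrDr mulrCA.
Qed.

Lemma ip_tens (f g f' g' : H) : ip (tens f g) (tens f' g') = ip f f' * ip g g'.
Proof.
rewrite [LHS]L2ip_cls; first by rewrite prod_inner//; exact: repL2.
- by apply: prod_L2; exact: repL2.
- by apply: prod_L2; exact: repL2.
Qed.

Lemma L2_indic (A : set X) : measurable A -> L2 mu (fun x => (\1_A x)%:C).
Proof.
move=> mA; split; last exact: (L2_cst0 mu).2.
apply/Lfun2P; split; first exact: measurable_indic.
apply: (@le_lt_trans _ _ (mu setT)); last by rewrite probability_setT ltry.
rewrite /sqint -[leRHS]mul1e -integral_cst//; apply: ge0_le_integral => //.
- by move=> x _; rewrite lee_fin sqr_ge0.
- by apply: measurable_sqr; exact: measurable_indic.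
- by move=> x _; rewrite lee_fin /= indicE; case: (x \in A); rewrite ?expr1n ?expr0n.
Qed.

Lemma prod_setT : P [set: X * X] = 1%E.
Proof.
rewrite -setXTT; transitivity (mu setT * mu setT)%E.
  exact: product_measure1E.
have -> : mu setT = 1%E by exact: probability_setT.
by rewrite mule1.
Qed.

(** Tensors of indicators are the indicators of rectangles; pairing [w] with them gives the
    integrals of its real and imaginary parts over rectangles, to which [rect_integral_eq0]
    applies. *)
Lemma tens_total (w : K) : (forall x y : H, ip (tens x y) w = 0) -> w = 0.
Proof.
move=> hw; have hwL2 := repL2 w.
have L2AB A B : measurable A -> measurable B ->
    L2 P (fun p => (\1_A p.1)%:C * (\1_B p.2)%:C).
  by move=> mA mB; exact: prod_L2 (L2_indic mA) (L2_indic mB).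
have inn A B : measurable A -> measurable B ->
    inner P (fun p => (\1_A p.1)%:C * (\1_B p.2)%:C) w = 0.
  move=> mA mB; have := hw (cls mu (fun x => (\1_A x)%:C)) (cls mu (fun x => (\1_B x)%:C)).
  rewrite tens_cls; [|exact: L2_indic|exact: L2_indic].
  by rewrite -{1}[w]cls_rep [LHS]L2ip_cls//; exact: L2AB.
have Pfin : P [set: X * X] \is a fin_num.
  by rewrite prod_setT.
have intw (u : X * X -> R) : u \in Lfun P 2%:E -> P.-integrable [set: X * X] (EFin \o u).
  by move=> /(Lfun_subset12 Pfin)/Lfun1_integrable.
have rect (u : X * X -> R) A B : measurable A -> measurable B ->
    P.-integrable [set: X * X] (EFin \o u) ->
    \int[P]_p (\1_A p.1 * \1_B p.2 * u p) = 0 ->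
    (\int[P]_(p in A `*` B) (u p)%:E = 0)%E.
  move=> mA mB iu; have iAB := integrableS measurableT (measurableX mA mB) (@subsetT _ _) iu.
  move=> h0; rewrite -[LHS]fineK; last exact: (integrable_fin_num (measurableX mA mB) iAB).
  congr EFin; rewrite -[RHS]h0 /Rintegral; congr fine; rewrite [LHS]integral_mkcond.
  apply: eq_integral => p _; rewrite /patch /= !indicE in_setX.
  by case: (p.1 \in A); case: (p.2 \in B); rewrite ?mul1r ?mul0r.
have [w1 w2] := hwL2.
have h1 := rect_integral_eq0 (intw _ w1); have h2 := rect_integral_eq0 (intw _ w2).
rewrite -[w]cls_rep; apply: cls_eq => //; first exact: L2_cst0.
have z1 : {ae P, forall p, complex.Re (rep w p) = 0}.
  apply: h1 => A B mA mB; apply: rect => //; first exact: intw.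
  have := congr1 (@complex.Re R) (inn A B mA mB); rewrite /inner /cintegral /= => e.
  rewrite -[RHS]e; congr Rintegral; apply/funext => p.
  by case: (rep w p) => r s /=; rewrite !(mulr0, mul0r, subr0, addr0, oppr0).
have z2 : {ae P, forall p, complex.Im (rep w p) = 0}.
  apply: h2 => A B mA mB; apply: rect => //; first exact: intw.
  have := congr1 (@complex.Im R) (inn A B mA mB); rewrite /inner /cintegral /= => e.
  have [_ i2] := L2_mul (L2AB A B mA mB) hwL2.
  (* The second argument of [inner] is conjugated, so the known integral is that of minus the
     imaginary part of [w]. *)
  rewrite -[RHS](mulr0 (-1)) -[X in _ = _ * X]e -RintegralZl//.
  congr Rintegral; apply/funext => p.
  by case: (rep w p) => r s /=; rewrite !(mulr0, mul0r, subr0, addr0, oppr0); ring.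
by apply: filterS2 z1 z2 => p; case: (rep w p) => r s /= -> ->.
Qed.

Lemma koop_tens (phi psi : X -> X) (f g : H) :
  measure_preserving mu phi -> measure_preserving mu psi ->
  koop (fun p => (phi p.1, psi p.2)) (tens f g) = tens (koop phi f) (koop psi g).
Proof.
move=> mphi mpsi; rewrite tens_cls; try by apply: mp_L2 => //; exact: repL2.
rewrite koop_cls//; first exact: prod_measure_preserving.
by apply: prod_L2; exact: repL2.
Qed.

Lemma swap_tens (f g : H) : koop (fun p => (p.2, p.1)) (tens f g) = tens g f.
Proof.
rewrite koop_cls; [|exact: swap_measure_preserving|by apply: prod_L2; exact: repL2].
by congr cls; apply/funext => p; rewrite mulrC.
Qed.

End ProductSpace.

(** * The spectrum of the diagonal action *)

Section ActionsOnL2.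
Context d (Y : measurableType d) (R : realType).
Variable mu : {measure set Y -> \bar R}.
Variable S : int * int -> Y -> Y.
Hypothesis mpS : forall z, measure_preserving mu (S z).
Local Notation C := R[i].
Local Notation H := (L2hilbert mu).
Local Notation Cls f := (cls mu f : H).
Implicit Types f g h : Y -> C.

Lemma L2norm_cls f : L2 mu f -> L2norm mu f = hn (Cls f).
Proof. by move=> hf; rewrite /L2norm /hn /nsq [ip _ _]L2ip_cls. Qed.

Lemma L2_comb (s : seq ((int * int) * C)) h : L2 mu h ->
  L2 mu (fun y => \sum_(p <- s) p.2 * koopman S p.1 h y).
Proof.
move=> hh; elim: s => [|p s IH].
  rewrite (_ : (fun y => _) = fun=> 0); first exact: L2_cst0.
  by apply/funext => y; rewrite big_nil.
rewrite (_ : (fun y => _) = fun y => p.2 * koopman S p.1 h y +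
    \sum_(p <- s) p.2 * koopman S p.1 h y).
  by apply: L2D => //; apply: L2Z; exact: mp_L2.
by apply/funext => y; rewrite big_cons.
Qed.

Lemma cls_comb (s : seq ((int * int) * C)) h : L2 mu h ->
  Cls (fun y => \sum_(p <- s) p.2 * koopman S p.1 h y) =
  \sum_(p <- s) p.2 *: koop (S p.1) (Cls h).
Proof.
move=> hh; elim: s => [|p s IH].
  rewrite big_nil; congr cls; by apply/funext => y; rewrite big_nil.
rewrite big_cons -IH koop_cls// -clsZ; last exact: mp_L2.
rewrite -clsD; [|by apply: L2Z; exact: mp_L2|exact: L2_comb].
by congr cls; apply/funext => y; rewrite big_cons.
Qed.

Lemma cyclic_spanP h f : L2 mu h -> cyclic_span mu S h f <->
  L2 mu f /\ forall e : R, 0 < e -> exists s : seq ((int * int) * C),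
    hn (Cls f - \sum_(p <- s) p.2 *: koop (S p.1) (Cls h)) < e.
Proof.
move=> hh; have E (s : seq ((int * int) * C)) g : L2 mu g ->
    L2norm mu (fun y => g y - \sum_(p <- s) p.2 * koopman S p.1 h y) =
    hn (Cls g - \sum_(p <- s) p.2 *: koop (S p.1) (Cls h)).
  move=> hg; rewrite L2norm_cls; last by apply: L2B => //; exact: L2_comb.
  by rewrite clsB ?cls_comb//; exact: L2_comb.
by split=> -[hf he]; split=> // e /he[s hs]; exists s; move: hs; rewrite E.
Qed.

End ActionsOnL2.

Section Constants.
Context d (Y : measurableType d) (R : realType).
Variable mu : {measure set Y -> \bar R}.
Hypothesis mu1 : mu [set: Y] = 1%E.
Local Notation C := R[i].
Local Notation H := (L2hilbert mu).
Local Notation Cls f := (cls mu f : H).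
Implicit Types f g h : Y -> C.

Lemma L2_cst (c : C) : L2 mu (cst c).
Proof.
have P (k : R) : (fun=> k) \in Lfun mu 2%:E.
  apply/Lfun2P; split; first exact: measurable_cst.
  by rewrite /sqint integral_cst// mu1 mule1 ltry.
by split; exact: P.
Qed.

Definition one : H := Cls (cst 1).

Lemma cls_cst c : Cls (cst c) = c *: one.
Proof.
rewrite /one -clsZ; last exact: L2_cst.
by congr cls; apply/funext => y /=; rewrite mulr1.
Qed.

Lemma ip_one : ip one one = 1.
Proof.
rewrite [LHS]L2ip_cls; [|exact: L2_cst|exact: L2_cst].
rewrite /inner /cintegral /= /Rintegral.
apply/eqP; rewrite eq_complex /= !(mulr0, mul0r, mulr1, subr0, addr0, oppr0).
by rewrite !integral_cst// mu1 !mule1/= ?oppr0 !eqxx.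
Qed.

Lemma L2_0P f : L2_0 mu f <-> L2 mu f /\ ip (Cls f) one = 0.
Proof.
have E c : L2 mu f -> inner mu f (cst c) = conjc c * ip (Cls f) one.
  by move=> hf; rewrite -ipZr -cls_cst [RHS]L2ip_cls//; exact: L2_cst.
split=> [[hf h]|[hf h]]; split=> //.
  by have := h 1; rewrite E// conjc1 mul1r.
by move=> c; rewrite E// h mulr0.
Qed.

Lemma koop_one (phi : Y -> Y) : measure_preserving mu phi -> koop phi one = one.
Proof. by move=> mp; rewrite koop_cls//; exact: L2_cst. Qed.

Lemma cls_mixed (T : int * int -> Y -> Y) a b c z f :
  (forall z, measure_preserving mu (T z)) -> L2 mu f ->
  L2 mu (mixed_operator mu T a b c z f) /\
  Cls (mixed_operator mu T a b c z f) =
  Qop (fun z => koop (T z) : H -> H) one a b c z (Cls f).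
Proof.
move=> mT hf; have hk : L2 mu (koopman T z f) by exact: mp_L2.
have hT : L2 mu (Theta mu f) by exact: L2_cst.
have h1 := L2Z a%:C hf; have h2 := L2Z b%:C hk; have h3 := L2Z c%:C hT.
have h12 := L2D h1 h2; split; first exact: L2D.
rewrite /mixed_operator (clsD h12 h3) (clsD h1 h2) (clsZ _ hf) (clsZ _ hk) (clsZ _ hT).
rewrite /Qop (koop_cls (mT z) hf).
by rewrite [Cls (Theta _ _)]cls_cst [ip _ _]L2ip_cls//; exact: L2_cst.
Qed.

Lemma normc_normr (x : C) (e : R) : (`|x| < e%:C) = (Normc.normc x < e).
Proof. by rewrite -ltcR. Qed.

Lemma weak_limit_at (T : int * int -> Y -> Y) a b c z :
  (forall z, measure_preserving mu (T z)) ->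
  [/\ 0 < a, 0 < b, 0 < c & a + b + c = 1] ->
  weak_limit mu T (mixed_operator mu T a b c z) ->
  limit_at (fun z => koop (T z) : H -> H) one z.
Proof.
move=> mT [a0 b0 c0 s] [zs hzs]; exists zs, a, b, c; split=> // x y e e0.
have [hx hy] := conj (repL2 x) (repL2 y).
have [hQ clsQ] := cls_mixed a b c z mT hx.
have := hzs _ _ hx hy => /cvgrPdist_lt/(_ e%:C).
rewrite ltcR => /(_ e0)[N _ hN]; exists N => n /hN /=.
rewrite distrC normc_normr.
have e1 : ip (koop (T (zs n)) x) y = inner mu (koopman T (zs n) x) y.
  by rewrite -{1}[y]cls_rep [LHS]L2ip_cls//; exact: mp_L2.
have e2 : ip (Qop (fun z => koop (T z) : H -> H) one a b c z x) y =
    inner mu (mixed_operator mu T a b c z x) y.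
  by rewrite -{1}[x]cls_rep -clsQ -{1}[y]cls_rep [LHS]L2ip_cls.
by rewrite -e1 -e2.
Qed.

End Constants.

(** * From classes back to functions *)

Section HomogeneousSpectrumOnL2.
Context d (Y : measurableType d) (R : realType).
Variable mu : {measure set Y -> \bar R}.
Variable S : int * int -> Y -> Y.
Hypothesis mpS : forall z, measure_preserving mu (S z).
Hypothesis mu1 : mu [set: Y] = 1%E.
Local Notation H := (L2hilbert mu).
Local Notation Cls f := (cls mu f : H).

Let E v := closed_span (fun z => koop (S z) : H -> H) v.

Let spanP (v : H) f : cyclic_span mu S v f <-> L2 mu f /\ E v (Cls f).
Proof.
have := cyclic_spanP mpS f (repL2 v); rewrite [cls mu v]cls_rep.
exact.
Qed.

Let span_rep (v x : H) : E v x -> cyclic_span mu S v x.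
Proof. by move=> Ex; apply/spanP; split; [exact: repL2|rewrite [cls _ _]cls_rep]. Qed.

Let cls_sum n (c : 'I_n -> Y -> R[i]) : (forall i, L2 mu (c i)) ->
  L2 mu (fun y => \sum_i c i y) /\ Cls (fun y => \sum_i c i y) = \sum_i Cls (c i).
Proof.
elim: n c => [|n IH] c hc.
  rewrite big_ord0 (_ : (fun y => _) = fun=> 0); first by split=> //; exact: L2_cst0.
  by apply/funext => y; rewrite big_ord0.
have [h1 h2] := IH _ (fun i => hc (lift ord0 i)).
rewrite (_ : (fun y => _) = fun y => c ord0 y + \sum_i c (lift ord0 i) y); last first.
  by apply/funext => y; rewrite big_ord_recl.
by rewrite big_ord_recl -h2 (clsD (hc _) h1); split=> //; exact: L2D.
Qed.

(** [rep] and [cls] carry vectors and operators between the two settings; by [cls_inj], an identity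
    between classes is an almost everywhere identity between functions. *)
Lemma homogeneous_spectrumP n :
  homogeneous_complement (fun z => koop (S z) : H -> H) (one mu) n ->
  homogeneous_spectrum mu S n.
Proof.
move=> [v [W [orth dec hW]]]; exists (fun i => cyclic_span mu S (v i)); split.
- by move=> i; exists (v i) => //; exact: repL2.
- move=> i j ij f g /spanP[hf Ef] /spanP[hg Eg].
  by rewrite -[LHS]L2ip_cls//; exact: (orth _ _ _ _ ij Ef Eg).
- apply/seteqP; split=> f.
    move=> /(L2_0P mu1)[hf /dec[c hc fc]]; split=> //.
    exists (fun i => rep (c i)); first by move=> i; exact: (span_rep (hc i)).
    have [h1 h2] := @cls_sum n (fun i => rep (c i)) (fun i => repL2 (c i)).
    apply: (cls_inj hf h1); rewrite [RHS]h2 [LHS]fc.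
    by apply: eq_bigr => i _; rewrite [RHS]cls_rep.
  move=> [hf [c hc fc]]; apply/(L2_0P mu1); split=> //; apply/dec.
  have hcP i := (spanP (v i) (c i)).1 (hc i).
  have [h1 h2] := @cls_sum n c (fun i => (hcP i).1).
  exists (fun i => Cls (c i)); first by move=> i; exact: (hcP i).2.
  exact: (etrans (cls_eq hf h1 fc) h2).
- move=> i j; have [lW WV EW ipW surj] := hW i j.
  exists (fun f => rep (W i j (Cls f) : H)); split.
  + by move=> f /spanP[hf Ef]; exact: (span_rep (EW _ Ef)).
  + move=> a b f g /spanP[hf Ef] /spanP[hg Eg].
    have L1 := L2Z a hf; have L2' := L2Z b hg.
    have L3 := L2Z a (repL2 (W i j (Cls f))).
    have L4 := L2Z b (repL2 (W i j (Cls g))).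
    apply: (cls_inj (repL2 _) (L2D L3 L4)).
    rewrite [LHS]cls_rep (clsD L1 L2') (clsD L3 L4).
    rewrite (clsZ a hf) (clsZ b hg) (clsZ a (repL2 _)) (clsZ b (repL2 _)).
    by rewrite lW (linZ lW) [cls mu (rep (W i j (cls mu f)))]cls_rep
      [cls mu (rep (W i j (cls mu g)))]cls_rep.
  + move=> f g /spanP[hf Ef] /spanP[hg Eg].
    have e := L2ip_cls (repL2 (W i j (Cls f))) (repL2 (W i j (Cls g))).
    rewrite !cls_rep in e.
    exact: (etrans (esym e) (etrans (ipW _ _ Ef Eg) (L2ip_cls hf hg))).
  + move=> g /spanP[hg Eg]; have [x Ex Wx] := surj _ Eg; exists x; first exact: (span_rep Ex).
    apply: (cls_inj (repL2 _) hg); rewrite [LHS]cls_rep.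
    by rewrite [cls mu (rep x)]cls_rep.
  + move=> z f /spanP[hf Ef].
    apply: (cls_inj (repL2 _) (mp_L2 (mpS z) (repL2 _))).
    rewrite [LHS]cls_rep -(koop_cls (mpS z) hf) -(koop_cls (mpS z) (repL2 _)).
    by rewrite [cls mu (rep (W i j (cls mu f)))]cls_rep; exact: WV.
Qed.

End HomogeneousSpectrumOnL2.

Section MainProof.
Context d (X : measurableType d) (R : realType) (mu : probability X R).
Variable T : int * int -> X -> X.
Hypothesis hT : Z2_action mu T.
Hypothesis hsimple : simple_spectrum mu T.
Hypotheses (L10 : limit_at (fun z => koop (T z) : L2hilbert mu -> L2hilbert mu) (one mu) (1, 0))
  (L01 : limit_at (fun z => koop (T z) : L2hilbert mu -> L2hilbert mu) (one mu) (0, 1))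
  (L11 : limit_at (fun z => koop (T z) : L2hilbert mu -> L2hilbert mu) (one mu) (1, 1)).
Local Notation C := R[i].
Local Notation P := (mu \x mu)%E.
Local Notation H := (L2hilbert mu).
Local Notation K := (L2hilbert P).
Local Notation S := (diagonal_action T).

Let U z : H -> H := koop (T z).
Let V (z z' : int * int) : K -> K := koop (fun p => (T z p.1, T z' p.2)).
Let F : K -> K := koop (fun p => (p.2, p.1)).
Let o : H := one mu.
Let t : H -> H -> K := @tens _ _ _ mu.
Let oo : K := t o o.

Let mpT z : measure_preserving mu (T z). Proof. by case: hT => /(_ z)[]. Qed.
Let mpTT z z' : measure_preserving P (fun p => (T z p.1, T z' p.2)).
Proof. exact: prod_measure_preserving. Qed.
Let mpS z : measure_preserving P (S z). Proof. exact: mpTT. Qed.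
Let mpF : measure_preserving P (fun p => (p.2, p.1)).
Proof. exact: swap_measure_preserving. Qed.
Let mu1 : mu [set: X] = 1%E. Proof. exact: probability_setT. Qed.
Let P1 : P [set: X * X] = 1%E. Proof. exact: prod_setT. Qed.

Let UD z w x : U (z + w) x = U z (U w x).
Proof.
rewrite /U -[x]cls_rep; have hx := repL2 x.
rewrite !koop_cls//; last exact: mp_L2.
apply: cls_eq; first exact: mp_L2.
  exact: (mp_L2 (mpT z) (mp_L2 (mpT w) hx)).
case: hT => _ /(_ w z); apply: filterS => y /= ->.
by rewrite addrC.
Qed.

Let U_lin z : lin (U z). Proof. exact: koop_lin. Qed.
Let ip_U z x y : ip (U z x) (U z y) = ip x y. Proof. exact: ip_koop. Qed.
Let V_lin z z' : lin (V z z'). Proof. exact: koop_lin. Qed.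
Let ip_V z z' x y : ip (V z z' x) (V z z' y) = ip x y. Proof. exact: ip_koop. Qed.
Let V_t z z' f g : V z z' (t f g) = t (U z f) (U z' g).
Proof. exact: koop_tens. Qed.
Let F_lin : lin F. Proof. exact: koop_lin. Qed.
Let ip_F x y : ip (F x) (F y) = ip x y. Proof. exact: ip_koop. Qed.
Let F_t f g : F (t f g) = t g f. Proof. exact: swap_tens. Qed.
Let o1 : ip o o = 1. Proof. exact: ip_one. Qed.
Let Uo z : U z o = o. Proof. exact: koop_one. Qed.

Let hn_F x : hn (F x) = hn x. Proof. by rewrite /hn /nsq ip_F. Qed.
Let hn_U z x : hn (U z x) = hn x. Proof. by rewrite /hn /nsq ip_U. Qed.

Let ooE : oo = one P.
Proof.
rewrite /oo /t /o /one tens_cls; [|exact: L2_cst|exact: L2_cst].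
by congr cls; apply/funext => p; rewrite /= mulr1.
Qed.

Let U0 x : U 0 x = x.
Proof.
apply/eqP; rewrite -subr_eq0; apply/eqP/hn_eq0.
by rewrite -(hn_U 0) (linB (U_lin 0)) -UD addr0 subrr hn0.
Qed.

(** The generator lies in its own span, by the index 0, hence is orthogonal to constants. If [x] is
    orthogonal to the orbit and [y] is a combination of it close to [x], then [<x, x> = <x - y, x>],
    so [hn x] is at most [hn (x - y)]. *)
Let cyclic_vector : exists h : H, ip h o = 0 /\
  forall x, ip x o = 0 -> (forall z, ip (U z h) x = 0) -> x = 0.
Proof.
case: hsimple => h0 hh0 hC; exists (cls mu h0); split.
  have : L2_0 mu h0.
    rewrite hC; apply/(cyclic_spanP mpT _ hh0); split=> // e e0.
    by exists [:: (0, 1)]; rewrite big_seq1 scale1r -/(U 0) U0 subrr hn0.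
  by case/(L2_0P mu1).
move=> x xo hx; have hxL := repL2 x.
have : L2_0 mu x by apply/(L2_0P mu1); split=> //; rewrite [cls _ _]cls_rep.
rewrite hC => /(cyclic_spanP mpT _ hh0)[_]; rewrite [cls mu x]cls_rep => hs.
apply: hcvg_small => e e0; have [s h1] := hs e e0.
set y := \sum_(p <- s) _ in h1; have yx : ip y x = 0.
  by rewrite /y ip_suml big1// => p _; rewrite ipZl hx mulr0.
have [->|x0] := eqVneq (hn x) 0; first by [].
have xp : 0 < hn x by rewrite lt_def x0 hn_ge0.
apply: le_lt_trans h1; rewrite -(ler_pM2r xp) -expr2 hn_sqr.
by rewrite /nsq -[X in ip X _](subrK y) ipDl yx addr0; exact: Re_ip_le.
Qed.

Theorem homogeneous_spectrum_square : homogeneous_spectrum P S 2.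
Proof.
apply: (homogeneous_spectrumP mpS P1); rewrite -ooE.
have [h [ho h_total]] := cyclic_vector.
exact: (homogeneous_tensor_square U_lin ip_U UD
  (@tens_linl _ _ _ mu) (@tens_linr _ _ _ mu) (@ip_tens _ _ _ mu)
  (@tens_total _ _ _ mu) V_lin ip_V V_t F_lin ip_F F_t o1 Uo ho h_total L10 L01 L11).
Qed.

End MainProof.

Local Close Scope complex_scope.

Theorem mainTheorem1 (R : realType) (d : measure_display)
    (X : measurableType d) (mu : probability X R)
    (T : int * int -> X -> X)
    (hX : lebesgue_space mu)
    (hT : Z2_action mu T)
    (hTT : totally_ergodic (mu \x mu)%E (diagonal_action T))
    (hsimple : simple_spectrum mu T)
    (hlim : exists a b c : 'I_3 -> R,
      [/\ forall j, [/\ 0 < a j, 0 < b j, 0 < c j & a j + b j + c j = 1],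
          weak_limit mu T (mixed_operator mu T (a 0) (b 0) (c 0) (1, 0)),
          weak_limit mu T (mixed_operator mu T (a 1) (b 1) (c 1) (0, 1)) &
          weak_limit mu T
            (mixed_operator mu T (a 2%:R) (b 2%:R) (c 2%:R) (1, 1))]) :
  homogeneous_spectrum (mu \x mu)%E (diagonal_action T) 2.
Proof.
have mT z : measure_preserving mu (T z) by case: hT => /(_ z)[].
have mu1 : mu [set: X] = 1%E by exact: probability_setT.
case: hlim => a [b [c [abc l10 l01 l11]]].
apply: homogeneous_spectrum_square => //.
- exact: weak_limit_at l10.
- exact: weak_limit_at l01.
- exact: weak_limit_at l11.
Qed.
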